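(* Let $\widetilde\Lambda$ be a generic achronal topological circle in $\widehat{\mathrm{Ein}}_2$, preserved by a torsion-free discrete subgroup $\Gamma$ of $\widehat{SO}_0(2,2)$. Then the action of $\Gamma$ on $E(\widetilde\Lambda)$ is free and properly discontinuous, and the quotient space $\Gamma\backslash E(\widetilde\Lambda)$ is globally hyperbolic, with regular cosmological time.
   Context: Let $E=\mathbb R^4$ with $Q=-u^2-v^2+x_1^2+x_2^2$, $\mathrm{AdS}=\{Q=-1\}$ with the induced Lorentzian metric, identified with $\{[x]\in S(E):Q(x)<0\}$, where $S(E)$ is the space of rays of $E$; its boundary is $\mathrm{Ein}_2=\{[x]:Q(x)=0\}$. Let $\mathbb D^2=\{p\in S^2:p_3>0\}$ and $d$ the spherical distance. The map $\overline{\mathbb D}^2\times\mathbb R\to S(E)$, $(p,\theta)\mapsto[(\cos\theta,\sin\theta,p_1,p_2)]$ identifies $\mathbb D^2\times\mathbb R$ with the universal covering $\widetilde{\mathrm{AdS}}$ and $\partial\mathbb D^2\times\mathbb R$ with the infinite cyclic covering $\widehat{\mathrm{Ein}}_2$ of $\mathrm{Ein}_2$; time orientation: $\theta$ increasing. $\widehat{SO}_0(2,2)$ is the group of isometries of $\widetilde{\mathrm{AdS}}$ preserving orientation and time-orientation; it acts also on $\widehat{\mathrm{Ein}}_2$. An achronal topological circle $\widetilde\Lambda$ in $\widehat{\mathrm{Ein}}_2$ is the graph of a $1$-Lipschitz map $f:\partial\mathbb D^2\to\mathbb R$; it is pure lightlike if it contains two opposite points, i.e. of the form $(x,\theta),(-x,\theta+\pi)$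 (it is then contained in the past lightcone of one and the future lightcone of the other), and generic otherwise. Its invisible domain is $E(\widetilde\Lambda)=\{(x,\theta)\in\mathbb D^2\times\mathbb R:\sup_{y\in\partial\mathbb D^2}(f(y)-d(x,y))<\theta<\inf_{y\in\partial\mathbb D^2}(f(y)+d(x,y))\}$. A time-oriented spacetime $M$ is globally hyperbolic if it is strongly causal (the sets (future of $x$)$\cap$(past of $y$) form a basis of its topology) and for all $x,y$ the intersection of the causal future of $x$ and the causal past of $y$ is compact or empty. The cosmological time is $\tau(x)=\sup L(c)$ over past-oriented causal curves $c$ starting at $x$, $L(c)=\int\sqrt{-\langle c'\mid c'\rangle}\,dt$. $M$ has regular cosmological time if $\tau<\infty$ everywhere and $\lim_{t\to\infty}\tau(c(t))=0$ for every past-oriented inextendible causal curve $c:[0,+\infty[\to M$. *)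

(* Defs.v *)
From HB Require Import structures.
From mathcomp Require Import all_boot all_order all_algebra generic_quotient.
From mathcomp Require Import all_classical all_reals all_analysis.

Set Implicit Arguments.
Unset Strict Implicit.
Unset Printing Implicit Defensive.

Import Order.TTheory GRing.Theory Num.Theory.
Import numFieldNormedType.Exports.

Local Open Scope classical_set_scope.
Local Open Scope ring_scope.

Notation point3 R := ('rV[R]_3 * R)%type.

Section AntiDeSitter.
Context {R : realType}.

(* The bilinear form on R^4 of Q = -u^2 - v^2 + x1^2 + x2^2. *)
Definition bform (x y : 'rV[R]_4) : R :=
  - (x 0 0 * y 0 0) - x 0 1 * y 0 1 + x 0 2 * y 0 2 + x 0 3 * y 0 3.

Definition Q (x : 'rV[R]_4) : R := bform x x.

Definition dot (p q : 'rV[R]_3) : R := \sum_(i < 3) p 0 i * q 0 i.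

Definition sphere : set 'rV[R]_3 := [set p | dot p p = 1].

Definition sdist (p q : 'rV[R]_3) : R := acos (dot p q).

(* The open hemisphere, its closure and its boundary; 'p_3' is [p 0 2]. *)
Definition disc : set 'rV[R]_3 := [set p | sphere p /\ 0 < p 0 2].
Definition cdisc : set 'rV[R]_3 := [set p | sphere p /\ 0 <= p 0 2].
Definition circle : set 'rV[R]_3 := [set p | sphere p /\ p 0 2 = 0].

Definition ads_set : set (point3 R) := disc `*` setT.
Definition cads_set : set (point3 R) := cdisc `*` setT.

Notation AdS := (set_type ads_set).

(* The covering map of AdS = {Q = -1}: the representative in that quadric of
   the ray [(cos theta, sin theta, p_1, p_2)], on which Q = - p_3 ^ 2.  The
   metric of the universal covering is the pull-back of Q by [dev]. *)
Definition dev (z : point3 R) : 'rV[R]_4 :=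
  (z.1 0 2)^-1 *: \row_(i < 4) [:: cos z.2; sin z.2; z.1 0 0; z.1 0 1]`_i.

(* The global chart (p, theta) |-> (p_1, p_2, theta) and its inverse. *)
Definition coord (z : point3 R) : 'rV[R]_3 :=
  \row_(i < 3) [:: z.1 0 0; z.1 0 1; z.2]`_i.
Definition coord_dom : set 'rV[R]_3 := [set u | u 0 0 ^+ 2 + u 0 1 ^+ 2 < 1].
Definition chart (u : 'rV[R]_3) : point3 R :=
  (\row_(i < 3)
     [:: u 0 0; u 0 1; Num.sqrt (1 - u 0 0 ^+ 2 - u 0 1 ^+ 2)]`_i, u 0 2).

Definition metric (u v w : 'rV[R]_3) : R :=
  bform ('D_v (dev \o chart) u) ('D_w (dev \o chart) u).

(* Since the metric is conformal to ds^2 - dtheta^2, nonzero causal vectors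
   have a nonzero theta-component. *)
Definition future_causal (u v : 'rV[R]_3) : Prop :=
  metric u v v <= 0 /\ 0 < v 0 2.

Fixpoint Ck (V W : normedModType R) (n : nat) (U : set V) (f : V -> W) : Prop :=
  if n is m.+1 then
    (forall x, U x -> differentiable f x) /\
    (forall v : V, Ck m U (fun x => 'D_v f x))
  else forall x, U x -> {for x, continuous f}.

Definition smooth (V W : normedModType R) (U : set V) (f : V -> W) : Prop :=
  forall n, Ck n U f.

(* The inverse of a bijective map satisfying these conditions is smooth by the
   inverse function theorem. *)
Definition SOhat22 (phi : AdS -> AdS) : Prop :=
  bijective phi /\
  exists h : 'rV[R]_3 -> 'rV[R]_3,
    [/\ forall z : AdS, coord (\val (phi z)) = h (coord (\val z)),
        smooth coord_dom h,
        forall u v w, coord_dom u ->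
          metric (h u) ('D_v h u) ('D_w h u) = metric u v w,
        forall u, coord_dom u -> 0 < \det ('J h u) &
        forall u v, coord_dom u -> future_causal u v ->
          future_causal (h u) ('D_v h u)].

Record SOhat22_subgroup := SOhat22Subgroup {
  subgroup_set :> (AdS -> AdS) -> Prop;
  subgroup_sub : forall g, subgroup_set g -> SOhat22 g;
  subgroup_id : subgroup_set id;
  subgroup_comp : forall g h,
    subgroup_set g -> subgroup_set h -> subgroup_set (g \o h);
  subgroup_inv : forall g, subgroup_set g ->
    exists h, [/\ subgroup_set h, cancel g h & cancel h g] }.

Definition torsion_free (G : SOhat22_subgroup) : Prop :=
  forall g n, G g -> (0 < n)%N -> iter n g = id -> g = id.

(* The Lie group topology is the compact-open topology. *)
Definition discrete_subgroup (G : SOhat22_subgroup) : Prop :=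
  forall g, G g -> isolated [set h : {compact-open, AdS -> AdS} | G h] g.

(* An isometry acts on the boundary by continuous extension to the closure. *)
Definition preserves (phi : AdS -> AdS) (L : set (point3 R)) : Prop :=
  exists psi : point3 R -> point3 R,
    [/\ {within cads_set, continuous psi},
        forall z : AdS, psi (\val z) = \val (phi z) &
        psi @` L = L].

Definition lipschitz1 (f : 'rV[R]_3 -> R) : Prop :=
  forall x y, circle x -> circle y -> `|f x - f y| <= sdist x y.

Definition circle_graph (f : 'rV[R]_3 -> R) : set (point3 R) :=
  [set z | circle z.1 /\ z.2 = f z.1].

Definition achronal_circle (f : 'rV[R]_3 -> R) (L : set (point3 R)) : Prop :=
  lipschitz1 f /\ L = circle_graph f.

Definition pure_lightlike (L : set (point3 R)) : Prop :=
  exists x theta, L (x, theta) /\ L (- x, theta + pi).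

Definition invisible_domain (f : 'rV[R]_3 -> R) : set AdS := [set z |
  sup [set f y - sdist (\val z).1 y | y in circle] < (\val z).2
    < inf [set f y + sdist (\val z).1 y | y in circle]].

Definition free_action (G : SOhat22_subgroup) (D : set AdS) : Prop :=
  forall g z, G g -> D z -> g z = z -> g = id.

Definition properly_discontinuous (G : SOhat22_subgroup) (D : set AdS) : Prop :=
  forall K : set AdS, compact K -> K `<=` D ->
    finite_set [set g | G g /\ g @` K `&` K !=set0].

Section OrbitSpace.
Variables (G : SOhat22_subgroup) (D : set AdS).

Definition same_orbit (x y : D) : bool :=
  `[< exists2 g, G g & g (\val x) = \val y >].

Lemma same_orbit_equiv : equiv_class_of same_orbit.
Proof.
split=> [x|x y|y x z].
- by apply/asboolP; exists id => //; exact: subgroup_id.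
- by apply/asboolP/asboolP => -[g Gg gxy];
    have [h [Gh gK hK]] := subgroup_inv Gg; exists h => //; rewrite -gxy gK.
- move=> /asboolP[g Gg gxy] /asboolP[h Gh hyz].
  apply/asboolP; exists (h \o g); first exact: subgroup_comp.
  by rewrite /= gxy.
Qed.

Canonical same_orbit_equiv_rel := EquivRelPack same_orbit_equiv.

Definition orbit_space : topologicalType :=
  quotient_topology {eq_quot same_orbit_equiv_rel}%qT.

Definition orbit_proj : D -> orbit_space :=
  fun x => (\pi_({eq_quot same_orbit_equiv_rel}) x)%qT.

End OrbitSpace.

(* The local Lorentzian structure of M is the one for which the projection
   [pr], from an open set D of the universal covering, is a local isometry; so
   it is read on local lifts to D.  For the orbit space of a free, properly
   discontinuous action, [pr] is a covering. *)
Section Spacetime.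
Variables (D : set AdS) (M : topologicalType) (pr : D -> M).

Definition C1_curve (g : R -> point3 R) : Prop :=
  (forall s, derivable g s 1) /\ continuous (derive1 g).

Definition lifts (g : R -> point3 R) (J : set R) (c : R -> M) : Prop :=
  forall s, J s -> exists2 x : D, \val (\val x) = g s & pr x = c s.

Definition sqnorm_velocity (g : R -> point3 R) (s : R) : R :=
  Q (derive1 (dev \o g) s).

(* The boolean [past] selects the time direction. *)
Definition causal_at (past : bool) (g : R -> point3 R) (s : R) : Prop :=
  sqnorm_velocity g s <= 0 /\ 0 < (-1) ^+ past * (derive1 g s).2.

Definition timelike_at (past : bool) (g : R -> point3 R) (s : R) : Prop :=
  sqnorm_velocity g s < 0 /\ 0 < (-1) ^+ past * (derive1 g s).2.

Definition arc (K : (R -> point3 R) -> R -> Prop) (J : set R) (c : R -> M) :=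
  exists g, [/\ C1_curve g, lifts g J c & forall s, J s -> K g s].

(* Piecewise C^1 curves on the interval I, with one-sided conditions at the
   breakpoints. *)
Definition piecewise_arc (K : (R -> point3 R) -> R -> Prop) (I : set R)
    (c : R -> M) : Prop :=
  forall t, I t -> exists2 e : R, 0 < e &
    arc K (I `&` `[t - e, t]) c /\ arc K (I `&` `[t, t + e]) c.

Definition causal_curve (past : bool) := piecewise_arc (causal_at past).
Definition timelike_curve (past : bool) := piecewise_arc (timelike_at past).

Definition chronological (past : bool) (x : M) : set M := [set y |
  exists a b c, [/\ a < b, timelike_curve past `[a, b] c, c a = x & c b = y]].

Definition causal (past : bool) (x : M) : set M := [set y | x = y \/
  exists a b c, [/\ a < b, causal_curve past `[a, b] c, c a = x & c b = y]].

Definition strongly_causal : Prop :=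
  basis [set A | exists x y,
    A = chronological false x `&` chronological true y].

Definition globally_hyperbolic : Prop :=
  strongly_causal /\
  forall x y, compact (causal false x `&` causal true y).

Definition has_speed (I : set R) (c : R -> M) (s q : R) : Prop :=
  exists g, [/\ C1_curve g,
    exists2 e : R, 0 < e & lifts g (I `&` `]s - e, s + e[) c &
    q = Num.sqrt (- sqnorm_velocity g s)].

(* The value at the (locally finitely many) breakpoints is irrelevant. *)
Definition speed (I : set R) (c : R -> M) (s : R) : R :=
  get [set q | has_speed I c s q].

Definition curve_length (a b : R) (c : R -> M) : \bar R :=
  \int[lebesgue_measure]_(s in `[a, b]) (speed `[a, b] c s)%:E.

Definition cosmological_time (x : M) : \bar R :=
  ereal_sup [set l | exists a b c,
    [/\ a <= b, causal_curve true `[a, b] c, c a = x & l = curve_length a b c]].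

Definition inextendible (c : R -> M) : Prop :=
  ~ exists l : M, c t @[t --> +oo] --> l.

Definition regular_cosmological_time : Prop :=
  (forall x, (cosmological_time x < +oo)%E) /\
  forall c : R -> M, causal_curve true `[0, +oo[ c -> inextendible c ->
    cosmological_time (c t) @[t --> +oo] --> 0%E.

End Spacetime.

End AntiDeSitter.

Arguments SOhat22_subgroup R : clear implicits.

(* Main.v *)
Require Import Defs.
From mathcomp Require Import all_boot all_order all_algebra.
From mathcomp Require Import all_classical all_reals all_analysis.
From mathcomp Require Import measurable_realfun ring lra.

Set Implicit Arguments.
Unset Strict Implicit.
Unset Printing Implicit Defensive.

Import Order.TTheory GRing.Theory Num.Theory.
Import numFieldNormedType.Exports.

Local Open Scope classical_set_scope.
Local Open Scope ring_scope.

(* Causality on the cylinder is the order [adist a b <= tht b - tht a], and its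
   diamonds are a basis of the topology.  Isometries preserve this order, also
   up to the boundary, hence they preserve the invisible domain [D], which is
   the set of points chronologically between points unrelated to [L].  They are
   moreover linear in the developed coordinates, because [- <dev a, dev b>] is
   the cosine of the Lorentzian distance of close timelike related points.

   A point of [D] related to a fixed [k] in [D] has height [p_3] bounded below,
   and [theta] is bounded on [D].  So the [g] in [G] with [k <= g y] have bounded
   linear parts; were there infinitely many of them, two would be arbitrarily
   close, against discreteness.  With torsion-freeness, this finiteness gives
   that no nontrivial [g] has [z <= g z], whence freeness, proper
   discontinuity, strong causality and the compactness of the diamonds.

   For [q] on the circle let [v_q (p, theta) = theta + d(p, q) - f q].  By AM-GM
   the length of a past curve of height at least [m] is at most
   [(v_q / e + 2 e Delta theta) / (2 m)] for all [e > 0]; so the cosmological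
   time is finite, and it tends to [0] wherever some [v_q] does.  The lift of an
   inextendible past curve decreases to a limit outside [D], near which
   some [v_q] is arbitrarily small. *)

(** A group element is given only as a smooth map preserving the metric, so its linearity has to be
    extracted. A timelike geodesic of the quadric is an explicit curve of unit speed; a reverse
    Bessel inequality shows that its image joins points at least as far apart in proper time. The
    same for the inverse map gives equality, but for related pairs only. Two independent quadruples,
    one in the past of the other, then determine a matrix locally, and connectedness makes it
    global.

    A matrix determines the image of a point only up to the deck transformation of [theta]. To pass
    from close matrices to close maps, a base point is squeezed between the images of two test
    points, and the control of [theta] is carried along a path by continuity.

    Curves of the quotient are never lifted as a whole: real induction over the time interval
    patches local lifts by group elements and keeps only the relation between end points, or the
    length accumulated so far. The diamonds without return of [wandering] play the role of evenly
    covered neighbourhoods. *)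

Notation AdS R := (set_type (@ads_set R)).
Notation coord := Defs.coord.

(** * Spherical distance on the unit sphere *)

Section SphereGeometry.
Context {R : realType}.
Implicit Types (p q r : 'rV[R]_3) (z w : point3 R).

Lemma dotE p q : dot p q = p 0 0 * q 0 0 + p 0 1 * q 0 1 + p 0 2 * q 0 2.
Proof.
rewrite /dot !big_ord_recl big_ord0 addr0 addrA.
have -> : lift ord0 ord0 = 1 :> 'I_3 by apply: val_inj.
by have -> : lift ord0 (lift ord0 ord0) = 2 :> 'I_3 by apply: val_inj.
Qed.

Lemma sphereE p : sphere p <-> p 0 0 ^+ 2 + p 0 1 ^+ 2 + p 0 2 ^+ 2 = 1.
Proof. by rewrite /sphere /= dotE -!expr2. Qed.

Lemma dotC p q : dot p q = dot q p.
Proof. by rewrite !dotE; ring. Qed.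

Lemma row3P p q : p 0 0 = q 0 0 -> p 0 1 = q 0 1 -> p 0 2 = q 0 2 -> p = q.
Proof.
move=> e0 e1 e2; apply/rowP => -[[|[|[|//]]] ilt].
- by rewrite (_ : Ordinal ilt = 0) //; apply: val_inj.
- by rewrite (_ : Ordinal ilt = 1) //; apply: val_inj.
- by rewrite (_ : Ordinal ilt = 2) //; apply: val_inj.
Qed.

Lemma dot_le1 p q : sphere p -> sphere q -> `|dot p q| <= 1.
Proof.
move=> /sphereE sp /sphereE sq; rewrite dotE ler_norml.
have h1 : 0 <= (p 0 0 - q 0 0) ^+ 2 + (p 0 1 - q 0 1) ^+ 2 + (p 0 2 - q 0 2) ^+ 2.
  by rewrite !addr_ge0 ?sqr_ge0.
have h2 : 0 <= (p 0 0 + q 0 0) ^+ 2 + (p 0 1 + q 0 1) ^+ 2 + (p 0 2 + q 0 2) ^+ 2.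
  by rewrite !addr_ge0 ?sqr_ge0.
by apply/andP; split; nra.
Qed.

Lemma dot_itv p q : sphere p -> sphere q -> -1 <= dot p q <= 1.
Proof. by move=> sp sq; rewrite -ler_norml dot_le1. Qed.

Lemma sdist_ge0 p q : sphere p -> sphere q -> 0 <= sdist p q.
Proof. by move=> sp sq; rewrite acos_ge0 ?dot_itv. Qed.

Lemma sdist_lepi p q : sphere p -> sphere q -> sdist p q <= pi.
Proof. by move=> sp sq; rewrite acos_lepi ?dot_itv. Qed.

Lemma cos_sdist p q : sphere p -> sphere q -> cos (sdist p q) = dot p q.
Proof. by move=> sp sq; rewrite acosK // in_itv /= dot_itv. Qed.

Lemma sin_sdist_ge0 p q : sphere p -> sphere q -> 0 <= sin (sdist p q).
Proof. by move=> sp sq; rewrite sin_ge0_pi// sdist_ge0//= sdist_lepi. Qed.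

Lemma sdistC p q : sdist p q = sdist q p.
Proof. by rewrite /sdist dotC. Qed.

Lemma sdistxx p : sphere p -> sdist p p = 0.
Proof. by rewrite /sdist => ->; exact: acos1. Qed.

Lemma ltr_cos_0pi (x y : R) : 0 <= x <= pi -> 0 <= y <= pi ->
  (cos x < cos y) = (y < x).
Proof. by move=> hx hy; rewrite ltr_cos // in_itv. Qed.

Lemma ler_cos_0pi (x y : R) : 0 <= x <= pi -> 0 <= y <= pi ->
  (cos x <= cos y) = (y <= x).
Proof. by move=> hx hy; rewrite leNgt ltr_cos_0pi // -leNgt. Qed.

(* The Gram determinant of three vectors is the square of their determinant. *)
Lemma gram3_ge0 p q r :
  0 <= dot p p * dot q q * dot r r + 2 * (dot p q * dot q r * dot p r)
       - dot p q ^+ 2 * dot r r - dot q r ^+ 2 * dot p p - dot p r ^+ 2 * dot q q.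
Proof.
have : 0 <= (p 0 0 * (q 0 1 * r 0 2 - q 0 2 * r 0 1)
             - p 0 1 * (q 0 0 * r 0 2 - q 0 2 * r 0 0)
             + p 0 2 * (q 0 0 * r 0 1 - q 0 1 * r 0 0)) ^+ 2 by exact: sqr_ge0.
by congr (_ <= _); rewrite !dotE; ring.
Qed.

(** Nonnegativity of the Gram determinant reads [(c - a b)^2 <= (1 - a^2) (1 - b^2)], which bounds
    the cosine of the sum of the two distances by [dot p r]. If the sum exceeds [pi] there is
    nothing to prove. *)
Lemma sdist_triangle q p r : sphere p -> sphere q -> sphere r ->
  sdist p r <= sdist p q + sdist q r.
Proof.
move=> sp sq sr.
have [h|/ltW h] := leP (sdist p q + sdist q r) pi; last first.
  exact: le_trans (sdist_lepi sp sr) h.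
rewrite -ler_cos_0pi ?sdist_ge0 ?sdist_lepi //; last first.
  by rewrite h addr_ge0 ?sdist_ge0.
rewrite cosD !cos_sdist //.
have := gram3_ge0 p q r; rewrite sp sq sr !mulr1.
have := cos2Dsin2 (sdist p q); have := cos2Dsin2 (sdist q r).
rewrite !cos_sdist //.
have := sin_sdist_ge0 sp sq; have := sin_sdist_ge0 sq sr.
set s := sin _; set t := sin _; set a := dot p q; set b := dot q r.
set c := dot p r => s0 t0 e1 e2 g.
suff : - (s * t) <= c - a * b by lra.
have st : 0 <= s * t by exact: mulr_ge0.
have : (c - a * b) ^+ 2 <= (s * t) ^+ 2.
  rewrite exprMn.
  have -> : t ^+ 2 = 1 - a ^+ 2 by lra.
  have -> : s ^+ 2 = 1 - b ^+ 2 by lra.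
  by nra.
by rewrite -ler_sqrt ?sqr_ge0 // !sqrtr_sqr [X in _ <= X]ger0_norm // ler_norml => /andP[].
Qed.

Lemma sdist_lt p q (e : R) : sphere p -> sphere q -> 0 <= e <= pi ->
  cos e < dot p q -> sdist p q < e.
Proof.
by move=> sp sq he; rewrite -cos_sdist // ltr_cos_0pi // sdist_ge0 ?sdist_lepi.
Qed.

(** The left side is [4 sin^2 (x / 2)], and the sine is bounded by its argument. *)
Lemma cos_ge_sqr (x : R) : 2 - 2 * cos x <= x ^+ 2.
Proof.
have h : `|sin (x / 2)| <= `|x / 2|.
  wlog x0 : x / 0 <= x => [hw|].
    have [|/ltW] := leP 0 x; first exact: hw.
    by rewrite -oppr_ge0 => /hw; rewrite mulNr sinN !normrN.
  rewrite [X in _ <= X]ger0_norm ?divr_ge0 //.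
  have [x2|x2] := leP (x / 2) pi; last first.
    by apply: le_trans (sin_max _) _; have := @pi_ge2 R; lra.
  rewrite ger0_norm; last by rewrite sin_ge0_pi // divr_ge0.
  have [->|x2N0] := eqVneq (x / 2) 0; first by rewrite sin0.
  have x2gt0 : 0 < x / 2 by rewrite lt_neqAle eq_sym x2N0 divr_ge0.
  have [c _] := MVT x2gt0 (fun y _ => is_derive_sin y)
    (continuous_subspaceT (@continuous_sin R)).
  by rewrite sin0 !subr0 => ->; rewrite ler_piMl // ?cos_le1 // divr_ge0.
have : cos x = 1 - 2 * sin (x / 2) ^+ 2.
  have {1}-> : x = (x / 2) + (x / 2) by field.
  by rewrite cosD; have := cos2Dsin2 (x / 2); nra.
have : sin (x / 2) ^+ 2 <= (x / 2) ^+ 2.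
  by rewrite -[leLHS]real_normK ?num_real// -[leRHS]real_normK ?num_real // ler_sqr ?nnegrE.
by nra.
Qed.

(** A chord is shorter than its arc: the squared chord is [2 - 2 cos (sdist p q)]. *)
Lemma coord_le_sdist p q (i : 'I_3) : sphere p -> sphere q ->
  `|p 0 i - q 0 i| <= sdist p q.
Proof.
move=> sp sq.
have := cos_ge_sqr (sdist p q); rewrite cos_sdist // => h.
have {}h : (p 0 0 - q 0 0) ^+ 2 + (p 0 1 - q 0 1) ^+ 2 + (p 0 2 - q 0 2) ^+ 2
   <= sdist p q ^+ 2.
  move: h; move/sphereE: sp => sp; move/sphereE: sq => sq; rewrite dotE.
  by nra.
have hi : (p 0 i - q 0 i) ^+ 2 <= sdist p q ^+ 2.
  apply: le_trans h.
  have h0 := sqr_ge0 (p 0 0 - q 0 0); have h1 := sqr_ge0 (p 0 1 - q 0 1).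
  have h2 := sqr_ge0 (p 0 2 - q 0 2).
  case: i => -[|[|[|//]]] ilt.
  - rewrite (_ : Ordinal ilt = 0); [lra|exact: val_inj].
  - rewrite (_ : Ordinal ilt = 1); [lra|exact: val_inj].
  - rewrite (_ : Ordinal ilt = 2); [lra|exact: val_inj].
by move: hi; rewrite -ler_sqrt ?sqr_ge0 // !sqrtr_sqr [X in _ <= X]ger0_norm // sdist_ge0.
Qed.

Lemma sdist_eq0 p q : sphere p -> sphere q -> sdist p q = 0 -> p = q.
Proof.
move=> sp sq e; apply/rowP => i; apply/eqP; rewrite -subr_eq0 -normr_eq0.
by rewrite eq_le normr_ge0 andbT -e coord_le_sdist.
Qed.

Lemma disc_sphere p : disc p -> sphere p. Proof. by case. Qed.
Lemma circle_sphere p : circle p -> sphere p. Proof. by case. Qed.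

(** Distance [pi] would make [q] the antipode of [p], but their heights have a positive sum. *)
Lemma sdist_ltpi p q : disc p -> sphere q -> 0 <= q 0 2 -> sdist p q < pi.
Proof.
move=> [sp p3] sq q3; rewrite lt_neqAle sdist_lepi // andbT; apply/eqP => e.
have := cos_sdist sp sq; rewrite e cospi dotE.
move/sphereE: sp => sp; move/sphereE: sq => sq h.
have : (p 0 0 + q 0 0) ^+ 2 + (p 0 1 + q 0 1) ^+ 2 + (p 0 2 + q 0 2) ^+ 2 = 0 by nra.
have := sqr_ge0 (p 0 0 + q 0 0); have := sqr_ge0 (p 0 1 + q 0 1).
have : 0 < (p 0 2 + q 0 2) ^+ 2 by rewrite exprn_gt0 // ltr_wpDr.
lra.
Qed.

Lemma sdist_disc_circle p q : disc p -> circle q -> 0 < sdist p q.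
Proof.
move=> dp [sq q3]; rewrite lt_neqAle sdist_ge0 ?andbT //; last exact: disc_sphere.
apply/eqP => /esym /sdist_eq0 -/(_ (disc_sphere dp) sq) e.
by case: dp => _; rewrite e q3 ltxx.
Qed.

End SphereGeometry.

(** * The causal order of the cylinder and its topology *)

Section CausalOrder.
Context {R : realType}.
Implicit Types (p q r : 'rV[R]_3) (z w : point3 R) (a b c : AdS R).

Lemma sdist_small (e : R) : 0 < e -> exists2 d : R, 0 < d &
  forall p q, sphere p -> sphere q -> (forall i, `|p 0 i - q 0 i| < d) ->
  sdist p q < e.
Proof.
move=> e0; pose e' := Num.min e pi.
have pi0 := @pi_gt0 R.
have e'0 : 0 < e' by rewrite lt_min e0.
have e'pi : e' <= pi by rewrite ge_min lexx orbT.
have ce : cos e' < 1.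
  by rewrite -(@cos0 R) ltr_cos_0pi ?e'0 // ?(ltW e'0) ?lexx ?(ltW pi0).
(* The minimum with 1 bounds each squared difference by its absolute value; then [1 - dot p q], half
   the sum of the three squares, is below [1 - cos e']. *)
exists (Num.min 1 ((1 - cos e') / 2)).
  by rewrite lt_min ltr01 /= divr_gt0 // subr_gt0.
move=> p q sp sq h.
suff : sdist p q < e' by move/lt_le_trans; apply; rewrite ge_min lexx.
apply: sdist_lt => //; first by rewrite ltW.
have {}h i : (p 0 i - q 0 i) ^+ 2 < (1 - cos e') / 2.
  have := h i; rewrite lt_min => /andP[h1 h2].
  rewrite -real_normK ?num_real // expr2; apply: le_lt_trans h2.
  by rewrite ler_piMl // ltW.
have := h 0; have := h 1; have := h 2; move: sp sq => /sphereE sp /sphereE sq.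
rewrite dotE; nra.
Qed.

Definition cle z w := sdist z.1 w.1 <= w.2 - z.2.
Definition clt z w := sdist z.1 w.1 < w.2 - z.2.

Lemma cle_refl z : sphere z.1 -> cle z z.
Proof. by move=> sz; rewrite /cle sdistxx // subrr. Qed.

Lemma cle_trans w z y : sphere z.1 -> sphere w.1 -> sphere y.1 ->
  cle z w -> cle w y -> cle z y.
Proof.
by rewrite /cle => sz sw sy zw wy; have := sdist_triangle sz sw sy; lra.
Qed.

Lemma clt_cle_trans w z y : sphere z.1 -> sphere w.1 -> sphere y.1 ->
  clt z w -> cle w y -> clt z y.
Proof.
by rewrite /cle/clt => sz sw sy zw wy; have := sdist_triangle sz sw sy; lra.
Qed.

Lemma cle_clt_trans w z y : sphere z.1 -> sphere w.1 -> sphere y.1 ->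
  cle z w -> clt w y -> clt z y.
Proof.
by rewrite /cle/clt => sz sw sy zw wy; have := sdist_triangle sz sw sy; lra.
Qed.

Lemma cle_tle z w : sphere z.1 -> sphere w.1 -> cle z w -> z.2 <= w.2.
Proof. by rewrite /cle => sz sw; have := sdist_ge0 sz sw; lra. Qed.

Lemma clt_tlt z w : sphere z.1 -> sphere w.1 -> clt z w -> z.2 < w.2.
Proof. by rewrite /clt => sz sw; have := sdist_ge0 sz sw; lra. Qed.

Lemma ads_disc a : disc (\val a).1.
Proof. by have /set_mem[] := valP a. Qed.

Lemma ads_sphere a : sphere (\val a).1.
Proof. exact/disc_sphere/ads_disc. Qed.

Hint Extern 0 (disc _) => solve [exact: ads_disc] : core.
Hint Extern 0 (sphere _) => solve [exact: ads_sphere] : core.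

Lemma mkads_subproof p (hp : disc p) (t : R) : (p, t) \in ads_set.
Proof. by apply/mem_set; split. Qed.

Definition mkads p (hp : disc p) (t : R) : AdS R := exist _ (p, t) (mkads_subproof hp t).

Definition ashift (e : R) a : AdS R := mkads (ads_disc a) ((\val a).2 + e).

Definition tht a : R := (\val a).2.
Definition adist a b : R := sdist (\val a).1 (\val b).1.

Lemma tht_ashift (e : R) a : tht (ashift e a) = tht a + e.
Proof. by []. Qed.

Lemma adist_ashiftl (e : R) a b : adist (ashift e a) b = adist a b.
Proof. by []. Qed.

Lemma adist_ashiftr (e : R) a b : adist a (ashift e b) = adist a b.
Proof. by []. Qed.

Definition ashiftE := (tht_ashift, adist_ashiftl, adist_ashiftr).

Lemma adistxx a : adist a a = 0.
Proof. exact: sdistxx. Qed.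

Lemma adistC a b : adist a b = adist b a.
Proof. exact: sdistC. Qed.

Lemma adist_ge0 a b : 0 <= adist a b.
Proof. exact: sdist_ge0. Qed.

Lemma adist_ltpi a b : adist a b < pi.
Proof. by apply: sdist_ltpi => //; have [] := ads_disc b => _ /ltW. Qed.

Lemma adist_triangle b a c : adist a c <= adist a b + adist b c.
Proof. exact: sdist_triangle. Qed.

Lemma ads_eq a b : adist a b = 0 -> tht a = tht b -> a = b.
Proof.
move=> ab t; apply: val_inj; move: (ads_sphere a) (ads_sphere b) ab t.
rewrite /adist /tht; case: (\val a) (\val b) => [p s] [q u] /= sp sq.
by move=> /(sdist_eq0 sp sq) -> ->.
Qed.

Definition ale a b := adist a b <= tht b - tht a.
Definition alt a b := adist a b < tht b - tht a.

Lemma altW a b : alt a b -> ale a b. Proof. exact: ltW. Qed.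

Lemma ale_refl a : ale a a.
Proof. exact: cle_refl. Qed.

Lemma ale_trans b a c : ale a b -> ale b c -> ale a c.
Proof. exact: cle_trans. Qed.

Lemma alt_le_trans b a c : alt a b -> ale b c -> alt a c.
Proof. exact: clt_cle_trans. Qed.

Lemma ale_lt_trans b a c : ale a b -> alt b c -> alt a c.
Proof. exact: cle_clt_trans. Qed.

Lemma ale_tht a b : ale a b -> tht a <= tht b.
Proof. exact: cle_tle. Qed.

Lemma alt_tht a b : alt a b -> tht a < tht b.
Proof. exact: clt_tlt. Qed.

Lemma alt_ashift (e : R) a : 0 < e -> alt a (ashift e a).
Proof. by move=> e0; rewrite /alt !ashiftE adistxx; lra. Qed.

Lemma ashift_alt (e : R) a : e < 0 -> alt (ashift e a) a.
Proof. by move=> e0; rewrite /alt !ashiftE adistxx; lra. Qed.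

(** Diamonds between vertical shifts of [a] are the balls of the sum metric. Hence maps that
    preserve the order can be controlled topologically. *)
Lemma alt_diamond (e : R) a b :
  (alt (ashift (- e) a) b /\ alt b (ashift e a)) <->
  adist a b + `|tht b - tht a| < e.
Proof.
rewrite /alt !ashiftE (adistC b); split.
  by case=> h1 h2; rewrite -ltrBrDl ltr_norml; apply/andP; split; lra.
by rewrite -ltrBrDl ltr_norml => /andP[h1 h2]; split; lra.
Qed.

(** The topology inherited from the coordinates is that of the sum metric: [coord_le_sdist] compares
    in one direction and [sdist_small] in the other. *)
Lemma nbhs_ads a (U : set (AdS R)) : nbhs a U <->
  exists2 e : R, 0 < e & forall b, adist a b + `|tht b - tht a| < e -> U b.
Proof.
split.
  move=> /nbhs_ballP[e /= e0 aU]; exists e => // b h; apply: aU.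
  have d0 := adist_ge0 a b.
  have n0 := normr_ge0 (tht b - tht a).
  split; last first.
    change (`|tht a - tht b| < e).
    by rewrite distrC; lra.
  split=> // i j; rewrite (ord1 i).
  change (`|(\val a).1 0 j - (\val b).1 0 j| < e).
  have := coord_le_sdist j (ads_sphere a) (ads_sphere b); rewrite -/(adist a b).
  move: (`|_ 0 j - _|) => x; lra.
case=> e e0 aU; apply/nbhs_ballP.
have e20 : 0 < e / 2 by lra.
have [d d0 hd] := sdist_small e20.
exists (Num.min d (e / 2)); first by rewrite /= lt_min d0.
move=> b [[_ b1] b2].
have {}b1 i : `|(\val a).1 0 i - (\val b).1 0 i| < Num.min d (e / 2) := b1 0 i.
have {}b2 : `|tht a - tht b| < Num.min d (e / 2) := b2.
apply: aU.
have : adist a b < e / 2.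
  by apply: hd => // i; have := b1 i; rewrite lt_min => /andP[].
move: b2; rewrite lt_min distrC => /andP[_ h2] h1.
lra.
Qed.

Lemma nbhs_alt a b c : alt a c -> alt c b ->
  nbhs c [set d : AdS R | alt a d /\ alt d b].
Proof.
rewrite /alt => ac cb; apply/nbhs_ads.
exists (Num.min (tht c - tht a - adist a c) (tht b - tht c - adist c b)).
  by rewrite lt_min; apply/andP; split; lra.
move=> d; rewrite lt_min => /andP[h1 h2].
have t1 := adist_triangle c a d; have t2 := adist_triangle c d b.
have := ler_norm (tht d - tht c); have := ler_norm (tht c - tht d).
rewrite /= distrC (adistC d c) in t2 *; split; lra.
Qed.

End CausalOrder.

#[local] Hint Extern 0 (disc _) => solve [exact: ads_disc] : core.
#[local] Hint Extern 0 (sphere _) => solve [exact: ads_sphere] : core.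

(** * One-variable differentiation rules and mean value arguments *)

Section RealDerivatives.
Context {R : realType}.
Implicit Types (f g : R -> R) (x a b : R).

Lemma deriv1D f g x a b : is_derive x 1 f a -> is_derive x 1 g b ->
  is_derive x 1 (fun s => f s + g s) (a + b).
Proof. by move=> fa gb; exact: is_deriveD. Qed.

Lemma deriv1N f x a : is_derive x 1 f a -> is_derive x 1 (fun s => - f s) (- a).
Proof. by move=> fa; exact: is_deriveN. Qed.

Lemma deriv1B f g x a b : is_derive x 1 f a -> is_derive x 1 g b ->
  is_derive x 1 (fun s => f s - g s) (a - b).
Proof. by move=> fa gb; exact: is_deriveB. Qed.

Lemma deriv1M f g x a b : is_derive x 1 f a -> is_derive x 1 g b ->
  is_derive x 1 (fun s => f s * g s) (a * g x + f x * b).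
Proof.
move=> fa gb; have h := is_deriveM fa gb.
by apply: is_derive_eq; rewrite addrC /GRing.scale /= (mulrC (g x)).
Qed.

Lemma deriv1Ml f x a (k : R) : is_derive x 1 f a ->
  is_derive x 1 (fun s => k * f s) (k * a).
Proof. by move=> fa; exact: is_deriveZ. Qed.

Lemma deriv1_cst x a : is_derive x 1 (fun=> a) 0.
Proof. exact: is_derive_cst. Qed.

Lemma deriv1_id x : is_derive x 1 (fun s => s) 1.
Proof. exact: is_derive_id. Qed.

Lemma deriv1_comp (h : R -> R) f x a b : is_derive (f x) 1 h a -> is_derive x 1 f b ->
  is_derive x 1 (fun s => h (f s)) (a * b).
Proof. by move=> ha fb; exact: (is_derive1_comp ha fb). Qed.

Lemma deriv1V f x a : f x != 0 -> is_derive x 1 f a ->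
  is_derive x 1 (fun s => (f s)^-1) (- a / f x ^+ 2).
Proof.
move=> f0 fa; have h := is_deriveV f0 fa.
by apply: is_derive_eq; rewrite /GRing.scale /= mulNr mulrC mulNr.
Qed.

Lemma deriv1_sqrt f x a : 0 < f x -> is_derive x 1 f a ->
  is_derive x 1 (fun s => Num.sqrt (f s)) (a / (2 * Num.sqrt (f x))).
Proof.
move=> f0 fa; rewrite mulrC; apply: deriv1_comp fa.
exact: is_derive1_sqrt.
Qed.

Lemma deriv1_cos f x a : is_derive x 1 f a ->
  is_derive x 1 (fun s => cos (f s)) (- sin (f x) * a).
Proof. by move=> fa; apply: deriv1_comp fa; exact: is_derive_cos. Qed.

Lemma deriv1_sin f x a : is_derive x 1 f a ->
  is_derive x 1 (fun s => sin (f s)) (cos (f x) * a).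
Proof. by move=> fa; apply: deriv1_comp fa; exact: is_derive_sin. Qed.

Lemma deriv1_acos f x a : -1 < f x < 1 -> is_derive x 1 f a ->
  is_derive x 1 (fun s => acos (f s)) (- (Num.sqrt (1 - f x ^+ 2))^-1 * a).
Proof. by move=> fx fa; apply: deriv1_comp fa; exact: is_derive1_acos. Qed.

Lemma deriv1_atan f x a : is_derive x 1 f a ->
  is_derive x 1 (fun s => atan (f s)) ((1 + f x ^+ 2)^-1 * a).
Proof. by move=> fa; apply: deriv1_comp fa; exact: is_derive1_atan. Qed.

Lemma deriv1_continuous f x a : is_derive x 1 f a -> {for x, continuous f}.
Proof. by move=> [fx _]; apply/differentiable_continuous/derivable1_diffP. Qed.

Lemma deriv1_within f (df : R -> R) a b :
  (forall s, a <= s <= b -> is_derive s 1 f (df s)) ->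
  {within `[a, b], continuous f}.
Proof.
move=> h; apply: derivable_within_continuous => s; rewrite in_itv /= => sab.
by have [] := h s sab.
Qed.

Lemma deriv1_mvt f (df : R -> R) a b : a < b ->
  (forall s, a <= s <= b -> is_derive s 1 f (df s)) ->
  exists2 c, a < c < b & f b - f a = df c * (b - a).
Proof.
move=> ab h.
have hoo s : s \in `]a, b[ -> is_derive s 1 f (df s).
  by rewrite in_itv /= => /andP[/ltW sa /ltW sb]; apply: h; rewrite sa.
have [c] := MVT ab hoo (deriv1_within h).
by rewrite in_itv /= => cab e; exists c.
Qed.

Lemma deriv1_unique f x a b : is_derive x 1 f a -> is_derive x 1 f b -> a = b.
Proof. by move=> [_ <-] [_ <-]. Qed.

(** For identities that are known only along a path, hence only on an open interval of times. *)
Lemma deriv1_eq_oo f g x a b (u v : R) : u < x < v ->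
  (forall s, u < s < v -> f s = g s) -> is_derive x 1 f a -> is_derive x 1 g b ->
  a = b.
Proof.
move=> uxv fg fa gb; apply: (deriv1_unique _ gb).
apply: near_eq_is_derive fa.
have : x \in `]u, v[ by rewrite in_itv.
by move=> /near_in_itvoo; apply: filterS => s; rewrite in_itv /=; exact: fg.
Qed.

Lemma cos_lip (x y : R) : `|cos x - cos y| <= `|x - y|.
Proof.
wlog xy : x y / y < x => [hw|].
  have [|yx|->] := ltgtP y x; last by rewrite !subrr.
    exact: hw.
  by rewrite distrC [leRHS]distrC; exact: hw.
have [c _ ->] := deriv1_mvt xy (fun s _ => is_derive_cos s).
by rewrite normrM normrN ler_piMl // sin_max.
Qed.

End RealDerivatives.

(** * Causal curves over the sphere and the order of their ends *)

Section SphericalCurves.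
Context {R : realType}.
Variables (p dp : R -> 'rV[R]_3) (th dth : R -> R) (a b : R).
Hypothesis sp : forall s, a <= s <= b -> sphere (p s).
Hypothesis p_der : forall s i, a <= s <= b ->
  is_derive s 1 (fun t => p t 0 i) (dp s 0 i).
Hypothesis th_der : forall s, a <= s <= b -> is_derive s 1 th (dth s).

Lemma dot_deriv q s : a <= s <= b ->
  is_derive s 1 (fun t => dot q (p t)) (dot q (dp s)).
Proof.
move=> h.
have -> : (fun t => dot q (p t)) =
  (fun t => q 0 0 * p t 0 0 + q 0 1 * p t 0 1 + q 0 2 * p t 0 2).
  by apply/funext => t; rewrite dotE.
by rewrite dotE; do !apply: deriv1D; apply: deriv1Ml; exact: p_der.
Qed.

Lemma tangent s : a < s < b -> dot (p s) (dp s) = 0.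
Proof.
move=> h; have h' : a <= s <= b by case/andP: h => /ltW -> /ltW ->.
have d1 := fun i => p_der i h'.
have : is_derive s 1 (fun t => p t 0 0 * p t 0 0 + p t 0 1 * p t 0 1
     + p t 0 2 * p t 0 2) (2 * dot (p s) (dp s)).
  have := deriv1D (deriv1D (deriv1M (d1 0) (d1 0)) (deriv1M (d1 1) (d1 1)))
     (deriv1M (d1 2) (d1 2)).
  by congr is_derive; rewrite dotE; ring.
move=> /(deriv1_eq_oo h _ (deriv1_cst s 1)) h0.
suff : 2 * dot (p s) (dp s) = 0 by lra.
apply/esym/h0 => t tab; rewrite -(@sp t) ?dotE //.
by case/andP: tab => /ltW -> /ltW ->.
Qed.

(** The Gram determinant of [q], [p s] and [dp s], the last two being orthogonal. It says that the
    distance to [q] varies no faster than the curve moves. *)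
Lemma radial_speed q s : sphere q -> a < s < b ->
  dot q (dp s) ^+ 2 <= dot (dp s) (dp s) * (1 - dot q (p s) ^+ 2).
Proof.
move=> sq h; have h' : a <= s <= b by case/andP: h => /ltW -> /ltW ->.
have := gram3_ge0 q (p s) (dp s).
rewrite (tangent h) (sp h') sq; lra.
Qed.

Hypothesis causal : forall s, a < s < b ->
  dot (dp s) (dp s) <= dth s ^+ 2 /\ 0 <= dth s.

Lemma th_mono s t : a <= s -> s <= t -> t <= b -> th s <= th t.
Proof.
move=> sa; rewrite le_eqVlt => /predU1P[<- //|st] tb.
have [|c /andP[cs ct] e] := @deriv1_mvt _ th dth s t st.
  by move=> u /andP[us ut]; apply: th_der; rewrite (le_trans sa) // (le_trans ut).
have [] := @causal c; first by rewrite (le_lt_trans sa) //= (lt_le_trans ct).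
by move=> _ dc; rewrite -subr_ge0 e mulr_ge0 // subr_ge0 ltW.
Qed.

(** By [radial_speed] the distance to [p a] grows at most at the speed of the curve, hence at most
    at rate [dth]; the mean value theorem applies to the difference with [th]. *)
Lemma curve_le : a <= b -> sdist (p a) (p b) <= th b - th a.
Proof.
rewrite le_eqVlt => /predU1P[ab|ab].
  by rewrite -ab subrr sdistxx //; apply: sp; rewrite ab lexx.
have spa : sphere (p a) by apply: sp; rewrite lexx ltW.
have spb : sphere (p b) by apply: sp; rewrite lexx ltW.
have D0 : 0 <= th b - th a by rewrite subr_ge0 th_mono // ltW.
(* The factor [c < 1] keeps [acos] away from its singularities. *)
have key (c : R) : 0 <= c < 1 ->
    acos (c * dot (p a) (p b)) <= th b - th a + acos c.
  move=> /andP[c0 c1].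
  have cu s : a <= s <= b -> -1 < c * dot (p a) (p s) < 1.
    move=> /sp ss; rewrite -ltr_norml normrM ger0_norm //.
    by apply: le_lt_trans c1; rewrite ler_piMr // dot_le1.
  have dF s : a <= s <= b -> is_derive s 1
      (fun t => acos (c * dot (p a) (p t)) - th t)
      (- (Num.sqrt (1 - (c * dot (p a) (p s)) ^+ 2))^-1
         * (c * dot (p a) (dp s)) - dth s).
    move=> h; apply: deriv1B; last exact: th_der.
    by apply: deriv1_acos; [exact: cu|exact/deriv1Ml/dot_deriv].
  have [s sab] := deriv1_mvt ab dF.
  have sab' : a <= s <= b by case/andP: sab => /ltW -> /ltW ->.
  have [cs1 cs2] := causal sab.
  have w0 : 0 < 1 - (c * dot (p a) (p s)) ^+ 2.
    rewrite subr_gt0 -real_normK ?num_real // expr_lt1 // ltr_norml.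
    exact: cu.
  have le0 : - (Num.sqrt (1 - (c * dot (p a) (p s)) ^+ 2))^-1
         * (c * dot (p a) (dp s)) - dth s <= 0.
    rewrite subr_le0 mulNr -mulrN mulrC ler_pdivrMr ?sqrtr_gt0 //.
    apply: le_trans (ler_norm _) _.
    have -> : `|- (c * dot (p a) (dp s))| = Num.sqrt ((c * dot (p a) (dp s)) ^+ 2).
      by rewrite sqrtr_sqr normrN.
    rewrite -[dth s]ger0_norm // -sqrtr_sqr -sqrtrM ?sqr_ge0 // ler_sqrt; last first.
      by rewrite mulr_ge0 ?sqr_ge0 // ltW.
    have rs := radial_speed spa sab.
    have dd : 0 <= dot (dp s) (dp s) by rewrite dotE; nra.
    have u1 : dot (p a) (p s) ^+ 2 <= 1.
      by rewrite -real_normK ?num_real // expr_le1 //; apply: dot_le1 => //; exact: sp.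
    rewrite exprMn.
    have cc : c ^+ 2 <= 1 by rewrite expr_le1 // ltW.
    have h1 : c ^+ 2 * dot (p a) (dp s) ^+ 2 <=
       c ^+ 2 * (dot (dp s) (dp s) * (1 - dot (p a) (p s) ^+ 2)).
      by rewrite ler_wpM2l // sqr_ge0.
    apply: (le_trans h1).
    apply: (@le_trans _ _ (dot (dp s) (dp s) * (1 - (c * dot (p a) (p s)) ^+ 2))).
      rewrite mulrCA ler_wpM2l // exprMn; nra.
    by rewrite ler_wpM2r // ltW.
  have -> : dot (p a) (p a) = 1 by exact: spa.
  rewrite mulr1 => e.
  have : (- (Num.sqrt (1 - (c * dot (p a) (p s)) ^+ 2))^-1
         * (c * dot (p a) (dp s)) - dth s) * (b - a) <= 0.
    by rewrite mulr_le0_ge0 // subr_ge0 ltW.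
  lra.
have [h|h] := leP pi (th b - th a).
  exact: le_trans (sdist_lepi spa spb) h.
suff cle : cos (th b - th a) <= dot (p a) (p b).
  rewrite -ler_cos_0pi ?sdist_ge0 ?sdist_lepi ?D0 ?(ltW h) //.
  by rewrite cos_sdist.
apply/ler_addgt0Pr => e e0.
(* With [c = cos d] the error [acos c] is [d]. The bounds keep [th b - th a + d] at most [pi] and
   make the total error, at most [3 d / 2], smaller than [e]. *)
pose d := Num.min (Num.min e 1 / 2) (pi - (th b - th a)).
have d0 : 0 < d.
  by rewrite lt_min subr_gt0 h andbT divr_gt0 // lt_min e0 ltr01.
have de : d <= Num.min e 1 / 2 by rewrite ge_min lexx.
have dpi : d <= pi - (th b - th a) by rewrite ge_min lexx orbT.
have m1 : Num.min e 1 <= e by rewrite ge_min lexx.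
have m2 : Num.min e 1 <= 1 by rewrite ge_min lexx orbT.
have dpi2 : 0 < d < pi / 2.
  by rewrite d0 /=; have := @pi_ge2 R; lra.
have cd0 : 0 <= cos d < 1.
  have p2 := @pi_ge2 R; case/andP: dpi2 => d1 d2.
  apply/andP; split; first by apply/ltW/cos_gt0_pihalf; lra.
  by rewrite -(@cos0 R) ltr_cos_0pi //; lra.
have := key _ cd0; rewrite cosK; last first.
  by rewrite in_itv /=; have := @pi_ge2 R; lra.
have cdu : -1 <= cos d * dot (p a) (p b) <= 1.
  rewrite -ler_norml normrM mulr_ile1 ?normr_ge0 ?cos_max //.
  exact: dot_le1.
rewrite -ler_cos_0pi ?acos_ge0 ?acos_lepi //; last by lra.
rewrite acosK ?in_itv // => h1.
have := cos_lip (th b - th a + d) (th b - th a).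
have -> : th b - th a + d - (th b - th a) = d by ring.
rewrite (gtr0_norm d0) ler_norml => /andP[h2 _].
have h3 := cos_ge_sqr d.
have h4 := dot_itv spa spb.
have h5 : d ^+ 2 <= d by rewrite expr2 ler_piMl; lra.
have h6 : 0 <= (1 - cos d) * (1 + dot (p a) (p b)) by rewrite mulr_ge0; lra.
lra.
Qed.

End SphericalCurves.

(** Equality at the ends forces equality at all times, so [cos (th s - th a) = dot (p a) (p s)].
    Differentiating this and using [radial_speed] gives a speed of at least [dth], a
    contradiction. *)
Lemma curve_lt {R : realType} (p dp : R -> 'rV[R]_3) (th dth : R -> R) (a b : R) :
  (forall s, a <= s <= b -> sphere (p s)) ->
  (forall s i, a <= s <= b -> is_derive s 1 (fun t => p t 0 i) (dp s 0 i)) ->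
  (forall s, a <= s <= b -> is_derive s 1 th (dth s)) ->
  (forall s, a < s < b -> dot (dp s) (dp s) < dth s ^+ 2 /\ 0 < dth s) ->
  a < b -> sdist (p a) (p b) < th b - th a.
Proof.
move=> sp pd td tl ab.
have sub s t (u : R) : a <= s -> t <= b -> s <= u <= t -> a <= u <= b.
  by move=> sa tb /andP[us ut]; rewrite (le_trans sa us) (le_trans ut tb).
have sub' s t (u : R) : a <= s -> t <= b -> s < u < t -> a < u < b.
  by move=> sa tb /andP[us ut]; rewrite (le_lt_trans sa us) (lt_le_trans ut tb).
have cl s t : a <= s -> s <= t -> t <= b -> sdist (p s) (p t) <= th t - th s.
  move=> sa st tb; apply: (@curve_le _ p dp th dth s t) => //.
  - by move=> u /(sub _ _ _ sa tb); exact: sp.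
  - by move=> u i /(sub _ _ _ sa tb); exact: pd.
  - by move=> u /(sub _ _ _ sa tb); exact: td.
  - by move=> u /(sub' _ _ _ sa tb) /tl [/ltW h /ltW h'].
rewrite lt_neqAle cl ?lexx // ?ltW // andbT; apply/eqP => e.
have ba : a <= b by exact: ltW.
have eqs s : a <= s <= b -> sdist (p a) (p s) = th s - th a.
  move=> /andP[sa sb]; apply/eqP; rewrite eq_le cl //=.
  have h1 := cl s b sa sb (lexx _).
  have [spa sps spb] : [/\ sphere (p a), sphere (p s) & sphere (p b)].
    by split; apply: sp; rewrite ?lexx ?sa ?sb ?ba.
  have := sdist_triangle spa sps spb; lra.
have thlt s t : a <= s -> s < t -> t <= b -> th s < th t.
  move=> sa st tb.
  have [|c /andP[cs ct] ec] := @deriv1_mvt _ th dth s t st.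
    by move=> u; move/(sub _ _ _ sa tb); exact: td.
  have [] := tl c; first by apply: (sub' _ _ _ sa tb); rewrite cs.
  by move=> _ dc; rewrite -subr_gt0 ec mulr_gt0 // subr_gt0.
(* At an interior time [0 < th m - th a < pi], so the sine produced by differentiation can be
   cancelled. *)
pose m := (a + b) / 2.
have mab : a < m < b by rewrite /m; lra.
have mab' : a <= m <= b by case/andP: mab => /ltW -> /ltW ->.
have spa : sphere (p a) by apply: sp; rewrite lexx.
have [am mb] : a < m /\ m < b by apply/andP.
have := deriv1_cos (deriv1B (td m mab') (deriv1_cst m (th a))).
rewrite subr0.
move=> /(deriv1_eq_oo mab _ (dot_deriv pd (p a) mab')) => h.
have {}h : - sin (th m - th a) * dth m = dot (p a) (dp m).
  apply/esym/h => s sab; have sab' : a <= s <= b by case/andP: sab => /ltW -> /ltW ->.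
  by rewrite -cos_sdist ?eqs //; exact: sp.
have rs := radial_speed sp pd spa mab.
have [ts t0] := tl m mab.
have : 0 < sin (th m - th a).
  rewrite sin_gt0_pi // subr_gt0 thlt //= ?lexx ?ltW //.
  have := sdist_lepi spa (sp b _); rewrite e lexx ba => /(_ isT).
  have := thlt m b; rewrite lexx (ltW am) mb => /(_ isT isT isT); lra.
have cm : dot (p a) (p m) = cos (th m - th a).
  by rewrite -eqs // cos_sdist //; exact: sp.
move: rs; rewrite -h cm -sin2cos2 exprMn sqrrN mulrC.
set S := sin _ => rs S0.
have S2 : 0 < S ^+ 2 by rewrite exprn_gt0.
by move: rs; rewrite ler_pM2r // leNgt ts.
Qed.

(** * The chart and the conformal form of the metric *)

Section Chart.
Context {R : realType}.
Implicit Types (u v w : 'rV[R]_3) (a b : AdS R).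

Lemma row4P (x y : 'rV[R]_4) : x 0 0 = y 0 0 -> x 0 1 = y 0 1 ->
  x 0 2 = y 0 2 -> x 0 3 = y 0 3 -> x = y.
Proof.
move=> e0 e1 e2 e3; apply/rowP => -[[|[|[|[|//]]]] ilt].
- by rewrite (_ : Ordinal ilt = 0) //; apply: val_inj.
- by rewrite (_ : Ordinal ilt = 1) //; apply: val_inj.
- by rewrite (_ : Ordinal ilt = 2) //; apply: val_inj.
- by rewrite (_ : Ordinal ilt = 3) //; apply: val_inj.
Qed.

Definition row3 (x y z : R) : 'rV[R]_3 := \row_(i < 3) [:: x; y; z]`_i.
Definition row4 (x y z t : R) : 'rV[R]_4 := \row_(i < 4) [:: x; y; z; t]`_i.

Lemma row3E x y z : (row3 x y z 0 0 = x) * (row3 x y z 0 1 = y) * (row3 x y z 0 2 = z).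
Proof. by rewrite !mxE. Qed.

Lemma row4E x y z t : (row4 x y z t 0 0 = x) * (row4 x y z t 0 1 = y) *
  (row4 x y z t 0 2 = z) * (row4 x y z t 0 3 = t).
Proof. by rewrite !mxE. Qed.

Lemma devE (z : point3 R) : (dev z 0 0 = (z.1 0 2)^-1 * cos z.2) *
  (dev z 0 1 = (z.1 0 2)^-1 * sin z.2) * (dev z 0 2 = (z.1 0 2)^-1 * z.1 0 0) *
  (dev z 0 3 = (z.1 0 2)^-1 * z.1 0 1).
Proof. by rewrite !mxE. Qed.

Definition height u : R := Num.sqrt (1 - u 0 0 ^+ 2 - u 0 1 ^+ 2).
Definition dheight u v : R := - (u 0 0 * v 0 0 + u 0 1 * v 0 1) / height u.
(** Velocity in R^3 of the hemisphere point whose chart coordinates [u] move with velocity [v]. *)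
Definition dpos u v : 'rV[R]_3 := row3 (v 0 0) (v 0 1) (dheight u v).

Lemma height_gt0 u : coord_dom u -> 0 < height u.
Proof. by rewrite /coord_dom /= => h; rewrite sqrtr_gt0; lra. Qed.

Lemma height_sqr u : coord_dom u -> height u ^+ 2 = 1 - u 0 0 ^+ 2 - u 0 1 ^+ 2.
Proof. by rewrite /coord_dom /= => h; rewrite sqr_sqrtr //; lra. Qed.

Lemma chartE u : ((chart u).1 0 0 = u 0 0) * ((chart u).1 0 1 = u 0 1) *
  ((chart u).1 0 2 = height u) * ((chart u).2 = u 0 2).
Proof. by rewrite !mxE. Qed.

Lemma coordE (z : point3 R) : (coord z 0 0 = z.1 0 0) * (coord z 0 1 = z.1 0 1) *
  (coord z 0 2 = z.2).
Proof. by rewrite !mxE. Qed.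

Lemma chart_disc u : coord_dom u -> disc (chart u).1.
Proof.
move=> h; split; last by rewrite chartE height_gt0.
by apply/sphereE; rewrite !chartE height_sqr //; ring.
Qed.

Lemma coord_in_dom (z : point3 R) : disc z.1 -> coord_dom (coord z).
Proof.
move=> [/sphereE s p]; rewrite /coord_dom /= !coordE -s ltrDl exprn_gt0 //.
Qed.

Lemma coordK (z : point3 R) : disc z.1 -> chart (coord z) = z.
Proof.
case: z => p t dp; congr pair; last by rewrite coordE.
apply: row3P; rewrite ?chartE ?coordE //.
have [/sphereE s p0] := dp.
rewrite /height !coordE -[RHS]gtr0_norm // -sqrtr_sqr; congr Num.sqrt; rewrite /=; lra.
Qed.

Definition adsof u (hu : coord_dom u) : AdS R := mkads (chart_disc hu) (u 0 2).

Lemma val_adsof u (hu : coord_dom u) : \val (adsof hu) = chart u.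
Proof. by []. Qed.

Lemma open_coord_dom : open (@coord_dom R).
Proof.
have -> : @coord_dom R =
    (fun u => u 0 0 * u 0 0 + u 0 1 * u 0 1) @^-1` [set x | x < 1].
  by apply/funext => u; rewrite /coord_dom /= !expr2.
have /continuousP : continuous (fun u : 'rV[R]_3 => u 0 0 * u 0 0 + u 0 1 * u 0 1).
  move=> u; have cc i : (fun v : 'rV[R]_3 => v 0 i) v @[v --> u] --> u 0 i.
    exact: coord_continuous.
  exact: cvgD (cvgM (cc 0) (cc 0)) (cvgM (cc 1) (cc 1)).
by apply; exact: open_lt.
Qed.

(* [dF u v] is the differential of [dev \o chart] at [u], applied to [v]. *)
Definition dF u v : 'rV[R]_4 :=
  let r := height u in let r' := dheight u v in
  row4 (- sin (u 0 2) * v 0 2 / r - cos (u 0 2) * r' / r ^+ 2)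
       (cos (u 0 2) * v 0 2 / r - sin (u 0 2) * r' / r ^+ 2)
       (v 0 0 / r - u 0 0 * r' / r ^+ 2)
       (v 0 1 / r - u 0 1 * r' / r ^+ 2).

Section Curve.
Variables (c : R -> 'rV[R]_3) (w : 'rV[R]_3) (t : R).
Hypothesis dc : forall i, is_derive t 1 (fun s => c s 0 i) (w 0 i).
Hypothesis ct : coord_dom (c t).

Lemma height_deriv : is_derive t 1 (fun s => height (c s)) (dheight (c t) w).
Proof.
have h0 := height_gt0 ct.
have p0 : 0 < 1 - c t 0 0 ^+ 2 - c t 0 1 ^+ 2.
  by move: ct; rewrite /coord_dom /=; lra.
have := deriv1_sqrt (f := fun s => 1 - c s 0 0 * c s 0 0 - c s 0 1 * c s 0 1) _
  (deriv1B (deriv1B (deriv1_cst t 1) (deriv1M (dc 0) (dc 0))) (deriv1M (dc 1) (dc 1))).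
rewrite -!expr2 => /(_ p0); rewrite -/(height (c t)).
have -> : (fun s => Num.sqrt (1 - c s 0 0 * c s 0 0 - c s 0 1 * c s 0 1)) =
          (fun s => height (c s)) by apply/funext => s; rewrite /height !expr2.
by congr is_derive; rewrite /dheight; field; rewrite gt_eqF.
Qed.

Lemma chart_deriv i : is_derive t 1 (fun s => (chart (c s)).1 0 i) (dpos (c t) w 0 i).
Proof.
case: i => -[|[|[|//]]] ilt.
- rewrite (_ : Ordinal ilt = 0); last exact: val_inj.
  rewrite row3E; have := dc 0; congr is_derive.
  by apply/funext => s; rewrite chartE.
- rewrite (_ : Ordinal ilt = 1); last exact: val_inj.
  rewrite row3E; have := dc 1; congr is_derive.
  by apply/funext => s; rewrite chartE.
- rewrite (_ : Ordinal ilt = 2); last exact: val_inj.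
  rewrite row3E; have := height_deriv; congr is_derive.
  by apply/funext => s; rewrite chartE.
Qed.

Lemma dev_deriv i : is_derive t 1 (fun s => dev (chart (c s)) 0 i) (dF (c t) w 0 i).
Proof.
have h0 := height_gt0 ct.
have hV := deriv1V (f := fun s => height (c s)) (lt0r_neq0 h0) height_deriv.
case: i => -[|[|[|[|//]]]] ilt.
- rewrite (_ : Ordinal ilt = 0); last exact: val_inj.
  rewrite row4E; have := deriv1M hV (deriv1_cos (dc 2)).
  have -> : (fun s => dev (chart (c s)) 0 0) = (fun s => (height (c s))^-1 * cos (c s 0 2)).
    by apply/funext => s; rewrite devE !chartE.
  by congr is_derive; field; rewrite gt_eqF.
- rewrite (_ : Ordinal ilt = 1); last exact: val_inj.
  rewrite row4E; have := deriv1M hV (deriv1_sin (dc 2)).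
  have -> : (fun s => dev (chart (c s)) 0 1) = (fun s => (height (c s))^-1 * sin (c s 0 2)).
    by apply/funext => s; rewrite devE !chartE.
  by congr is_derive; field; rewrite gt_eqF.
- rewrite (_ : Ordinal ilt = 2); last exact: val_inj.
  rewrite row4E; have := deriv1M hV (dc 0).
  have -> : (fun s => dev (chart (c s)) 0 2) = (fun s => (height (c s))^-1 * c s 0 0).
    by apply/funext => s; rewrite devE !chartE.
  by congr is_derive; field; rewrite gt_eqF.
- rewrite (_ : Ordinal ilt = 3); last exact: val_inj.
  rewrite row4E; have := deriv1M hV (dc 1).
  have -> : (fun s => dev (chart (c s)) 0 3) = (fun s => (height (c s))^-1 * c s 0 1).
    by apply/funext => s; rewrite devE !chartE.
  by congr is_derive; field; rewrite gt_eqF.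
Qed.

End Curve.

(** Reduces the directional derivatives in [metric] to derivatives along a line, where the
    one-variable rules apply. *)
Lemma is_derive_line (V : normedModType R) (W : normedModType R) (G : V -> W) (u v : V) (l : W) :
  is_derive (0 : R) 1 (fun s : R => G (u + s *: v)) l -> is_derive u v G l.
Proof.
move=> [dG eG].
have e : (fun h : R => h^-1 *: ((G \o shift u) (h *: v) - G u)) =
  (fun h : R => h^-1 *: (((fun s : R => G (u + s *: v)) \o shift 0) (h *: 1) -
     (fun s : R => G (u + s *: v)) 0)).
  apply/funext => h; rewrite /= scale0r !addr0 (addrC u).
  by have -> : h *: (1 : R) = h by exact: mulr1.
split; first by rewrite /derivable e.
by rewrite /derive e.
Qed.

Lemma is_derive_mx m n (V : normedModType R) (M : V -> 'M[R]_(m, n)) (x v : V) (A : 'M[R]_(m, n)) :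
  (forall i j, is_derive x v (fun y => M y i j) (A i j)) -> is_derive x v M A.
Proof.
move=> h; have dM : derivable M x v by apply/derivable_mxP => i j; have [] := h i j.
split=> //; rewrite derive_mx //; apply/matrixP => i j; rewrite mxE.
by have [] := h i j.
Qed.

Lemma is_derive_mxP m n (V : normedModType R) (M : V -> 'M[R]_(m, n)) (x v : V) (A : 'M[R]_(m, n)) :
  is_derive x v M A -> forall i j, is_derive x v (fun y => M y i j) (A i j).
Proof.
move=> [dM eM] i j; split; first by move/derivable_mxP : dM; exact.
by move: eM; rewrite derive_mx // => /matrixP /(_ i j); rewrite mxE.
Qed.

Lemma derive_dev u v : coord_dom u -> 'D_v (dev \o chart) u = dF u v.
Proof.
move=> hu; suff [] : is_derive u v (dev \o chart) (dF u v) by [].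
apply: is_derive_line; apply: is_derive_mx => i j; rewrite (ord1 i).
have := @dev_deriv (fun s => u + s *: v) v 0 _ _ j.
rewrite scale0r addr0; apply => // k.
have := deriv1D (deriv1_cst 0 (u 0 k)) (deriv1M (deriv1_id 0) (deriv1_cst 0 (v 0 k))).
have -> : (fun s => (u + s *: v) 0 k) = (fun s => u 0 k + s * v 0 k).
  by apply/funext => s; rewrite !mxE.
by congr is_derive; ring.
Qed.

(** Write [dev = X / r] with [r] the height, so that [Q X = - r^2]. Then
    [Q (dev') = (Q X' + r'^2) / r^2], and [r'^2] completes the planar part of [Q X'] to the
    spherical norm: the metric is conformal to that of the cylinder. *)
Lemma Q_dF u v : coord_dom u ->
  Q (dF u v) = (dot (dpos u v) (dpos u v) - v 0 2 ^+ 2) / height u ^+ 2.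
Proof.
move=> hu; have h0 := height_gt0 hu; have h2 := height_sqr hu.
rewrite dotE /Q /bform !row4E !row3E.
have hd : height u * dheight u v = - (u 0 0 * v 0 0 + u 0 1 * v 0 1).
  by rewrite /dheight; field; rewrite gt_eqF.
have cs := cos2Dsin2 (u 0 2).
move: (height u) (dheight u v) (cos (u 0 2)) (sin (u 0 2)) h0 h2 hd cs => r r' C S.
move: (u 0 0) (u 0 1) (v 0 0) (v 0 1) (v 0 2) => x y vx vy vt r0 h2 hd cs.
have rN0 : r != 0 by rewrite gt_eqF.
have -> : - ((- S * vt / r - C * r' / r ^+ 2) * (- S * vt / r - C * r' / r ^+ 2)) -
  (C * vt / r - S * r' / r ^+ 2) * (C * vt / r - S * r' / r ^+ 2) +
  (vx / r - x * r' / r ^+ 2) * (vx / r - x * r' / r ^+ 2) +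
  (vy / r - y * r' / r ^+ 2) * (vy / r - y * r' / r ^+ 2) =
  ((vx ^+ 2 + vy ^+ 2) * r ^+ 2 - 2 * r * r' * (x * vx + y * vy)
   + r' ^+ 2 * (x ^+ 2 + y ^+ 2) - (C ^+ 2 + S ^+ 2) * (vt ^+ 2 * r ^+ 2 + r' ^+ 2)) / r ^+ 4.
  by field.
rewrite cs (_ : x * vx + y * vy = - (r * r')); last by rewrite hd opprK.
rewrite (_ : x ^+ 2 + y ^+ 2 = 1 - r ^+ 2); last by rewrite h2; ring.
by field.
Qed.

Lemma metricE u v : coord_dom u ->
  metric u v v = (dot (dpos u v) (dpos u v) - v 0 2 ^+ 2) / height u ^+ 2.
Proof. by move=> hu; rewrite /metric derive_dev // -Q_dF. Qed.

End Chart.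

(** * Great-circle arcs in the hemisphere *)

Section GreatArc.
Context {R : realType}.
Variables (p q : 'rV[R]_3).
Hypotheses (sp : sphere p) (sq : sphere q) (dpq : sdist p q < pi).
Let d := sdist p q.

(** Gram-Schmidt: the unit vector orthogonal to [p] in the plane of [p] and [q]. If [d = 0] it is
    the zero vector and the arc below is constant. *)
Definition gperp : 'rV[R]_3 := (sin d)^-1 *: (q - cos d *: p).
Definition garc (s : R) : 'rV[R]_3 := cos (s * d) *: p + sin (s * d) *: gperp.
Definition dgarc (s : R) : 'rV[R]_3 :=
  (d * - sin (s * d)) *: p + (d * cos (s * d)) *: gperp.

Lemma garc_deriv (s : R) i : is_derive s 1 (fun t => garc t 0 i) (dgarc s 0 i).
Proof.
have hd := deriv1M (deriv1_id s) (deriv1_cst s d).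
have := deriv1D (deriv1M (deriv1_cos hd) (deriv1_cst s (p 0 i)))
   (deriv1M (deriv1_sin hd) (deriv1_cst s (gperp 0 i))).
have -> : (fun t => garc t 0 i) =
  (fun t => cos (t * d) * p 0 i + sin (t * d) * gperp 0 i).
  by apply/funext => t; rewrite !mxE.
by congr is_derive; rewrite !mxE; ring.
Qed.

Lemma sin_sdist_gt0 : 0 < d -> 0 < sin d.
Proof. by move=> d0; rewrite sin_gt0_pi // d0. Qed.

Lemma garc0 : garc 0 = p.
Proof. by rewrite /garc mul0r cos0 sin0 scale1r scale0r addr0. Qed.

Lemma garc_const : d = 0 -> p = q /\ garc = fun=> p.
Proof.
move=> d0; split; first exact: sdist_eq0.
by apply/funext => s; rewrite /garc d0 mulr0 cos0 sin0 scale1r scale0r addr0.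
Qed.

Lemma garc1 : garc 1 = q.
Proof.
have [d0|d0] := eqVneq d 0.
  by have [<- ->] := garc_const d0.
have : 0 < sin d by rewrite sin_sdist_gt0 // lt_neqAle eq_sym d0 sdist_ge0.
by move=> s0; rewrite /garc mul1r scalerA divff ?gt_eqF // scale1r addrC subrK.
Qed.

Lemma gperp_ortho : dot p gperp = 0.
Proof.
have -> : dot p gperp = (sin d)^-1 * (dot p q - cos d * dot p p).
  by rewrite !dotE !mxE; ring.
by rewrite cos_sdist // (sp : dot p p = 1) mulr1 subrr mulr0.
Qed.

Lemma gperp_norm : 0 < d -> dot gperp gperp = 1.
Proof.
move=> /sin_sdist_gt0 d0.
have -> : dot gperp gperp =
  (sin d)^-1 ^+ 2 * (dot q q - 2 * cos d * dot p q + cos d ^+ 2 * dot p p).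
  by rewrite !dotE !mxE; ring.
rewrite (sq : dot q q = 1) (sp : dot p p = 1) cos_sdist //.
have := sin2cos2 d; rewrite cos_sdist // exprVn => e.
rewrite (_ : 1 - _ + _ = sin d ^+ 2); last by rewrite e; ring.
by rewrite mulVf // expf_neq0 // gt_eqF.
Qed.

Lemma garc_sphere s : sphere (garc s).
Proof.
have [d0|d0] := eqVneq d 0.
  by have [_ ->] := garc_const d0.
have {}d0 : 0 < d by rewrite lt_neqAle eq_sym d0 sdist_ge0.
have : dot (garc s) (garc s) = cos (s * d) ^+ 2 * dot p p
  + 2 * cos (s * d) * sin (s * d) * dot p gperp + sin (s * d) ^+ 2 * dot gperp gperp.
  by rewrite !dotE !mxE; ring.
by rewrite gperp_ortho gperp_norm // (sp : dot p p = 1) mulr0 !mulr1 addr0 cos2Dsin2.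
Qed.

Lemma garc_ortho s : dot (garc s) (dgarc s) = 0.
Proof.
have [d0|d0] := eqVneq d 0.
  by rewrite /dgarc d0 !mul0r !scale0r addr0 dotE !mxE; ring.
have {}d0 : 0 < d by rewrite lt_neqAle eq_sym d0 sdist_ge0.
have -> : dot (garc s) (dgarc s) = - d * cos (s * d) * sin (s * d) * dot p p
  + d * (cos (s * d) ^+ 2 - sin (s * d) ^+ 2) * dot p gperp
  + d * sin (s * d) * cos (s * d) * dot gperp gperp.
  by rewrite !dotE !mxE; ring.
by rewrite gperp_ortho gperp_norm // (sp : dot p p = 1); ring.
Qed.

Lemma dgarc_norm s : dot (dgarc s) (dgarc s) = d ^+ 2.
Proof.
have [d0|d0] := eqVneq d 0.
  by rewrite /dgarc d0 !mul0r !scale0r addr0 dotE !mxE; ring.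
have {}d0 : 0 < d by rewrite lt_neqAle eq_sym d0 sdist_ge0.
have -> : dot (dgarc s) (dgarc s) = d ^+ 2 * (sin (s * d) ^+ 2 * dot p p
  - 2 * cos (s * d) * sin (s * d) * dot p gperp + cos (s * d) ^+ 2 * dot gperp gperp).
  by rewrite !dotE !mxE; ring.
rewrite gperp_ortho gperp_norm // (sp : dot p p = 1) mulr0 subr0 !mulr1.
by rewrite addrC cos2Dsin2 mulr1.
Qed.

(** [sin d] times the height is [sin (d - s d) p_3 + sin (s d) q_3], with nonnegative coefficients.
    The end [q] may lie on the boundary circle if [s < 1], as required for approximating boundary
    points. *)
Lemma garc_disc s : 0 < p 0 2 -> 0 <= q 0 2 -> 0 <= s <= 1 ->
  s < 1 \/ 0 < q 0 2 -> disc (garc s).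
Proof.
move=> p2 q2 /andP[s0 s1] h; split; first exact: garc_sphere.
have [d0|d0] := eqVneq d 0.
  by have [_ ->] := garc_const d0.
have {}d0 : 0 < d by rewrite lt_neqAle eq_sym d0 sdist_ge0.
have sd0 := sin_sdist_gt0 d0.
have e : sin d * garc s 0 2 = sin (d - s * d) * p 0 2 + sin (s * d) * q 0 2.
  rewrite sinB !mxE; move: (sin d) sd0 => S S0; field; by rewrite gt_eqF.
rewrite -(pmulr_rgt0 _ sd0) e.
have sd : s * d <= d by rewrite ler_piMl // ltW.
have sd' : 0 <= s * d by rewrite mulr_ge0 // ltW.
have a1 : 0 <= sin (d - s * d) by rewrite sin_ge0_pi //; have := dpq; rewrite -/d; lra.
have a2 : 0 <= sin (s * d) by rewrite sin_ge0_pi //; have := dpq; rewrite -/d; lra.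
case: h => h.
  apply: ltr_wpDr; first exact: mulr_ge0.
  rewrite mulr_gt0 // sin_gt0_pi //.
  have : s * d < d by rewrite -[ltRHS]mul1r ltr_pM2r.
  by have := dpq; rewrite -/d; lra.
have [s00|s00] := eqVneq s 0.
  by rewrite s00 mul0r subr0 sin0 mul0r addr0 mulr_gt0.
apply: ltr_wpDl; first by rewrite mulr_ge0 // ltW.
rewrite mulr_gt0 // sin_gt0_pi // mulr_gt0 //=; last by rewrite lt_neqAle eq_sym s00.
by have := dpq; rewrite -/d; lra.
Qed.

(** The arc has constant speed [d], so with [th = d u] it is a lightlike curve and [curve_le]
    applies. *)
Lemma sdist_garc s t : 0 <= s -> s <= t -> t <= 1 ->
  sdist (garc s) (garc t) <= d * (t - s).
Proof.
move=> s0 st t1; rewrite mulrBr.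
have hd u := deriv1Ml d (deriv1_id u); rewrite mulr1 in hd.
apply: (@curve_le _ garc dgarc (fun u => d * u) (fun=> d) s t) => //.
- by move=> u _; exact: garc_sphere.
- by move=> u i _; exact: garc_deriv.
- by move=> u _; rewrite dgarc_norm lexx sdist_ge0.
Qed.

End GreatArc.

(** * Isometries preserve the causal and chronological relations *)

Section Isometry.
Context {R : realType}.
Variables (phi : AdS R -> AdS R) (h : 'rV[R]_3 -> 'rV[R]_3).
Hypothesis phi_h : forall z : AdS R, coord (\val (phi z)) = h (coord (\val z)).
Hypothesis h_smooth : smooth coord_dom h.
Hypothesis h_metric : forall u v w, coord_dom u ->
  metric (h u) ('D_v h u) ('D_w h u) = metric u v w.
Hypothesis h_future : forall u v, coord_dom u -> future_causal u v ->
  future_causal (h u) ('D_v h u).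

Lemma h_dom u : coord_dom u -> coord_dom (h u).
Proof.
move=> hu; have := phi_h (adsof hu).
have -> : coord (\val (adsof hu)) = u.
  by rewrite val_adsof; apply: row3P; rewrite !mxE.
by move=> <-; exact/coord_in_dom/ads_disc.
Qed.

Lemma val_phi u (hu : coord_dom u) : \val (phi (adsof hu)) = chart (h u).
Proof.
rewrite -[LHS]coordK; last exact: ads_disc.
rewrite phi_h; congr (chart (h _)).
by rewrite val_adsof; apply: row3P; rewrite !mxE.
Qed.

Lemma h_deriv (c : R -> 'rV[R]_3) (w : 'rV[R]_3) t : coord_dom (c t) ->
  (forall i, is_derive t 1 (fun s => c s 0 i) (w 0 i)) ->
  forall i, is_derive t 1 (fun s => h (c s) 0 i) ('D_w h (c t) 0 i).
Proof.
move=> ct cw i.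
have [dh _] := h_smooth 1; have {}dh := dh _ ct.
have [dc ec] : is_derive t 1 c w.
  by apply: is_derive_mx => j k; rewrite (ord1 j).
have dc' : differentiable c t by exact/derivable1_diffP.
suff : is_derive t 1 (h \o c) ('D_w h (c t)) by move/is_derive_mxP; exact.
have dhc : differentiable (h \o c) t by exact: differentiable_comp.
split; first exact/diff_derivable.
by rewrite deriveE // diff_comp // deriveE //= -ec deriveE.
Qed.

Section Path.
Variables (c w : R -> 'rV[R]_3) (a b : R).
Hypothesis c_dom : forall s, a <= s <= b -> coord_dom (c s).
Hypothesis c_der : forall s i, a <= s <= b ->
  is_derive s 1 (fun t => c t 0 i) (w s 0 i).

Lemma image_path_le : a <= b ->
  (forall s, a < s < b -> future_causal (c s) (w s)) ->
  sdist (chart (h (c a))).1 (chart (h (c b))).1 <= h (c b) 0 2 - h (c a) 0 2.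
Proof.
move=> ab fc; pose W s := 'D_(w s) h (c s).
apply: (@curve_le _ (fun s => (chart (h (c s))).1) (fun s => dpos (h (c s)) (W s))
   (fun s => h (c s) 0 2) (fun s => W s 0 2)) => //.
- by move=> s sab; have [] := chart_disc (h_dom (c_dom sab)).
- move=> s i sab; apply: (@chart_deriv _ (fun s => h (c s)) (W s) s).
    by move=> j; apply: h_deriv; [exact: c_dom|move=> k; exact: c_der].
  exact/h_dom/c_dom.
- move=> s sab; apply: h_deriv; [exact: c_dom|move=> k; exact: c_der].
- move=> s sab; have sab' : a <= s <= b by case/andP: sab => /ltW -> /ltW ->.
  have [] := h_future (c_dom sab') (fc _ sab).
  rewrite metricE; last exact/h_dom/c_dom.
  rewrite pmulr_lle0 ?invr_gt0 ?exprn_gt0 ?height_gt0 //; last exact/h_dom/c_dom.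
  by rewrite subr_le0 => -> /ltW.
Qed.

(** Strictness comes from [h_metric]: preservation of [future_causal] alone would allow a timelike
    vector to become lightlike. *)
Lemma image_path_lt : a < b ->
  (forall s, a < s < b -> metric (c s) (w s) (w s) < 0 /\ 0 < w s 0 2) ->
  sdist (chart (h (c a))).1 (chart (h (c b))).1 < h (c b) 0 2 - h (c a) 0 2.
Proof.
move=> ab fc; pose W s := 'D_(w s) h (c s).
apply: (@curve_lt _ (fun s => (chart (h (c s))).1) (fun s => dpos (h (c s)) (W s))
   (fun s => h (c s) 0 2) (fun s => W s 0 2)) => //.
- by move=> s sab; have [] := chart_disc (h_dom (c_dom sab)).
- move=> s i sab; apply: (@chart_deriv _ (fun s => h (c s)) (W s) s).
    by move=> j; apply: h_deriv; [exact: c_dom|move=> k; exact: c_der].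
  exact/h_dom/c_dom.
- move=> s sab; apply: h_deriv; [exact: c_dom|move=> k; exact: c_der].
- move=> s sab; have sab' : a <= s <= b by case/andP: sab => /ltW -> /ltW ->.
  have [m0 w0] := fc _ sab.
  have [] := h_future (c_dom sab') (conj (ltW m0) w0).
  rewrite -(h_metric (w s) (w s) (c_dom sab')) in m0.
  move=> _ W0; move: m0; rewrite metricE; last exact/h_dom/c_dom.
  rewrite pmulr_llt0 ?invr_gt0 ?exprn_gt0 ?height_gt0 //; last exact/h_dom/c_dom.
  by rewrite subr_lt0.
Qed.

End Path.

Section Segment.
Variables (a b : AdS R).
Let p := (\val a).1.
Let q := (\val b).1.
Let D := tht b - tht a.
(** A great arc run while [theta] is affine. It need not be a geodesic of the Lorentzian metric, but
    its squared velocity has the constant sign of [adist a b ^+ 2 - D ^+ 2], which is all that the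
    order sees. *)
Let c s := row3 (garc p q s 0 0) (garc p q s 0 1) (tht a + s * D).
Let w s := row3 (dgarc p q s 0 0) (dgarc p q s 0 1) D.

Let pq_pi : sdist p q < pi. Proof. exact: adist_ltpi. Qed.

Let gdisc (s : R) : 0 <= s <= 1 -> disc (garc p q s).
Proof.
move=> h01; have [sp p2] := ads_disc a; have [sq q2] := ads_disc b.
by apply: garc_disc => //; [exact: ltW|right].
Qed.

Let c_coord s : c s = coord (garc p q s, tht a + s * D).
Proof. by apply: row3P; rewrite !mxE. Qed.

Let c_dom (s : R) : 0 <= s <= 1 -> coord_dom (c s).
Proof. by move=> h01; rewrite c_coord; apply/coord_in_dom/gdisc. Qed.

Let c_der (s : R) i : 0 <= s <= 1 -> is_derive s 1 (fun t => c t 0 i) (w s 0 i).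
Proof.
move=> _; case: i => -[|[|[|//]]] ilt.
- rewrite (_ : Ordinal ilt = 0); last exact: val_inj.
  rewrite row3E; have := garc_deriv p q s 0; congr is_derive.
  by apply/funext => t; rewrite row3E.
- rewrite (_ : Ordinal ilt = 1); last exact: val_inj.
  rewrite row3E; have := garc_deriv p q s 1; congr is_derive.
  by apply/funext => t; rewrite row3E.
- rewrite (_ : Ordinal ilt = 2); last exact: val_inj.
  rewrite row3E; have := deriv1D (deriv1_cst s (tht a))
    (deriv1M (deriv1_id s) (deriv1_cst s D)).
  have -> : (fun t => c t 0 2) = (fun t => tht a + t * D).
    by apply/funext => t; rewrite row3E.
  by congr is_derive; ring.
Qed.

Let c_metric (s : R) : 0 <= s <= 1 ->
  metric (c s) (w s) (w s) = (adist a b ^+ 2 - D ^+ 2) / height (c s) ^+ 2.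
Proof.
move=> h01; rewrite metricE; last exact: c_dom.
have -> : w s 0 2 = D by rewrite row3E.
congr ((_ - _) / _).
have -> : dpos (c s) (w s) = dgarc p q s.
  have [sg g2] := gdisc h01.
  have hc : height (c s) = garc p q s 0 2.
    by have := coordK (gdisc h01 : disc (_, tht a + s * D).1); rewrite -c_coord => -[<- _]; rewrite mxE.
  apply: row3P; rewrite !row3E //; rewrite /dheight hc !row3E.
  have := garc_ortho (ads_sphere a) (ads_sphere b) pq_pi s; rewrite dotE => o.
  have -> : garc p q s 0 0 * dgarc p q s 0 0 + garc p q s 0 1 * dgarc p q s 0 1
    = - (garc p q s 0 2 * dgarc p q s 0 2) by lra.
  by rewrite opprK mulrAC divff ?mul1r // gt_eqF.
by rewrite dgarc_norm.
Qed.

Let c0 : chart (h (c 0)) = \val (phi a).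
Proof.
have d0 : 0 <= (0 : R) <= 1 by rewrite lexx ler01.
rewrite -(val_phi (c_dom d0)); congr (\val (phi _)); apply: val_inj.
rewrite val_adsof c_coord coordK; last exact: (gdisc d0).
by rewrite garc0 mul0r addr0 /tht /p -surjective_pairing.
Qed.

Let c1 : chart (h (c 1)) = \val (phi b).
Proof.
have d1 : 0 <= (1 : R) <= 1 by rewrite lexx ler01.
rewrite -(val_phi (c_dom d1)); congr (\val (phi _)); apply: val_inj.
rewrite val_adsof c_coord coordK; last exact: (gdisc d1).
by rewrite garc1 // mul1r /D addrC subrK /tht /q -surjective_pairing.
Qed.

Lemma iso_ale : ale a b -> ale (phi a) (phi b).
Proof.
move=> ab; have d0 := adist_ge0 a b.
have [D0|D0] := eqVneq D 0.
  have e : a = b.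
    apply: ads_eq; last by rewrite /D in D0; lra.
    by move: ab; rewrite /ale -/D D0; lra.
  by rewrite e; exact: ale_refl.
have {}D0 : 0 < D by rewrite lt_neqAle eq_sym D0 (le_trans d0 ab).
have := image_path_le c_dom c_der ler01.
rewrite c0 c1.
have t0 : h (c 0) 0 2 = tht (phi a) by rewrite /tht -c0 chartE.
have t1 : h (c 1) 0 2 = tht (phi b) by rewrite /tht -c1 chartE.
rewrite t0 t1; apply=> s /andP[/ltW s0 /ltW s1]; split; last by rewrite row3E.
have s01 : 0 <= s <= 1 by rewrite s0.
rewrite c_metric // pmulr_lle0 ?invr_gt0 ?exprn_gt0 ?height_gt0 //; last exact: c_dom.
by rewrite subr_le0 ler_pXn2r ?nnegrE // ltW.
Qed.

Lemma iso_alt : alt a b -> alt (phi a) (phi b).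
Proof.
move=> ab; have d0 := adist_ge0 a b.
have D0 : 0 < D by exact: le_lt_trans d0 ab.
have := image_path_lt c_dom c_der ltr01.
rewrite c0 c1.
have t0 : h (c 0) 0 2 = tht (phi a) by rewrite /tht -c0 chartE.
have t1 : h (c 1) 0 2 = tht (phi b) by rewrite /tht -c1 chartE.
rewrite t0 t1; apply=> s /andP[/ltW s0 /ltW s1]; split; last by rewrite row3E.
have s01 : 0 <= s <= 1 by rewrite s0.
rewrite c_metric // pmulr_llt0 ?invr_gt0 ?exprn_gt0 ?height_gt0 //; last exact: c_dom.
by rewrite subr_lt0 ltr_pXn2r ?nnegrE // ltW.
Qed.

End Segment.

End Isometry.

(** * The invisible domain and its invariance *)

Section InvisibleDomain.
Context {R : realType}.
Implicit Types (a b z : AdS R).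

Lemma SOhat22_ale (phi : AdS R -> AdS R) a b :
  SOhat22 phi -> ale a b -> ale (phi a) (phi b).
Proof. by move=> [_ [h [h1 h2 _ _ h5]]]; exact: (iso_ale h1 h2 h5). Qed.

Lemma SOhat22_alt (phi : AdS R -> AdS R) a b :
  SOhat22 phi -> alt a b -> alt (phi a) (phi b).
Proof. by move=> [_ [h [h1 h2 h3 _ h5]]]; exact: (iso_alt h1 h2 h3 h5). Qed.

Lemma circle_neq0 : @circle R !=set0.
Proof.
exists (row3 1 0 0); split; last by rewrite row3E.
by apply/sphereE; rewrite !row3E; ring.
Qed.

Lemma within_continuous_ball (V W : pseudoMetricNormedZmodType R) (A : set V) (psi : V -> W) w
  (U : set W) : {within A, continuous psi} -> A w -> nbhs (psi w) U ->
  exists2 e : R, 0 < e & forall x, A x -> ball w e x -> U (psi x).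
Proof.
move=> /subspace_continuousP cpsi Aw /(cpsi _ Aw).
rewrite nbhs_simpl /within /= => /nbhs_ballP[e e0 h].
by exists e => // x Ax xe; exact: h.
Qed.

Lemma sphere_dist_lt4 p q : sphere p -> sphere q -> sdist p q < 4 :> R.
Proof.
by move=> sp sq; have := sdist_lepi sp sq; have := @pihalf_lt2 R; lra.
Qed.

(** The approximating point [b] lies on the great arc from [a] to [w], at the level of [w]. It is
    therefore no farther from [a] than [w] is, and inherits any causal relation between [a] and
    [w]. *)
Lemma boundary_approx (psi : point3 R -> point3 R) a (w : point3 R) (e : R) :
  {within cads_set, continuous psi} -> circle w.1 -> sphere (psi w).1 ->
  (forall z : AdS R, sphere (psi (\val z)).1) -> 0 < e ->
  exists b, [/\ tht b = w.2, sdist (\val a).1 (\val b).1 <= sdist (\val a).1 w.1,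
    sdist (psi (\val b)).1 (psi w).1 < e &
    `|(psi (\val b)).2 - (psi w).2| < e].
Proof.
move=> cpsi cw spw sps e0.
have [d d0 hd] := sdist_small e0.
have cadw : cads_set w by split=> //; have [sw w0] := cw; split=> //; rewrite w0.
have de0 : 0 < Num.min d e by rewrite lt_min d0.
have [r r0 hr] := within_continuous_ball cpsi cadw
  (nbhsx_ballx (psi w) (Num.min d e) de0).
pose s : R := Num.max 0 (1 - r / 4).
have s0 : 0 <= s by rewrite le_max lexx.
have s1 : s < 1 by rewrite gt_max ltr01 /=; lra.
have sr : 1 - r / 4 <= s by rewrite le_max lexx orbT.
have [sw w20] := cw; have [sa a2] := ads_disc a.
have dpi : sdist (\val a).1 w.1 < pi by rewrite sdist_ltpi // ?w20.
have gd : disc (garc (\val a).1 w.1 s).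
  by apply: garc_disc => //; rewrite ?w20 // ?s0 ?ltW //; left.
have ga : garc (\val a).1 w.1 0 = (\val a).1 by exact: garc0.
have g1 : garc (\val a).1 w.1 1 = w.1 by exact: garc1.
exists (mkads gd w.2).
have adsb : cads_set (\val (mkads gd w.2)).
  by split=> //=; have [? /ltW] := gd.
have bw : ball w r (\val (mkads gd w.2)).
  split; last exact: ballxx.
  split=> // i j; rewrite (ord1 i) /ball /= distrC.
  apply: (le_lt_trans (coord_le_sdist j (disc_sphere gd) sw)).
  rewrite -{2}g1; apply: le_lt_trans (sdist_garc sa sw dpi s0 (ltW s1) (lexx _)) _.
  have := sphere_dist_lt4 sa sw; have := sdist_ge0 sa sw.
  by move: (sdist _ _) => D D0 D4; nra.
have [b1 b2] := hr _ adsb bw.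
split=> //.
- rewrite -[X in sdist X _ <= _]ga.
  have := sdist_garc sa sw dpi (lexx 0) s0 (ltW s1).
  move=> /le_trans; apply; rewrite subr0 ler_piMr ?sdist_ge0 // ltW //.
- apply: hd => // i; have [_ b1'] := b1; have := b1' 0 i.
  by rewrite /ball /= lt_min distrC => /andP[].
- by move: b2; rewrite /ball /= lt_min distrC => /andP[].
Qed.

Section Domain.
Variables (f : 'rV[R]_3 -> R).
Hypothesis f_lip : lipschitz1 f.

Definition nonrel z : Prop :=
  forall y, circle y -> `|tht z - f y| < sdist (\val z).1 y.

Definition deep (eta : R) z : Prop := forall y, circle y ->
  f y - sdist (\val z).1 y + eta <= tht z /\ tht z <= f y + sdist (\val z).1 y - eta.

Lemma f_lip_pi x y : circle x -> circle y -> `|f x - f y| <= pi.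
Proof.
move=> cx cy; apply: (le_trans (f_lip cx cy)).
by apply: sdist_lepi; exact: circle_sphere.
Qed.

(** A strict inequality against a supremum or an infimum is a margin uniform over the circle. *)
Lemma invisible_domainP z : invisible_domain f z <-> exists2 eta, 0 < eta & deep eta z.
Proof.
have [y0 cy0] := circle_neq0.
have sdy y : circle y -> 0 <= sdist (\val z).1 y <= pi.
  by move=> cy; rewrite sdist_ge0 ?sdist_lepi //; exact: circle_sphere.
(* The values of [sup] and [inf] mean something only for nonempty bounded sets; the Lipschitz
   condition bounds them. *)
have hs : has_sup [set f y - sdist (\val z).1 y | y in circle].
  split; first by exists (f y0 - sdist (\val z).1 y0), y0.
  exists (f y0 + pi) => _ [y cy <-].
  have := f_lip_pi cy cy0; rewrite ler_norml => /andP[_].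
  have /andP[] := sdy _ cy; lra.
have hi : has_inf [set f y + sdist (\val z).1 y | y in circle].
  split; first by exists (f y0 + sdist (\val z).1 y0), y0.
  exists (f y0 - pi) => _ [y cy <-].
  have := f_lip_pi cy cy0; rewrite ler_norml => /andP[].
  have /andP[] := sdy _ cy; lra.
rewrite /invisible_domain /=; split.
  move=> /andP[h1 h2].
  exists (Num.min (tht z - sup [set f y - sdist (\val z).1 y | y in circle])
     (inf [set f y + sdist (\val z).1 y | y in circle] - tht z)).
    by rewrite lt_min !subr_gt0 h1.
  move=> y cy.
  have m1 := ge_min (tht z - sup [set f y - sdist (\val z).1 y | y in circle]).
  have e1 : f y - sdist (\val z).1 y <= sup [set f y - sdist (\val z).1 y | y in circle].
    by apply: ub_le_sup; [case: hs|exists y].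
  have e2 : inf [set f y + sdist (\val z).1 y | y in circle] <= f y + sdist (\val z).1 y.
    by apply: ge_inf; [case: hi|exists y].
  move: h1 h2 e1 e2; rewrite -/(tht z).
  set S := sup _; set I := inf _ => h1 h2 e1 e2.
  have : Num.min (tht z - S) (I - tht z) <= tht z - S by rewrite ge_min lexx.
  have : Num.min (tht z - S) (I - tht z) <= I - tht z by rewrite ge_min lexx orbT.
  set m := Num.min _ _; lra.
move=> [eta eta0 hz]; apply/andP; split.
  apply: (@le_lt_trans _ _ (tht z - eta)); last by rewrite -/(tht z); lra.
  apply: ge_sup; first by case: hs.
  by move=> _ [y cy <-]; have [] := hz y cy; lra.
apply: (@lt_le_trans _ _ (tht z + eta)); first by rewrite -/(tht z); lra.
apply: lb_le_inf; first by case: hi.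
by move=> _ [y cy <-]; have [] := hz y cy; lra.
Qed.

Lemma domain_nonrel z : invisible_domain f z <->
  exists a b, [/\ nonrel a, nonrel b, alt a z & alt z b].
Proof.
rewrite invisible_domainP; split.
  move=> [eta eta0 hz]; exists (ashift (- (eta / 2)) z), (ashift (eta / 2) z).
  split; [| |by apply: ashift_alt; lra|by apply: alt_ashift; lra].
  - move=> y cy; have [] := hz y cy; rewrite !ashiftE ltr_norml /= => h1 h2.
    by apply/andP; split; lra.
  - move=> y cy; have [] := hz y cy; rewrite !ashiftE ltr_norml /= => h1 h2.
    by apply/andP; split; lra.
move=> [a [b [na nb az zb]]].
(* The slack of the two strict relations, which the triangle inequality turns into a margin against
   every [y]. *)
exists (Num.min (tht z - tht a - adist a z) (tht b - tht z - adist z b)).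
  by move: az zb; rewrite /alt lt_min => az zb; apply/andP; split; lra.
set m := Num.min _ _.
have m1 : m <= tht z - tht a - adist a z by rewrite ge_min lexx.
have m2 : m <= tht b - tht z - adist z b by rewrite ge_min lexx orbT.
move=> y cy; have sy := circle_sphere cy.
have := na y cy; have := nb y cy; rewrite !ltr_norml => /andP[h1 h2] /andP[h3 h4].
have := sdist_triangle (ads_sphere a) (ads_sphere z) sy; rewrite -/(adist a z).
have := sdist_triangle (ads_sphere b) (ads_sphere z) sy; rewrite -/(adist b z) adistC.
by move=> t1 t2; split; lra.
Qed.

Lemma domain_convex a b z : invisible_domain f a -> invisible_domain f b ->
  ale a z -> ale z b -> invisible_domain f z.
Proof.
move=> /domain_nonrel[a1 [_ [na _ aa _]]] /domain_nonrel[_ [b1 [_ nb _ bb]]] az zb.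
apply/domain_nonrel; exists a1, b1; split=> //.
  exact: alt_le_trans az.
exact: ale_lt_trans bb.
Qed.

Lemma domain_open a : invisible_domain f a -> exists e : R, [/\ 0 < e,
  invisible_domain f (ashift (- e) a) & invisible_domain f (ashift e a)].
Proof.
move=> /invisible_domainP[eta eta0 hz]; exists (eta / 2); split; first by lra.
  apply/invisible_domainP; exists (eta / 2); first by lra.
  by move=> y cy; have := hz y cy; rewrite ashiftE /=; lra.
apply/invisible_domainP; exists (eta / 2); first by lra.
by move=> y cy; have := hz y cy; rewrite ashiftE /=; lra.
Qed.

Section Invariance.
Variables (phi phi' : AdS R -> AdS R).
Hypothesis phi'_ale : forall a b, ale a b -> ale (phi' a) (phi' b).
Hypothesis phiK : cancel phi phi'.
Hypothesis phi'_preserves : preserves phi' (circle_graph f).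

(** If [phi z] were related to a point of the graph, it would be related to interior points
    approximating it. Applying [phi'] and letting the approximation tend to the boundary relates [z]
    to the image of that point under the extension [psi], which is again on the graph. *)
Lemma nonrel_image z : nonrel z -> nonrel (phi z).
Proof.
move=> nz y cy; rewrite ltNge; apply/negP.
have [psi [cpsi psiE psiL]] := phi'_preserves.
pose w : point3 R := (y, f y).
have [cw fw] : circle_graph f (psi w) by rewrite -psiL; exists w.
have sps (x : AdS R) : sphere (psi (\val x)).1 by rewrite psiE.
have spw := circle_sphere cw.
have := nz _ cw; rewrite -fw => nzw.
have appr e : 0 < e -> _ := boundary_approx (phi z) cpsi (cy : circle w.1) spw sps.
have fin (x : R) : (forall e, 0 < e -> x <= e) -> x <= 0.
  by move=> h; apply/ler_addgt0Pr => e e0; rewrite add0r; exact: h.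
rewrite ler_normr => /orP[] h.
- suff : sdist (\val z).1 (psi w).1 + (psi w).2 - tht z <= 0.
    by move: nzw; rewrite ltr_norml => /andP[]; lra.
  apply: fin => e e0.
  have [|b [b1 b2 b3 b4]] := appr (e / 2); first by lra.
  have : ale b (phi z).
    by rewrite /ale adistC b1 (le_trans b2).
  move=> /phi'_ale; rewrite phiK /ale => h'.
  move: b3 b4; rewrite psiE -/(tht (phi' b)) ltr_norml => b3 /andP[b4 b5].
  have := sdist_triangle (ads_sphere z) (ads_sphere (phi' b)) spw.
  by rewrite -/(adist z (phi' b)) adistC; lra.
- suff : sdist (\val z).1 (psi w).1 + tht z - (psi w).2 <= 0.
    by move: nzw; rewrite ltr_norml => /andP[]; lra.
  apply: fin => e e0.
  have [|b [b1 b2 b3 b4]] := appr (e / 2); first by lra.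
  have : ale (phi z) b.
    by rewrite /ale b1 (le_trans b2) // -opprB.
  move=> /phi'_ale; rewrite phiK /ale => h'.
  move: b3 b4; rewrite psiE -/(tht (phi' b)) ltr_norml => b3 /andP[b4 b5].
  have := sdist_triangle (ads_sphere z) (ads_sphere (phi' b)) spw.
  by rewrite -/(adist z (phi' b)); lra.
Qed.

End Invariance.

End Domain.

End InvisibleDomain.

(** * The quadric in R^4 and the product of developed points *)

Section Lorentz.
Context {R : realType}.
Implicit Types (X Y W V : 'rV[R]_4) (a b z : AdS R).

(* A plane spanned by two orthogonal negative vectors has a positive definite
   orthogonal complement. *)
Lemma reverse_Bessel X W V : Q W = -1 -> Q V = -1 -> bform W V = 0 ->
  - Q X <= bform X W ^+ 2 + bform X V ^+ 2.
Proof.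
move=> QW QV WV.
pose x := bform X W; pose y := bform X V.
(* The component of [X] orthogonal to [W] and [V], with negative part [n] and positive part [m]. Its
   square is [Q X + x^2 + y^2], so it remains to see that it is not negative. *)
pose n0 := X 0 0 + x * W 0 0 + y * V 0 0.
pose n1 := X 0 1 + x * W 0 1 + y * V 0 1.
pose m0 := X 0 2 + x * W 0 2 + y * V 0 2.
pose m1 := X 0 3 + x * W 0 3 + y * V 0 3.
have QN : - (n0 ^+ 2) - n1 ^+ 2 + m0 ^+ 2 + m1 ^+ 2 = Q X + x ^+ 2 + y ^+ 2.
  have -> : - (n0 ^+ 2) - n1 ^+ 2 + m0 ^+ 2 + m1 ^+ 2 =
    Q X + 2 * x * bform X W + 2 * y * bform X V + x ^+ 2 * Q W + y ^+ 2 * Q V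
    + 2 * x * y * bform W V by rewrite /Q /bform /n0 /n1 /m0 /m1; ring.
  by rewrite -/x -/y QW QV WV; ring.
have nW : n0 * W 0 0 + n1 * W 0 1 = m0 * W 0 2 + m1 * W 0 3.
  apply/eqP; rewrite -subr_eq0; apply/eqP.
  have -> : n0 * W 0 0 + n1 * W 0 1 - (m0 * W 0 2 + m1 * W 0 3) =
    - (bform X W + x * Q W + y * bform W V).
    by rewrite /Q /bform /n0 /n1 /m0 /m1; ring.
  by rewrite -/x QW WV; ring.
have nV : n0 * V 0 0 + n1 * V 0 1 = m0 * V 0 2 + m1 * V 0 3.
  apply/eqP; rewrite -subr_eq0; apply/eqP.
  have -> : n0 * V 0 0 + n1 * V 0 1 - (m0 * V 0 2 + m1 * V 0 3) =
    - (bform X V + x * bform W V + y * Q V).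
    by rewrite /Q /bform /n0 /n1 /m0 /m1; ring.
  by rewrite -/y QV WV; ring.
rewrite -/x -/y -subr_ge0 (_ : _ - _ = Q X + x ^+ 2 + y ^+ 2); last by ring.
rewrite -QN (_ : _ + m1 ^+ 2 = m0 ^+ 2 + m1 ^+ 2 - (n0 ^+ 2 + n1 ^+ 2)); last by ring.
rewrite subr_ge0.
move: nW nV QW QV WV; rewrite /Q /bform {QN}.
move: (W 0 0) (W 0 1) (W 0 2) (W 0 3) (V 0 0) (V 0 1) (V 0 2) (V 0 3).
move: n0 n1 m0 m1 => n0 n1 m0 m1 a0 a1 e0 e1 c0 c1 g0 g1 na nc aa cc ac.
(* Since [de^2 >= 1], the negative parts of [W] and [V] form a basis of the plane; [l] and [k] will
   be the coordinates of [n] in it. *)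
pose de := a0 * c1 - a1 * c0.
have de1 : 1 <= de ^+ 2.
  have -> : de ^+ 2 = (a0 ^+ 2 + a1 ^+ 2) * (c0 ^+ 2 + c1 ^+ 2) - (a0 * c0 + a1 * c1) ^+ 2.
    by rewrite /de; ring.
  have -> : a0 ^+ 2 + a1 ^+ 2 = 1 + (e0 ^+ 2 + e1 ^+ 2) by lra.
  have -> : c0 ^+ 2 + c1 ^+ 2 = 1 + (g0 ^+ 2 + g1 ^+ 2) by lra.
  have -> : a0 * c0 + a1 * c1 = e0 * g0 + e1 * g1 by lra.
  have -> : (1 + (e0 ^+ 2 + e1 ^+ 2)) * (1 + (g0 ^+ 2 + g1 ^+ 2)) - (e0 * g0 + e1 * g1) ^+ 2
     = 1 + e0 ^+ 2 + e1 ^+ 2 + g0 ^+ 2 + g1 ^+ 2 + (e0 * g1 - e1 * g0) ^+ 2 by ring.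
  have := sqr_ge0 e0; have := sqr_ge0 e1; have := sqr_ge0 g0; have := sqr_ge0 g1.
  by have := sqr_ge0 (e0 * g1 - e1 * g0); lra.
have de0 : de != 0.
  by apply/eqP => d0; move: de1; rewrite d0 expr0n /= ler10.
pose l := (n0 * c1 - n1 * c0) / de; pose k := (n1 * a0 - n0 * a1) / de.
have en0 : n0 = l * a0 + k * c0 by rewrite /l /k; move: de0; rewrite /de => de0; field.
have en1 : n1 = l * a1 + k * c1 by rewrite /l /k; move: de0; rewrite /de => de0; field.
(* The positive part of [l W + k V]. Orthogonality gives [n.n = m.v], and [v.v = n.n - l^2 - k^2],
   so Cauchy-Schwarz yields [n.n <= m.m]. *)
pose v0 := l * e0 + k * g0; pose v1 := l * e1 + k * g1.
have h1 : n0 ^+ 2 + n1 ^+ 2 = m0 * v0 + m1 * v1.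
  have -> : m0 * v0 + m1 * v1 = l * (m0 * e0 + m1 * e1) + k * (m0 * g0 + m1 * g1).
    by rewrite /v0 /v1; ring.
  by rewrite -na -nc !expr2 {2}en0 {2}en1; ring.
have h2 : v0 ^+ 2 + v1 ^+ 2 = n0 ^+ 2 + n1 ^+ 2 - l ^+ 2 - k ^+ 2.
  have -> : n0 ^+ 2 + n1 ^+ 2 = l ^+ 2 * (a0 ^+ 2 + a1 ^+ 2)
     + 2 * l * k * (a0 * c0 + a1 * c1) + k ^+ 2 * (c0 ^+ 2 + c1 ^+ 2).
    by rewrite en0 en1; ring.
  have -> : a0 ^+ 2 + a1 ^+ 2 = 1 + (e0 ^+ 2 + e1 ^+ 2) by lra.
  have -> : c0 ^+ 2 + c1 ^+ 2 = 1 + (g0 ^+ 2 + g1 ^+ 2) by lra.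
  have -> : a0 * c0 + a1 * c1 = e0 * g0 + e1 * g1 by lra.
  by rewrite /v0 /v1; ring.
have h3 : (m0 * v0 + m1 * v1) ^+ 2 <= (m0 ^+ 2 + m1 ^+ 2) * (v0 ^+ 2 + v1 ^+ 2).
  rewrite -subr_ge0 (_ : _ - _ = (m0 * v1 - m1 * v0) ^+ 2); last by ring.
  exact: sqr_ge0.
have h4 := sqr_ge0 l; have h5 := sqr_ge0 k.
have M0 : 0 <= m0 ^+ 2 + m1 ^+ 2 by rewrite addr_ge0 ?sqr_ge0.
have N0 : 0 <= n0 ^+ 2 + n1 ^+ 2 by rewrite addr_ge0 ?sqr_ge0.
rewrite -h1 h2 in h3.
have h6 : (n0 ^+ 2 + n1 ^+ 2) ^+ 2 <= (m0 ^+ 2 + m1 ^+ 2) * (n0 ^+ 2 + n1 ^+ 2).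
  by apply: (le_trans h3); rewrite ler_wpM2l //; lra.
move: h6 M0 N0; move: (n0 ^+ 2 + n1 ^+ 2) (m0 ^+ 2 + m1 ^+ 2) => N M h6 M0 N0.
have [->//|NN0] := eqVneq N 0.
by move: h6; rewrite expr2 ler_pM2r // lt_neqAle eq_sym NN0.
Qed.

Definition hgt a : R := (\val a).1 0 2.
Definition bprod a b : R := - bform (dev (\val a)) (dev (\val b)).

Lemma hgt_gt0 a : 0 < hgt a. Proof. by have [] := ads_disc a. Qed.

Lemma hgt_le1 a : hgt a <= 1.
Proof.
have /sphereE := ads_sphere a; rewrite -/(hgt a) => e.
have : hgt a ^+ 2 <= 1.
  have := sqr_ge0 ((\val a).1 0 0); have := sqr_ge0 ((\val a).1 0 1); lra.
by rewrite expr_le1 // ltW // hgt_gt0.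
Qed.

Lemma hgt_dist a b : hgt a - adist a b <= hgt b.
Proof.
have := coord_le_sdist 2 (ads_sphere a) (ads_sphere b).
rewrite ler_norml -/(adist a b) -/(hgt a) -/(hgt b); lra.
Qed.

Lemma Q_dev a : Q (dev (\val a)) = -1.
Proof.
rewrite /Q /bform !devE -/(hgt a) -/(tht a).
have /sphereE := ads_sphere a; rewrite -/(hgt a) => e.
have cs := cos2Dsin2 (tht a); have h0 := hgt_gt0 a.
move: (hgt a) (cos _) (sin _) ((\val a).1 0 0) ((\val a).1 0 1) e cs h0 => r C S x y e cs h0.
have -> : - (r^-1 * C * (r^-1 * C)) - r^-1 * S * (r^-1 * S) +
  r^-1 * x * (r^-1 * x) + r^-1 * y * (r^-1 * y) =
  (x ^+ 2 + y ^+ 2 - (C ^+ 2 + S ^+ 2)) / r ^+ 2 by field; rewrite gt_eqF.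
rewrite cs -e (_ : _ - _ = - r ^+ 2); last by ring.
by rewrite mulNr divff ?e // expf_neq0 // gt_eqF.
Qed.

Lemma bprodxx a : bprod a a = 1.
Proof. by rewrite /bprod -/(Q _) Q_dev opprK. Qed.

(** If [0 <= tht b - tht a <= pi], both angles lie where the cosine decreases, so comparing
    [bprod a b] with 1 decides the causal relation. *)
Lemma bprodE a b :
  (1 - bprod a b) * (hgt a * hgt b) = cos (adist a b) - cos (tht b - tht a).
Proof.
rewrite /bprod /bform !devE -/(hgt a) -/(tht a) -/(hgt b) -/(tht b) cos_sdist //.
rewrite dotE -/(hgt a) -/(hgt b) cosB.
have ha := hgt_gt0 a; have hb := hgt_gt0 b.
by field; rewrite !gt_eqF.
Qed.

Lemma bprod_lt1 a b : alt a b -> tht b - tht a <= pi -> bprod a b < 1.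
Proof.
move=> ab D; rewrite -subr_gt0 -(pmulr_lgt0 _ (mulr_gt0 (hgt_gt0 a) (hgt_gt0 b))) bprodE.
rewrite subr_gt0 ltr_cos_0pi ?adist_ge0 ?(ltW (adist_ltpi a b)) // D andbT.
exact: le_trans (adist_ge0 a b) (ltW ab).
Qed.

Lemma bprod_alt a b : 0 <= tht b - tht a <= pi -> bprod a b < 1 -> alt a b.
Proof.
move=> D; rewrite -subr_gt0 -(pmulr_lgt0 _ (mulr_gt0 (hgt_gt0 a) (hgt_gt0 b))) bprodE.
by rewrite subr_gt0 ltr_cos_0pi // ?adist_ge0 ?(ltW (adist_ltpi a b)).
Qed.

Lemma bprod_ale a b : 0 <= tht b - tht a <= pi -> bprod a b <= 1 -> ale a b.
Proof.
move=> D; rewrite -subr_ge0 -(pmulr_lge0 _ (mulr_gt0 (hgt_gt0 a) (hgt_gt0 b))) bprodE.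
by rewrite subr_ge0 ler_cos_0pi // ?adist_ge0 ?(ltW (adist_ltpi a b)).
Qed.

(** Both heights are at least three quarters of [hgt z], and the [theta] difference is below
    [hgt z / 2]. Hence [bprodE] bounds [1 - bprod a b] by [(1/8) / (9/16)], which is below 1. *)
Lemma small_diamond z a b : adist z a + `|tht a - tht z| < hgt z / 4 ->
  adist z b + `|tht b - tht z| < hgt z / 4 -> 0 < bprod a b /\ `|tht b - tht a| < 1.
Proof.
move=> ha hb.
have a0 := adist_ge0 z a; have b0 := adist_ge0 z b.
have na := normr_ge0 (tht a - tht z); have nb := normr_ge0 (tht b - tht z).
have z1 := hgt_le1 z; have z0 := hgt_gt0 z.
have D : `|tht b - tht a| < hgt z / 2.
  rewrite -(subrKA (tht z)); apply: (le_lt_trans (ler_normD _ _)).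
  by rewrite (distrC (tht z)); lra.
split; last by lra.
have h1 : hgt z * (3 / 4) <= hgt a by have := hgt_dist z a; lra.
have h2 : hgt z * (3 / 4) <= hgt b by have := hgt_dist z b; lra.
have e := bprodE a b.
have c1 : cos (adist a b) <= 1 by exact: cos_le1.
have c2 := cos_ge_sqr (tht b - tht a).
have D2 : (tht b - tht a) ^+ 2 <= (hgt z / 2) ^+ 2.
  by rewrite -real_normK ?num_real // ler_pXn2r ?nnegrE // ?ltW //; lra.
have h3 : (hgt z * (3 / 4)) ^+ 2 <= hgt a * hgt b.
  by rewrite expr2 ler_pM // mulr_ge0 // ltW.
rewrite -(pmulr_lgt0 _ (mulr_gt0 (hgt_gt0 a) (hgt_gt0 b))).
have z2 : 0 < hgt z ^+ 2 by rewrite exprn_gt0.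
move: e h3 D2; rewrite mulrBl mul1r !exprMn; lra.
Qed.

End Lorentz.

(** * A local inverse of the developing map *)

Section HyperboloidLift.
Context {R : realType}.
Variable t0 : R.
Implicit Types (Y : 'rV[R]_4) (a b : AdS R).

(* Components of the rotation by [- t0] of the negative part of [Y]. *)
Definition lxi Y : R := cos t0 * Y 0 0 + sin t0 * Y 0 1.
Definition leta Y : R := cos t0 * Y 0 1 - sin t0 * Y 0 0.
Definition lrho Y : R := Num.sqrt (Y 0 0 ^+ 2 + Y 0 1 ^+ 2).

(** The inverse of [dev \o chart] over the half-space [0 < lxi Y], with values in the slab of angles
    within [pi / 2] of [t0]. The rotation by [- t0] brings the angle into the range of [atan]. *)
Definition hlift Y : 'rV[R]_3 :=
  row3 (Y 0 2 / lrho Y) (Y 0 3 / lrho Y) (t0 + atan (leta Y / lxi Y)).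

Lemma lxi_leta Y : lxi Y ^+ 2 + leta Y ^+ 2 = Y 0 0 ^+ 2 + Y 0 1 ^+ 2.
Proof.
have cs := cos2Dsin2 t0.
rewrite /lxi /leta.
have -> : (cos t0 * Y 0 0 + sin t0 * Y 0 1) ^+ 2 +
  (cos t0 * Y 0 1 - sin t0 * Y 0 0) ^+ 2 =
  (cos t0 ^+ 2 + sin t0 ^+ 2) * (Y 0 0 ^+ 2 + Y 0 1 ^+ 2) by ring.
by rewrite cs mul1r.
Qed.

Section Lift.
Variable Y : 'rV[R]_4.
Hypotheses (QY : Q Y = -1) (Y0 : 0 < lxi Y).

Lemma lrho2_gt0 : 0 < Y 0 0 ^+ 2 + Y 0 1 ^+ 2.
Proof. by rewrite -lxi_leta ltr_pwDl ?exprn_gt0 // sqr_ge0. Qed.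

Lemma lrho_gt0 : 0 < lrho Y.
Proof. by rewrite sqrtr_gt0 lrho2_gt0. Qed.

Lemma lrho_sqr : lrho Y ^+ 2 = Y 0 0 ^+ 2 + Y 0 1 ^+ 2.
Proof. by rewrite sqr_sqrtr // ltW // lrho2_gt0. Qed.

Lemma lrho_Q : Y 0 2 ^+ 2 + Y 0 3 ^+ 2 = lrho Y ^+ 2 - 1.
Proof. by rewrite lrho_sqr; move: QY; rewrite /Q /bform; lra. Qed.

Lemma lift_dom : coord_dom (hlift Y).
Proof.
rewrite /coord_dom /= !row3E !exprMn -mulrDl lrho_Q exprVn.
rewrite ltr_pdivrMr ?exprn_gt0 ?lrho_gt0 //; lra.
Qed.

Lemma lift_height : height (hlift Y) = (lrho Y)^-1.
Proof.
have r0 := lrho_gt0.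
rewrite /height !row3E -addrA -opprD !exprMn -mulrDl lrho_Q exprVn.
have -> : 1 - (lrho Y ^+ 2 - 1) / lrho Y ^+ 2 = (lrho Y)^-1 ^+ 2.
  by field; rewrite gt_eqF.
by rewrite sqrtr_sqr ger0_norm // invr_ge0 ltW.
Qed.

Lemma cos_lift : cos (atan (leta Y / lxi Y)) = lxi Y / lrho Y.
Proof.
rewrite cos_atan.
have -> : 1 + (leta Y / lxi Y) ^+ 2 = (lrho Y / lxi Y) ^+ 2.
  by rewrite !exprMn lrho_sqr -lxi_leta; field; rewrite gt_eqF.
rewrite sqrtr_sqr ger0_norm; last by rewrite divr_ge0 // ltW // lrho_gt0.
by rewrite invf_div.
Qed.

Lemma sin_lift : sin (atan (leta Y / lxi Y)) = leta Y / lrho Y.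
Proof.
have h := atanK (leta Y / lxi Y); move: h; rewrite /tan cos_lift => h.
have r0 := lrho_gt0.
have c0 : lxi Y / lrho Y != 0 by rewrite gt_eqF // divr_gt0.
move: h => /(congr1 (fun x => x * (lxi Y / lrho Y))); rewrite divfK // => ->.
by field; rewrite !gt_eqF.
Qed.

Lemma dev_lift : dev (chart (hlift Y)) = Y.
Proof.
have r0 := lrho_gt0; have rN0 : lrho Y != 0 by rewrite gt_eqF.
have cs := cos2Dsin2 t0.
apply: row4P; rewrite devE !chartE lift_height !row3E invrK.
- rewrite cosD cos_lift sin_lift -[RHS]mul1r -cs /lxi /leta; by field.
- rewrite sinD cos_lift sin_lift -[RHS]mul1r -cs /lxi /leta; by field.
- by field.
- by field.
Qed.

End Lift.

Lemma lift_dev b : `|tht b - t0| < pi / 2 -> hlift (dev (\val b)) = coord (\val b).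
Proof.
rewrite ltr_norml => D.
have h0 := hgt_gt0 b; have hN0 : hgt b != 0 by rewrite gt_eqF.
have ex : lxi (dev (\val b)) = cos (tht b - t0) / hgt b.
  by rewrite /lxi !devE -/(hgt b) -/(tht b) cosB; field.
have ee : leta (dev (\val b)) = sin (tht b - t0) / hgt b.
  by rewrite /leta !devE -/(hgt b) -/(tht b) sinB; field.
have er : lrho (dev (\val b)) = (hgt b)^-1.
  rewrite /lrho !devE -/(hgt b) -/(tht b) !exprMn -mulrDr cos2Dsin2 mulr1.
  by rewrite sqrtr_sqr ger0_norm // invr_ge0 ltW.
have c0 : 0 < cos (tht b - t0) by exact: cos_gt0_pihalf.
apply: row3P; rewrite !row3E ?coordE ?er ?devE -/(hgt b).
- by field.
- by field.
- rewrite ex ee (_ : _ / _ = tan (tht b - t0)); last first.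
    by rewrite /tan; field; rewrite hN0 gt_eqF.
  by rewrite tanK ?in_itv // addrC subrK.
Qed.

Lemma lift_derivable (Y : R -> 'rV[R]_4) (dY : 'rV[R]_4) (s : R) :
  (forall i, is_derive s 1 (fun t => Y t 0 i) (dY 0 i)) -> 0 < lxi (Y s) ->
  exists w : 'rV[R]_3, forall i, is_derive s 1 (fun t => hlift (Y t) 0 i) (w 0 i).
Proof.
move=> hY Y0.
have r2 : 0 < Y s 0 0 ^+ 2 + Y s 0 1 ^+ 2 by exact: lrho2_gt0.
have [dr hr] : exists dr, is_derive s 1 (fun t => lrho (Y t)) dr.
  have := deriv1_sqrt (f := fun t => Y t 0 0 * Y t 0 0 + Y t 0 1 * Y t 0 1) _
   (deriv1D (deriv1M (hY 0) (hY 0)) (deriv1M (hY 1) (hY 1))).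
  rewrite -!expr2 => /(_ r2) h; eexists; move: h.
  have -> : (fun t => Num.sqrt (Y t 0 0 * Y t 0 0 + Y t 0 1 * Y t 0 1)) =
          (fun t => lrho (Y t)) by apply/funext => t; rewrite /lrho !expr2.
  exact.
have rN0 : lrho (Y s) != 0 by rewrite gt_eqF // lrho_gt0.
have hrV := deriv1V (f := fun t => lrho (Y t)) rN0 hr.
have hx : is_derive s 1 (fun t => lxi (Y t)) (cos t0 * dY 0 0 + sin t0 * dY 0 1).
  exact: deriv1D (deriv1Ml _ (hY 0)) (deriv1Ml _ (hY 1)).
have he : is_derive s 1 (fun t => leta (Y t)) (cos t0 * dY 0 1 - sin t0 * dY 0 0).
  exact: deriv1B (deriv1Ml _ (hY 1)) (deriv1Ml _ (hY 0)).
have xN0 : lxi (Y s) != 0 by rewrite gt_eqF.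
have hxV := deriv1V (f := fun t => lxi (Y t)) xN0 hx.
have ha := deriv1D (deriv1_cst s t0) (deriv1_atan (deriv1M he hxV)).
have h2 := deriv1M (hY 2) hrV; have h3 := deriv1M (hY 3) hrV.
eexists (row3 _ _ _); case=> -[|[|[|//]]] ilt.
- rewrite (_ : Ordinal ilt = 0); last exact: val_inj.
  rewrite row3E; have -> : (fun t => hlift (Y t) 0 0) = (fun t => Y t 0 2 / lrho (Y t)).
    by apply/funext => t; rewrite row3E.
  exact: h2.
- rewrite (_ : Ordinal ilt = 1); last exact: val_inj.
  rewrite row3E; have -> : (fun t => hlift (Y t) 0 1) = (fun t => Y t 0 3 / lrho (Y t)).
    by apply/funext => t; rewrite row3E.
  exact: h3.
- rewrite (_ : Ordinal ilt = 2); last exact: val_inj.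
  rewrite row3E; have -> : (fun t => hlift (Y t) 0 2) =
     (fun t => t0 + atan (leta (Y t) / lxi (Y t))).
    by apply/funext => t; rewrite row3E.
  exact: ha.
Qed.

End HyperboloidLift.

(** * Timelike distances do not shrink under isometries *)

Section Expansion.
Context {R : realType}.
Implicit Types (X Y V : 'rV[R]_4) (a b : AdS R).

Lemma bform_comb X V (x1 y1 x2 y2 : R) : Q X = -1 -> Q V = -1 -> bform X V = 0 ->
  bform (x1 *: X + y1 *: V) (x2 *: X + y2 *: V) = - (x1 * x2 + y1 * y2).
Proof.
move=> QX QV XV.
have -> : bform (x1 *: X + y1 *: V) (x2 *: X + y2 *: V) =
  x1 * x2 * Q X + (x1 * y2 + y1 * x2) * bform X V + y1 * y2 * Q V.
  by rewrite /Q /bform !mxE; ring.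
by rewrite QX QV XV; ring.
Qed.

Lemma bform_deriv (F : R -> 'rV[R]_4) (dF' : 'rV[R]_4) X (t : R) :
  (forall i, is_derive t 1 (fun s => F s 0 i) (dF' 0 i)) ->
  is_derive t 1 (fun s => bform X (F s)) (bform X dF').
Proof.
move=> h; rewrite /bform.
exact: deriv1D (deriv1D (deriv1B (deriv1N (deriv1Ml _ (h 0))) (deriv1Ml _ (h 1)))
  (deriv1Ml _ (h 2))) (deriv1Ml _ (h 3)).
Qed.

Lemma Q_deriv (F : R -> 'rV[R]_4) (dF' : 'rV[R]_4) (t : R) :
  (forall i, is_derive t 1 (fun s => F s 0 i) (dF' 0 i)) ->
  is_derive t 1 (fun s => Q (F s)) (2 * bform (F t) dF').
Proof.
move=> h; rewrite /Q /bform.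
have := deriv1D (deriv1D (deriv1B (deriv1N (deriv1M (h 0) (h 0))) (deriv1M (h 1) (h 1)))
  (deriv1M (h 2) (h 2))) (deriv1M (h 3) (h 3)).
by congr is_derive; ring.
Qed.

Lemma bformZB X Y (k m : R) :
  bform X (k *: (Y - m *: X)) = k * (bform X Y - m * Q X).
Proof. by rewrite /Q /bform !mxE; ring. Qed.

Lemma QZB X Y (k m : R) :
  Q (k *: (Y - m *: X)) = k ^+ 2 * (Q Y - 2 * m * bform X Y + m ^+ 2 * Q X).
Proof. by rewrite /Q /bform !mxE; ring. Qed.

Variables (phi : AdS R -> AdS R) (h : 'rV[R]_3 -> 'rV[R]_3).
Hypothesis phi_h : forall z : AdS R, coord (\val (phi z)) = h (coord (\val z)).
Hypothesis h_smooth : smooth coord_dom h.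
Hypothesis h_metric : forall u v w, coord_dom u ->
  metric (h u) ('D_v h u) ('D_w h u) = metric u v w.
Hypothesis h_future : forall u v, coord_dom u -> future_causal u v ->
  future_causal (h u) ('D_v h u).

Variables (a b : AdS R).
Hypothesis ab : alt a b.
Hypothesis b_pos : 0 < bprod a b.
Hypothesis D_small : tht b - tht a < pi / 2.
Hypothesis gpos : forall x, ale (phi a) x -> ale x (phi b) -> 0 < bprod (phi a) x.
Hypothesis gD : tht (phi b) - tht (phi a) <= pi.

Let b0 := bprod a b.
Let s := acos b0.
Let X := dev (\val a).
(** Gram-Schmidt for two timelike vectors: [X] and [V] are orthogonal with square -1, so [Y] is the
    timelike geodesic of the quadric that reaches [dev b] at proper time [s]. *)
Let V : 'rV[R]_4 := (sin s)^-1 *: (dev (\val b) - b0 *: X).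
Let Y (t : R) : 'rV[R]_4 := cos t *: X + sin t *: V.
Let dY (t : R) : 'rV[R]_4 := - sin t *: X + cos t *: V.
Let D := tht b - tht a.
Let c t := hlift (tht a) (Y t).

Let D0 : 0 < D. Proof. by rewrite subr_gt0 alt_tht. Qed.

Let Dpi : D < pi. Proof. have := @pi_gt0 R; have := D_small; rewrite -/D; lra. Qed.

Let b0_lt1 : b0 < 1.
Proof. by apply: bprod_lt1 => //; exact: ltW. Qed.

Let b0_itv : -1 <= b0 <= 1.
Proof. by rewrite (ltW b0_lt1) andbT; have := b_pos; rewrite -/b0; lra. Qed.

Let cos_s : cos s = b0. Proof. by rewrite acosK. Qed.

Let s_gt0 : 0 < s.
Proof. by rewrite acos_gt0 // b0_lt1 andbT; case/andP: b0_itv. Qed.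

Let s_lt : s < pi / 2.
Proof.
have pi2 := @pi_ge2 R.
rewrite -ltr_cos_0pi; first by rewrite cos_pihalf cos_s.
  by lra.
by rewrite (ltW s_gt0) acos_lepi.
Qed.

Let sin_s : 0 < sin s.
Proof. by rewrite sin_gt0_pi // s_gt0 /=; have := s_lt; have := @pi_gt0 R; lra. Qed.

Let QX : Q X = -1. Proof. exact: Q_dev. Qed.

Let XV : bform X V = 0.
Proof.
by rewrite bformZB QX /b0 /bprod -/X; ring.
Qed.

Let QV : Q V = -1.
Proof.
rewrite QZB.
have -> : bform X (dev (\val b)) = - b0 by rewrite /b0 /bprod opprK.
rewrite Q_dev QX exprVn sin2cos2 cos_s.
have : 1 - b0 ^+ 2 != 0 by rewrite -cos_s -sin2cos2 expf_neq0 // gt_eqF.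
by move=> n0; field.
Qed.

Let Ys : Y s = dev (\val b).
Proof.
by rewrite /Y /V [X in _ + X]scalerA divff ?gt_eqF // scale1r cos_s addrC subrK.
Qed.

Let Y0 : Y 0 = X. Proof. by rewrite /Y cos0 sin0 scale1r scale0r addr0. Qed.

Let QY t : Q (Y t) = -1.
Proof. by rewrite /Q bform_comb // -!expr2 cos2Dsin2. Qed.

Let QdY t : Q (dY t) = -1.
Proof. by rewrite /Q bform_comb // mulrNN -!expr2 addrC cos2Dsin2. Qed.

Let bYY t u : bform (Y t) (Y u) = - cos (u - t).
Proof. by rewrite bform_comb // cosB (mulrC (cos u)) (mulrC (sin u)). Qed.

Let Y_deriv (t : R) i : is_derive t 1 (fun u => Y u 0 i) (dY t 0 i).
Proof.
have := deriv1D (deriv1M (deriv1_cos (deriv1_id t)) (deriv1_cst t (X 0 i)))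
  (deriv1M (deriv1_sin (deriv1_id t)) (deriv1_cst t (V 0 i))).
have -> : (fun u => Y u 0 i) = (fun u => cos u * X 0 i + sin u * V 0 i).
  by apply/funext => u; rewrite !mxE.
by congr is_derive; rewrite !mxE; ring.
Qed.

Let ha := hgt_gt0 a.
Let hb := hgt_gt0 b.

Let lxiX : lxi (tht a) X = (hgt a)^-1.
Proof.
rewrite /lxi /X !devE -/(hgt a) -/(tht a) mulrCA (mulrCA (sin _)) -mulrDr.
by rewrite -!expr2 cos2Dsin2 mulr1.
Qed.

Let lxib : lxi (tht a) (dev (\val b)) = cos D / hgt b.
Proof. by rewrite /lxi /D !devE -/(hgt b) -/(tht b) cosB; ring. Qed.

(** [sin s] times [Y t] is [sin (s - t)] times [X] plus [sin t] times [dev b], which shows that the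
    geodesic stays in the domain of [hlift]. *)
Let lxiY t : sin s * lxi (tht a) (Y t) = sin (s - t) / hgt a + sin t * cos D / hgt b.
Proof.
have -> : lxi (tht a) (Y t) = cos t * lxi (tht a) X + sin t * lxi (tht a) V.
  by rewrite /lxi !mxE; ring.
have -> : lxi (tht a) V = (sin s)^-1 * (lxi (tht a) (dev (\val b)) - b0 * lxi (tht a) X).
  by rewrite /lxi /V !mxE; ring.
rewrite lxiX lxib sinB cos_s.
by field; rewrite !gt_eqF.
Qed.

Let letaY t : sin s * leta (tht a) (Y t) = sin t * sin D / hgt b.
Proof.
have -> : leta (tht a) (Y t) = cos t * leta (tht a) X + sin t * leta (tht a) V.
  by rewrite /leta !mxE; ring.
have -> : leta (tht a) V = (sin s)^-1 * (leta (tht a) (dev (\val b)) - b0 * leta (tht a) X).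
  by rewrite /leta /V !mxE; ring.
have -> : leta (tht a) X = 0.
  by rewrite /leta /X !devE -/(tht a); ring.
have -> : leta (tht a) (dev (\val b)) = sin D / hgt b.
  by rewrite /leta /D !devE -/(hgt b) -/(tht b) sinB; ring.
by field; rewrite !gt_eqF.
Qed.

Let cosD_gt0 : 0 < cos D.
Proof. by rewrite cos_gt0_pihalf // D_small andbT; have := @pi_gt0 R; have := D0; lra. Qed.

Let sinD_gt0 : 0 < sin D. Proof. by rewrite sin_gt0_pi // D0 Dpi. Qed.

Let lxi_gt0 t : 0 <= t <= s -> 0 < lxi (tht a) (Y t).
Proof.
move=> /andP[t0 ts]; rewrite -(pmulr_rgt0 _ sin_s) lxiY.
have p2 := @pi_gt0 R; have := s_lt => sl.
move: ts; rewrite le_eqVlt => /predU1P[->|ts].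
  by rewrite subrr sin0 mul0r add0r divr_gt0 // mulr_gt0.
apply: ltr_pwDl; first by rewrite divr_gt0 // sin_gt0_pi //; lra.
by rewrite divr_ge0 // ?(ltW hb) // mulr_ge0 // ?(ltW cosD_gt0) // sin_ge0_pi //; lra.
Qed.

Let leta_ge0 t : 0 <= t <= s -> 0 <= leta (tht a) (Y t).
Proof.
move=> /andP[t0 ts]; rewrite -(pmulr_rge0 _ sin_s) letaY.
have p2 := @pi_gt0 R; have := s_lt => sl.
rewrite divr_ge0 // ?(ltW hb) // mulr_ge0 // ?(ltW sinD_gt0) // sin_ge0_pi //; lra.
Qed.

Let c_dom t : 0 <= t <= s -> coord_dom (c t).
Proof. by move=> /lxi_gt0 h0; exact: lift_dom. Qed.

(** The ratio [leta / lxi] lies between 0 and [tan D], and [atan] is increasing. *)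
Let tht_itv t : 0 <= t <= s -> 0 <= c t 0 2 - tht a <= D.
Proof.
move=> ht; have x0 := lxi_gt0 ht; have e0 := leta_ge0 ht.
rewrite row3E addrAC subrr add0r; apply/andP; split.
  by rewrite -(@atan0 R) le_atan // divr_ge0 // ltW.
have Ditv : D \in `](- (pi / 2)), (pi / 2)[.
  by rewrite in_itv /= D_small andbT; have := @pi_gt0 R; have := D0; lra.
rewrite -(tanK Ditv) le_atan // /tan ler_pdivrMr // mulrAC ler_pdivlMr //.
rewrite -(ler_pM2l sin_s) mulrA letaY mulrCA lxiY.
rewrite mulrDr -subr_ge0.
have p2 := @pi_gt0 R; have := s_lt => sl; have /andP[t0 ts] := ht.
have : 0 <= sin D * (sin (s - t) / hgt a).
  rewrite mulr_ge0 ?(ltW sinD_gt0) // divr_ge0 ?(ltW ha) // sin_ge0_pi //; lra.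
by congr (_ <= _); ring.
Qed.

Let c0 : c 0 = coord (\val a).
Proof.
rewrite /c Y0 lift_dev // subrr normr0; have := @pi_gt0 R; lra.
Qed.

Let cs : c s = coord (\val b).
Proof. by rewrite /c Ys lift_dev // -/D gtr0_norm. Qed.

Let w_ex (t : R) : exists w : 'rV[R]_3, 0 <= t <= s ->
  forall i, is_derive t 1 (fun u => c u 0 i) (w 0 i).
Proof.
have [ht|] := boolP (0 <= t <= s); last by exists 0.
by have [w hw] := lift_derivable (Y_deriv t) (lxi_gt0 ht); exists w.
Qed.

Let w := projT1 (choice w_ex).
Let w_der (t : R) : 0 <= t <= s -> forall i, is_derive t 1 (fun u => c u 0 i) (w t 0 i).
Proof. exact: (projT2 (choice w_ex)). Qed.

Let oo_cc t : 0 < t < s -> 0 <= t <= s.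
Proof. by case/andP => /ltW -> /ltW ->. Qed.

(** The lift develops onto [Y], so its velocity is mapped to [dY], a vector of square -1. *)
Let c_metric t : 0 < t < s -> metric (c t) (w t) (w t) = -1.
Proof.
move=> ht; have ht' := oo_cc ht.
rewrite /metric derive_dev; last exact: c_dom.
suff -> : dF (c t) (w t) = dY t by exact: QdY.
apply/rowP => i.
apply: (deriv1_eq_oo ht _ (dev_deriv (w_der ht') (c_dom ht') i) (Y_deriv t i)).
by move=> u hu; rewrite dev_lift //; exact/lxi_gt0/oo_cc.
Qed.

Let Z t := dev (chart (h (c t))).
Let dZ t := dF (h (c t)) ('D_(w t) h (c t)).

Let hdom u : coord_dom u -> coord_dom (h u).
Proof. exact: h_dom. Qed.

Let Z_deriv (t : R) i : 0 <= t <= s -> is_derive t 1 (fun u => Z u 0 i) (dZ t 0 i).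
Proof.
move=> ht; apply: (@dev_deriv _ (fun u => h (c u))); last exact/hdom/c_dom.
by move=> j; apply: h_deriv => //; [exact: c_dom|exact: w_der].
Qed.

Let QdZ t : 0 < t < s -> Q (dZ t) = -1.
Proof.
move=> ht; rewrite -(c_metric ht) -h_metric; last exact/c_dom/oo_cc.
by rewrite /metric derive_dev //; exact/hdom/c_dom/oo_cc.
Qed.

Let z t (ht : 0 <= t <= s) : AdS R := adsof (c_dom ht).

Let Zz t (ht : 0 <= t <= s) : Z t = dev (\val (phi (z ht))).
Proof. by rewrite (val_phi phi_h). Qed.

Let QZ t : 0 <= t <= s -> Q (Z t) = -1.
Proof. by move=> ht; rewrite (Zz ht) Q_dev. Qed.

Let ZdZ t : 0 < t < s -> bform (Z t) (dZ t) = 0.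
Proof.
move=> ht; have := Q_deriv (fun i => Z_deriv i (oo_cc ht)).
move=> /(deriv1_eq_oo ht _ (deriv1_cst t (-1))) h0.
suff : 2 * bform (Z t) (dZ t) = 0 by lra.
by apply/esym/h0 => u /oo_cc /QZ ->.
Qed.

Let l0 : 0 <= (0 : R) <= s. Proof. by rewrite lexx ltW. Qed.
Let l1 : 0 <= s <= s. Proof. by rewrite lexx ltW. Qed.

Let z0 : z l0 = a.
Proof. by apply: val_inj; rewrite val_adsof c0 coordK. Qed.

Let zs : z l1 = b.
Proof. by apply: val_inj; rewrite val_adsof cs coordK. Qed.

Let Zbprod t (ht : 0 <= t <= s) : - bform (Z 0) (Z t) = bprod (phi a) (phi (z ht)).
Proof. by rewrite (Zz ht) (Zz l0) z0. Qed.

Let bz t (ht : 0 <= t <= s) u (hu : 0 <= u <= s) : bprod (z ht) (z hu) = cos (u - t).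
Proof. by rewrite /bprod !val_adsof !dev_lift ?lxi_gt0 // bYY opprK. Qed.

Let thz t (ht : 0 <= t <= s) : tht (z ht) = c t 0 2. Proof. by []. Qed.

(** The geodesic stays between [a] and [b], so its image stays between [phi a] and [phi b], where
    [gpos] and [gD] apply. *)
Let bg_itv t : 0 < t <= s -> 0 < - bform (Z 0) (Z t) < 1.
Proof.
move=> /andP[t0 ts]; have ht : 0 <= t <= s by rewrite ltW.
have /andP[d1 d2] := tht_itv ht; have sl := s_lt; have p0 := @pi_gt0 R.
have Dp := Dpi.
have aa : alt a (z ht).
  apply: bprod_alt; first by rewrite thz; lra.
  rewrite -[X in bprod X]z0 bz subr0 -(@cos0 R) ltr_cos_0pi //; lra.
have zb : ale (z ht) b.
  apply: bprod_ale; first by rewrite thz; move: d1 d2 Dp; rewrite /D; lra.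
  by rewrite -[X in bprod _ X]zs bz cos_le1.
have g1 := iso_alt phi_h h_smooth h_metric h_future aa.
have g2 := iso_ale phi_h h_smooth h_future zb.
rewrite (Zbprod ht) gpos ?(altW g1) //=.
apply: bprod_lt1 => //; have := ale_tht g2; have := gD; lra.
Qed.

(** [Z t] and [dZ t] are orthogonal of square -1, so [reverse_Bessel] applied to [Z 0] shows that
    [acos (bg t)] has derivative at least 1 in absolute value. Hence [acos (bg s)] is at least [s],
    the proper time from [a] to [b]. *)
Lemma bprod_contract : bprod (phi a) (phi b) <= bprod a b.
Proof.
pose bg t := - bform (Z 0) (Z t).
have bg_der t : 0 <= t <= s -> is_derive t 1 bg (- bform (Z 0) (dZ t)).
  by move=> ht; apply: deriv1N; apply: bform_deriv => i; exact: Z_deriv.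
have bgs : bg s = bprod (phi a) (phi b) by rewrite /bg (Zbprod l1) zs.
have bg0 : bg 0 = 1 by rewrite /bg (Zbprod l0) z0 bprodxx.
have itv t : 0 < t <= s -> -1 <= bg t <= 1.
  by move=> /bg_itv /andP[h1 /ltW h2]; rewrite h2 andbT; apply: le_trans (ltW h1); lra.
have ge0 t : 0 < t <= s -> 0 <= acos (bg t) by move=> /itv; exact: acos_ge0.
have ss : 0 < s <= s by rewrite s_gt0 lexx.
(* [acos] is not differentiable at [bg 0 = 1], so the estimate starts at time [e]. The sign of the
   derivative is left open, whence a sum rather than a difference; [acos (bg e)] disappears as [e]
   tends to 0. *)
have step e : 0 < e < s -> s <= e + acos (bg e) + acos (bg s).
  move=> /andP[e0 es].
  have dac t : e <= t <= s -> is_derive t 1 (fun u => acos (bg u))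
     (- (Num.sqrt (1 - bg t ^+ 2))^-1 * - bform (Z 0) (dZ t)).
    move=> /andP[et ts]; have t0 := lt_le_trans e0 et.
    apply: deriv1_acos; last by apply: bg_der; rewrite ts ltW.
    have t0s : 0 < t <= s by rewrite t0.
    by have := bg_itv t0s; rewrite -/(bg t) => /andP[h1 ->]; rewrite andbT; apply: lt_trans h1; lra.
  have [t /andP[et ts] ee] := deriv1_mvt es dac.
  have t0 := lt_trans e0 et.
  have ht : 0 < t < s by rewrite t0.
  have rb := reverse_Bessel (Z 0) (QZ (oo_cc ht)) (QdZ ht) (ZdZ ht).
  rewrite (QZ l0) opprK in rb.
  have /andP[g0 g1] : 0 < bg t < 1 by apply: bg_itv; rewrite t0 ltW.
  have S0 : 0 < 1 - bg t ^+ 2 by rewrite subr_gt0 expr_lt1 // ltW.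
  have : 1 <= `|- (Num.sqrt (1 - bg t ^+ 2))^-1 * - bform (Z 0) (dZ t)|.
    rewrite mulrNN normrM normfV mulrC ler_pdivlMr ?normr_gt0 ?gt_eqF ?sqrtr_gt0 //.
    rewrite mul1r (ger0_norm (sqrtr_ge0 _)) -sqrtr_sqr ler_sqrt ?sqr_ge0 //.
    by rewrite /bg sqrrN lerBlDl.
  move=> h1.
  have : s - e <= `|acos (bg s) - acos (bg e)|.
    rewrite ee normrM (gtr0_norm (_ : 0 < s - e)) ?subr_gt0 //.
    by rewrite ler_peMl // subr_ge0 ltW.
  have a1 := ge0 s ss; have a2 : 0 <= acos (bg e) by apply: ge0; rewrite e0 ltW.
  move: a1 a2; move: (acos (bg s)) (acos (bg e)) => x y x0 y0 k.
  by have := le_trans k (ler_normB x y); rewrite (ger0_norm x0) (ger0_norm y0) lerBlDl -addrA (addrC y).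
have key : s <= acos (bg s).
  apply/ler_addgt0Pr => d d0.
  pose d' := Num.min (d / 2) pi.
  have d'0 : 0 < d' by rewrite lt_min pi_gt0 andbT; lra.
  have d'pi : d' <= pi by rewrite ge_min lexx orbT.
  have d'd : d' <= d / 2 by rewrite ge_min lexx.
  have cd : cos d' < 1.
    by rewrite -(@cos0 R) ltr_cos_0pi ?d'0 ?(ltW d'0) ?lexx ?pi_ge0.
  have /cvgrPdist_lt/(_ _ (_ : 0 < 1 - cos d')) : bg @ 0 --> bg 0.
    exact: (deriv1_continuous (bg_der 0 l0)).
  rewrite subr_gt0 => /(_ cd)/nbhs_ballP[r /= r0 hr].
  pose e := Num.min (r / 2) (Num.min (s / 2) d').
  have e0 : 0 < e by rewrite /e lt_min divr_gt0 //= lt_min divr_gt0.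
  have er : e <= r / 2 by rewrite ge_min lexx.
  have es : e <= s / 2 by rewrite /e ge_min ge_min lexx orbT.
  have ed : e <= d' by rewrite /e ge_min ge_min lexx !orbT.
  have es' : 0 < e < s by rewrite e0; have := s_gt0; lra.
  have : ball 0 r e by rewrite /ball /= sub0r normrN gtr0_norm //; lra.
  move=> /hr /=; rewrite bg0 ltr_norml => /andP[_ h1].
  have := step e es'.
  have : acos (bg e) < d'.
    have he : 0 < e <= s by rewrite e0 /=; case/andP: es' => _ /ltW.
    rewrite -ltr_cos_0pi ?(ltW d'0) //; last by rewrite ge0 // acos_lepi // itv.
    by rewrite acosK ?in_itv ?itv //; lra.
  lra.
have sitv : 0 <= s <= pi by rewrite ltW //= acos_lepi.
rewrite -bgs -/b0 -cos_s -[bg s]acosK ?in_itv ?itv //.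
by rewrite ler_cos_0pi // ge0 // acos_lepi // itv.
Qed.

End Expansion.

(** * Local preservation of [bprod], and independent developed points *)

Section Rigidity.
Context {R : realType}.
Implicit Types (a b x y z : AdS R).

Lemma chartK (u : 'rV[R]_3) : coord (chart u) = u.
Proof. by apply: row3P; rewrite !mxE. Qed.

Definition aball x (e : R) y : Prop := adist x y + `|tht y - tht x| < e.

Lemma aball_center x (e : R) : 0 < e -> aball x e x.
Proof. by move=> e0; rewrite /aball adistxx subrr normr0 addr0. Qed.

Lemma aball_tri x y z (e r : R) : aball x e y -> aball y r z -> aball x (e + r) z.
Proof.
rewrite /aball => xy yz; have := adist_triangle y x z.
have := ler_normD (tht y - tht x) (tht z - tht y).
rewrite (addrC (tht y - tht x)) addrA subrK; lra.
Qed.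

Lemma aball_le x y (e r : R) : e <= r -> aball x e y -> aball x r y.
Proof. by move=> er /lt_le_trans; apply. Qed.

Lemma aball_diamond x (e : R) y :
  aball x e y <-> alt (ashift (- e) x) y /\ alt y (ashift e x).
Proof. exact: iff_sym (alt_diamond e x y). Qed.

Section LinearPart.
Variables (phi phi' : AdS R -> AdS R).
Hypotheses (phi_SO : SOhat22 phi) (phi'_SO : SOhat22 phi').
Hypotheses (phiK : cancel phi phi') (phi'K : cancel phi' phi).

(** The inverse images of the two tips of a diamond around [phi x] bound an open diamond around
    [x]. *)
Lemma iso_continuous x (e : R) : 0 < e -> exists2 r : R, 0 < r &
  forall y, aball x r y -> aball (phi x) e (phi y).
Proof.
move=> e0.
have h1 : alt (phi' (ashift (- e) (phi x))) x.
  by rewrite -[X in alt _ X]phiK; apply: SOhat22_alt => //; apply: ashift_alt; rewrite oppr_lt0.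
have h2 : alt x (phi' (ashift e (phi x))).
  by rewrite -[X in alt X _]phiK; apply: SOhat22_alt => //; exact: alt_ashift.
have /nbhs_ads[r r0 hr] := nbhs_alt h1 h2.
exists r => // y /hr [] /= /(SOhat22_alt phi_SO) + /(SOhat22_alt phi_SO).
by rewrite !phi'K => h3 h4; exact/aball_diamond.
Qed.

End LinearPart.

Lemma aball_convex x (e : R) y1 y2 z : aball x e y1 -> aball x e y2 ->
  ale y1 z -> ale z y2 -> aball x e z.
Proof.
move=> /aball_diamond[h1 _] /aball_diamond[_ h2] l1 l2; apply/aball_diamond.
by split; [exact: alt_le_trans l1|exact: ale_lt_trans h2].
Qed.

Lemma SOhat22_contract (phi : AdS R -> AdS R) a b : SOhat22 phi ->
  alt a b -> 0 < bprod a b -> tht b - tht a < pi / 2 ->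
  (forall x, ale (phi a) x -> ale x (phi b) -> 0 < bprod (phi a) x) ->
  tht (phi b) - tht (phi a) <= pi -> bprod (phi a) (phi b) <= bprod a b.
Proof. by move=> [_ [h [h1 h2 h3 _ h5]]]; exact: (bprod_contract h1 h2 h3 h5). Qed.

(** [SOhat22_contract] for [phi] and for its inverse gives the two inequalities. The radius is such
    that [small_diamond] holds around [x] and around [phi x]. *)
Lemma bprod_local (phi phi' : AdS R -> AdS R) x : SOhat22 phi -> SOhat22 phi' ->
  cancel phi phi' -> cancel phi' phi -> exists2 e : R, 0 < e &
  forall a b, aball x e a -> aball x e b -> alt a b ->
  bprod (phi a) (phi b) = bprod a b.
Proof.
move=> S S' K K'.
have p2 := @pi_ge2 R.
have e'0 : 0 < hgt (phi x) / 4 by rewrite divr_gt0 // hgt_gt0.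
have [r r0 hr] := iso_continuous S S' K K' x e'0.
have e0 : 0 < hgt x / 4 by rewrite divr_gt0 // hgt_gt0.
exists (Num.min r (hgt x / 4)); first by rewrite lt_min r0.
have hm1 : Num.min r (hgt x / 4) <= r by rewrite ge_min lexx.
have hm2 : Num.min r (hgt x / 4) <= hgt x / 4 by rewrite ge_min lexx orbT.
move=> a b xa xb ab.
have ga := hr _ (aball_le hm1 xa); have gb := hr _ (aball_le hm1 xb).
have {}xa := aball_le hm2 xa; have {}xb := aball_le hm2 xb.
have gab := SOhat22_alt S ab.
have [b1 d1] := small_diamond xa xb; have [b2 d2] := small_diamond ga gb.
have t1 := ler_norm (tht b - tht a); have t2 := ler_norm (tht (phi b) - tht (phi a)).
apply/eqP; rewrite eq_le; apply/andP; split.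
  apply: SOhat22_contract => //; [lra| |lra].
  by move=> y h1 h2; have [] := small_diamond ga (aball_convex ga gb h1 h2).
rewrite -{1}(K a) -{1}(K b).
apply: SOhat22_contract => //; rewrite ?K; [lra| |lra].
by move=> y h1 h2; have [] := small_diamond xa (aball_convex xa xb h1 h2).
Qed.

Lemma perturb x (v : 'rV[R]_3) (e : R) : 0 < e ->
  exists2 s : R, 0 < s & exists2 b, coord (\val b) = coord (\val x) + s *: v & aball x e b.
Proof.
move=> e0; pose u := coord (\val x); pose c (s : R) := u + s *: v.
have udom : coord_dom u by exact/coord_in_dom/ads_disc.
have c0 : c 0 = u by rewrite /c scale0r addr0.
have dc i : is_derive (0 : R) 1 (fun s => c s 0 i) (v 0 i).
  have := deriv1D (deriv1_cst 0 (u 0 i)) (deriv1M (deriv1_id 0) (deriv1_cst 0 (v 0 i))).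
  have -> : (fun s => c s 0 i) = (fun s => u 0 i + s * v 0 i).
    by apply/funext => s; rewrite !mxE.
  by congr is_derive; ring.
have cc : {for (0 : R), continuous c}.
  have [dc1 _] : is_derive (0 : R) 1 c v by apply: is_derive_mx => j k; rewrite (ord1 j).
  by apply/differentiable_continuous/derivable1_diffP.
have e20 : 0 < e / 2 by rewrite divr_gt0.
have [d d0 hd] := sdist_small e20.
have near_dom : \forall s \near (0 : R), coord_dom (c s).
  by apply: cc; rewrite c0; apply: open_nbhs_nbhs; split; [exact: open_coord_dom|].
have near_i i : \forall s \near (0 : R), `|(chart u).1 0 i - (chart (c s)).1 0 i| < d.
  have c0d : coord_dom (c 0) by rewrite c0.
  have /cvgrPdist_lt/(_ _ d0) := deriv1_continuous (chart_deriv dc c0d i).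
  by rewrite c0.
have near_t : \forall s \near (0 : R), `|u 0 2 - c s 0 2| < e / 2.
  have /cvgrPdist_lt/(_ _ e20) := deriv1_continuous (dc 2).
  by rewrite c0.
have : \forall s \near (0 : R), [/\ coord_dom (c s),
  forall i, `|(chart u).1 0 i - (chart (c s)).1 0 i| < d & `|u 0 2 - c s 0 2| < e / 2].
  have h0 : \forall s \near (0 : R), forall i, `|(chart u).1 0 i - (chart (c s)).1 0 i| < d.
    exact: filter_forall near_i.
  move: near_dom near_t h0; apply: filterS3.
  by move=> s h1 h2 h3; split.
move=> /nbhs_ballP[r r0 hr]; have {}r0 : 0 < r by [].
have r20 : 0 < r / 2 by rewrite divr_gt0.
exists (r / 2) => //.
have [|h1 h2 h3] := hr (r / 2).
  by rewrite /ball /= sub0r normrN gtr0_norm //; lra.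
exists (adsof h1).
  by rewrite val_adsof chartK.
rewrite /aball; have : adist x (adsof h1) < e / 2.
  apply: hd => // i; rewrite val_adsof.
  by have := h2 i; rewrite coordK //; exact: ads_disc.
have : `|tht (adsof h1) - tht x| < e / 2.
  have ux : u 0 2 = tht x by rewrite /u coordE.
  by rewrite distrC -ux.
lra.
Qed.

Definition devmx (w : 'I_4 -> AdS R) : 'M[R]_4 := \matrix_(i, j) dev (\val (w i)) 0 j.

Lemma devmxE w i j : devmx w i j = dev (\val (w i)) 0 j.
Proof. by rewrite mxE. Qed.

Lemma row_devmx w i : row i (devmx w) = dev (\val (w i)).
Proof. by apply/rowP => j; rewrite !mxE. Qed.

Lemma independent_quadruple x (e : R) : 0 < e ->
  exists2 w : 'I_4 -> AdS R, forall i, aball x e (w i) & devmx w \in unitmx.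
Proof.
move=> e0.
have [s1 s10 [b1 eb1 xb1]] := perturb x (row3 1 0 0) e0.
have [s2 s20 [b2 eb2 xb2]] := perturb x (row3 0 1 0) e0.
pose al := Num.min (e / 2) 1.
have al0 : 0 < al by rewrite lt_min ltr01 andbT divr_gt0.
have al1 : al <= 1 by rewrite ge_min lexx orbT.
have ale2 : al <= e / 2 by rewrite ge_min lexx.
pose w (i : 'I_4) : AdS R := nth x [:: x; ashift al x; b1; b2] i.
exists w.
  case=> -[|[|[|[|//]]]] ilt //=; first exact: aball_center.
  rewrite /aball /w /= !ashiftE adistxx add0r addrAC subrr add0r gtr0_norm //; lra.
(* A linear form vanishing on the four developed points is shown to be zero. After clearing heights
   it is linear in [cos theta], [sin theta], [p_1], [p_2]: the perturbations [b1] and [b2] kill its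
   last two coefficients, and the vertical shift by [al] kills the others. *)
rewrite -unitmx_tr -row_free_unit; apply: inj_row_free => v.
move=> /rowP hv.
have hE i : v 0 0 * dev (\val (w i)) 0 0 + v 0 1 * dev (\val (w i)) 0 1 +
   v 0 2 * dev (\val (w i)) 0 2 + v 0 3 * dev (\val (w i)) 0 3 = 0.
  have := hv i; rewrite mxE [RHS]mxE !big_ord_recl big_ord0 addr0 !addrA.
  have -> : lift ord0 ord0 = 1 :> 'I_4 by apply: val_inj.
  have -> : lift ord0 (lift ord0 ord0) = 2 :> 'I_4 by apply: val_inj.
  have -> : lift ord0 (lift ord0 (lift ord0 ord0)) = 3 :> 'I_4 by apply: val_inj.
  by rewrite -!devmxE ![(devmx w)^T _ _]mxE.
have hdev y : v 0 0 * dev (\val y) 0 0 + v 0 1 * dev (\val y) 0 1 + v 0 2 * dev (\val y) 0 2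
   + v 0 3 * dev (\val y) 0 3 = 0 ->
   v 0 0 * cos (tht y) + v 0 1 * sin (tht y) + v 0 2 * (\val y).1 0 0 + v 0 3 * (\val y).1 0 1 = 0.
  rewrite !devE -/(hgt y) -/(tht y) => h.
  have y0 : hgt y != 0 by rewrite gt_eqF // hgt_gt0.
  move: h => /(congr1 (fun k : R => hgt y * k)); rewrite mulr0 => <-.
  by field.
have h0 := hdev x (hE 0); have h1 := hdev (ashift al x) (hE 1).
have h2 := hdev b1 (hE 2); have h3 := hdev b2 (hE 3).
have [x1 y1 t1] : [/\ (\val b1).1 0 0 = (\val x).1 0 0 + s1,
  (\val b1).1 0 1 = (\val x).1 0 1 & tht b1 = tht x].
  move/rowP : eb1 => eb1; have := eb1 0; have := eb1 1; have := eb1 2.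
  by rewrite /tht !mxE /= !mulr0 !addr0 mulr1 => -> -> ->.
have [x2 y2 t2] : [/\ (\val b2).1 0 0 = (\val x).1 0 0,
  (\val b2).1 0 1 = (\val x).1 0 1 + s2 & tht b2 = tht x].
  move/rowP : eb2 => eb2; have := eb2 0; have := eb2 1; have := eb2 2.
  by rewrite /tht !mxE /= !mulr0 !addr0 mulr1 => -> -> ->.
move: h1 h2 h3; rewrite x1 y1 t1 x2 y2 t2 tht_ashift cosD sinD /= => h1 h2 h3.
have v2 : v 0 2 = 0.
  have : v 0 2 * s1 = 0 by move: h2 h0; rewrite mulrDr; lra.
  by move/eqP; rewrite mulf_eq0 (gt_eqF s10) orbF => /eqP.
have v3 : v 0 3 = 0.
  have : v 0 3 * s2 = 0 by move: h3 h0; rewrite mulrDr; lra.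
  by move/eqP; rewrite mulf_eq0 (gt_eqF s20) orbF => /eqP.
move: h0 h1; rewrite v2 v3 !mul0r !addr0.
have sa : 0 < sin al by rewrite sin_gt0_pi // al0; have := @pi_ge2 R; lra.
have cs := cos2Dsin2 (tht x).
move=> h0 h1.
have h4 : sin al * (v 0 1 * cos (tht x) - v 0 0 * sin (tht x)) = 0.
  rewrite -h1 -[RHS]subr0 -(mulr0 (cos al)) -h0; ring.
have {}h4 : v 0 1 * cos (tht x) - v 0 0 * sin (tht x) = 0.
  by move/eqP : h4; rewrite mulf_eq0 (gt_eqF sa) => /eqP.
apply: row4P; rewrite ?v2 ?v3 ![in RHS]mxE //.
- rewrite -[LHS]mulr1 -cs.
  transitivity ((v 0 0 * cos (tht x) + v 0 1 * sin (tht x)) * cos (tht x)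
     - (v 0 1 * cos (tht x) - v 0 0 * sin (tht x)) * sin (tht x)); first by ring.
  by rewrite h0 h4 !mul0r subrr.
- rewrite -[LHS]mulr1 -cs.
  transitivity ((v 0 0 * cos (tht x) + v 0 1 * sin (tht x)) * sin (tht x)
     + (v 0 1 * cos (tht x) - v 0 0 * sin (tht x)) * cos (tht x)); first by ring.
  by rewrite h0 h4 !mul0r addr0.
Qed.

End Rigidity.

(** * The linear part of an isometry *)

Section LinearPart.
Context {R : realType}.
Implicit Types (a b x y z : AdS R).

Definition jmx : 'M[R]_4 := diag_mx (row4 (-1) (-1) 1 1).

Lemma bform_mx (X Y : 'rV[R]_4) : X *m jmx *m Y^T = (bform X Y)%:M.
Proof.
apply/matrixP => i j; rewrite (ord1 i) (ord1 j) mul_mx_diag !mxE eqxx mulr1n.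
rewrite !big_ord_recl big_ord0 addr0 !addrA !mxE /bform.
have -> : lift ord0 ord0 = 1 :> 'I_4 by apply: val_inj.
have -> : lift ord0 (lift ord0 ord0) = 2 :> 'I_4 by apply: val_inj.
have -> : lift ord0 (lift ord0 (lift ord0 ord0)) = 3 :> 'I_4 by apply: val_inj.
by rewrite /= -[ord0]/(0 : 'I_4); ring.
Qed.

Lemma jmxK : jmx *m jmx = 1%:M.
Proof.
apply/matrixP => i j; rewrite mul_diag_mx !mxE.
case: (eqVneq i j) => [->|]; last by rewrite mulr0n mulr0.
case: j => -[|[|[|[|//]]]] ilt /=; rewrite mulr1n; ring.
Qed.

Lemma jmx_unit : jmx \in unitmx.
Proof. by have /mulmx1_unit[] := jmxK. Qed.

Lemma devmx_bform (w y : 'I_4 -> AdS R) i j :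
  (devmx w *m jmx *m (devmx y)^T) i j = bform (dev (\val (w i))) (dev (\val (y j))).
Proof.
have := bform_mx (dev (\val (w i))) (dev (\val (y j))).
rewrite -!row_devmx -!row_mul tr_row => /matrixP /(_ 0 0).
rewrite [X in _ = X -> _]mxE eqxx mulr1n => <-; rewrite [LHS]mxE [RHS]mxE [RHS]mxE.
by apply: eq_bigr => k _; rewrite [col _ _ _ _]mxE.
Qed.

(** [bprod_local] speaks of chronologically related pairs only, so one quadruple is placed around
    the shift of [x] by [- e / 2], in the past of a whole ball around [x]. *)
Lemma two_quadruples x (e : R) : 0 < e -> exists w y : 'I_4 -> AdS R,
  [/\ forall i, aball x e (w i), forall i, aball x (e / 8) (y i),
      devmx w \in unitmx, devmx y \in unitmx &
      forall i z, aball x (e / 8) z -> alt (w i) z].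
Proof.
move=> e0; have e80 : 0 < e / 8 by lra.
have [w xw uw] := independent_quadruple (ashift (- (e / 2)) x) e80.
have [y xy uy] := independent_quadruple x e80.
exists w, y; split=> // [i|i z xz].
  have := xw i; rewrite /aball !ashiftE opprD opprK addrA.
  have := adist_ge0 x (w i).
  have := ler_normB (tht (w i) - tht x + e / 2) (e / 2).
  rewrite addrK (gtr0_norm (_ : 0 < e / 2)); last by lra.
  move: (`|_|) (`|_|) (adist _ _) => u v d; lra.
have := xw i; move: xz; rewrite /aball /alt !ashiftE opprD opprK addrA.
have := adist_triangle x (w i) z; rewrite (adistC (w i) x).
have := ler_norm (tht (w i) - tht x + e / 2).
have := ler_norm (tht x - tht z); rewrite distrC.
have := adist_ge0 x (w i); have := adist_ge0 x z.
lra.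
Qed.

Lemma aball_sub x y z (e : R) :
  aball y (e - (adist x y + `|tht y - tht x|)) z -> aball x e z.
Proof.
rewrite /aball => yz; have := adist_triangle y x z.
have := ler_normD (tht y - tht x) (tht z - tht y).
rewrite (addrC (tht y - tht x)) addrA subrK; lra.
Qed.

Lemma disc_pole : disc (row3 0 0 1 : 'rV[R]_3).
Proof.
by split; [apply/sphereE; rewrite !row3E; ring|rewrite row3E ltr01].
Qed.

(** The parameter is clamped to the unit interval, so that the path is Lipschitz on the whole line
    and its heights, taken on a compact arc, have a positive lower bound. *)
Lemma ads_path a b : exists z : R -> AdS R, [/\ z 0 = a, z 1 = b,
  exists2 K : R, 0 < K & forall s t, adist (z s) (z t) + `|tht (z t) - tht (z s)| <= K * `|s - t| &
  exists2 m : R, 0 < m & forall s, m <= hgt (z s)].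
Proof.
pose cl (s : R) : R := Num.max 0 (Num.min s 1).
have cl_itv s : 0 <= cl s <= 1.
  by rewrite le_max lexx /= ge_max ler01 /= ge_min lexx orbT.
have cl_lip s t : `|cl s - cl t| <= `|s - t|.
  have n1 := ler_norm (s - t); have n2 := ler_norm (t - s).
  rewrite distrC in n2; rewrite ler_norml /cl; move: (`|s - t|) n1 n2 => n n1 n2.
  case: (leP s 1) => hs; case: (leP t 1) => ht; rewrite ?(max_idPr ler01);
    case: (leP 0 s) => h1; case: (leP 0 t) => h2; apply/andP; split; lra.
pose D : R := tht b - tht a.
have pq := adist_ltpi a b.
have gd s : 0 <= s <= 1 -> disc (garc (\val a).1 (\val b).1 s).
  have [sp p2] := ads_disc a; have [sq q2] := ads_disc b.
  by move=> s01; apply: garc_disc => //; [exact: ltW|right].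
pose z s := mkads (gd _ (cl_itv s)) (tht a + cl s * D).
exists z; split.
- apply: val_inj; rewrite /z /= /cl (min_idPl ler01) maxxx mul0r addr0.
  by rewrite garc0 /tht -surjective_pairing.
- apply: val_inj; rewrite /z /= /cl minxx (max_idPr ler01) mul1r /D addrC subrK.
  by rewrite garc1 // /tht -surjective_pairing.
- exists (adist a b + `|D| + 1); first by rewrite ltr_wpDl // addr_ge0 // adist_ge0.
  move=> s t; apply: (@le_trans _ _ ((adist a b + `|D|) * `|s - t|)); last first.
    by rewrite ler_wpM2r // lerDl.
  have -> : tht (z t) - tht (z s) = (cl t - cl s) * D by rewrite /z /tht /=; ring.
  rewrite normrM [leRHS]mulrDl (distrC (cl t)) (mulrC `|D|) lerD //; last first.
    by rewrite ler_wpM2r // cl_lip.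
  apply: (@le_trans _ _ (adist a b * `|cl s - cl t|)); last first.
    by rewrite ler_wpM2l // adist_ge0.
  have /andP[s0 s1] := cl_itv s; have /andP[t0 t1] := cl_itv t.
  have [st|/ltW ts] := leP (cl s) (cl t).
    by rewrite distrC ger0_norm ?subr_ge0 //; exact: sdist_garc.
  by rewrite adistC ger0_norm ?subr_ge0 //; exact: sdist_garc.
have [c] := EVT_min (@ler01 R)
   (deriv1_within (fun s _ => garc_deriv (\val a).1 (\val b).1 s 2)).
rewrite in_itv /= => c01 hc.
exists (garc (\val a).1 (\val b).1 c 0 2); first by have [] := gd c c01.
by move=> s; apply: hc; rewrite in_itv /= cl_itv.
Qed.

Variables (phi phi' : AdS R -> AdS R).
Hypotheses (phi_SO : SOhat22 phi) (phi'_SO : SOhat22 phi').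
Hypotheses (phiK : cancel phi phi') (phi'K : cancel phi' phi).

Definition is_linear_part (A : 'M[R]_4) x (e : R) : Prop :=
  forall y, aball x e y -> dev (\val (phi y)) = dev (\val y) *m A.

Lemma devmx_linear A x (e : R) (w : 'I_4 -> AdS R) : is_linear_part A x e ->
  (forall i, aball x e (w i)) -> devmx (phi \o w) = devmx w *m A.
Proof.
move=> hA xw; apply/row_matrixP => i.
by rewrite row_mul !row_devmx /= hA.
Qed.

(** The products with the images of the four points of [w] determine the image of every nearby [z],
    through a linear system with the same right-hand side as for [z] itself. *)
Lemma local_linear x : exists A : 'M[R]_4, A *m jmx *m A^T = jmx /\
  exists2 e : R, 0 < e & is_linear_part A x e.
Proof.
have [e e0 he] := bprod_local x phi_SO phi'_SO phiK phi'K.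
have hb a b : aball x e a -> aball x e b -> alt a b ->
    bform (dev (\val (phi a))) (dev (\val (phi b))) = bform (dev (\val a)) (dev (\val b)).
  by move=> xa xb /(he _ _ xa xb) /oppr_inj.
have e8e : e / 8 <= e by lra.
have [w [y [xw xy uw uy wy]]] := two_quadruples x e0.
have xye i := aball_le e8e (xy i).
have key (w1 y1 : 'I_4 -> AdS R) : (forall i, aball x e (w1 i)) -> (forall i, aball x e (y1 i)) ->
    (forall i j, alt (w1 i) (y1 j)) ->
    devmx (phi \o w1) *m jmx *m (devmx (phi \o y1))^T = devmx w1 *m jmx *m (devmx y1)^T.
  move=> xw1 xy1 a1; apply/matrixP => i j; rewrite !devmx_bform /= hb //.
have hm : devmx (phi \o w) *m jmx *m (devmx (phi \o y))^T = devmx w *m jmx *m (devmx y)^T.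
  by apply: key => // i j; exact: wy.
have uJ := jmx_unit.
(* This product is unchanged by [phi], so the factor formed with the images of [w] is invertible
   too. *)
have uM : devmx w *m jmx *m (devmx y)^T \in unitmx.
  by rewrite !unitmx_mul uw uJ unitmx_tr uy.
have uw' : devmx (phi \o w) *m jmx \in unitmx.
  by move: uM; rewrite -hm unitmx_mul => /andP[].
pose B := invmx (devmx (phi \o w) *m jmx) *m (devmx w *m jmx).
have lin : is_linear_part B^T x (e / 8).
  move=> z xz; have h := key w (fun=> z) xw (fun=> aball_le e8e xz) (fun i _ => wy i z xz).
  have : (devmx (phi \o (fun=> z)))^T = B *m (devmx (fun=> z))^T.
    by rewrite /B -mulmxA -h mulKmx.
  move=> /(congr1 trmx); rewrite trmx_mul !trmxK => /(congr1 (row 0)).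
  by rewrite row_mul !row_devmx.
clearbody B; have e80 : 0 < e / 8 by lra.
exists B^T; split; last by exists (e / 8).
(* A second pair of quadruples, inside the ball where [phi] is already linear, shows that the matrix
   preserves the form. *)
have [w2 [y2 [xw2 xy2 uw2 uy2 wy2]]] := two_quadruples x e80.
have e88 : e / 8 / 8 <= e / 8 by lra.
have := key w2 y2 (fun i => aball_le e8e (xw2 i)) (fun i => aball_le e8e (aball_le e88 (xy2 i)))
  (fun i j => wy2 i _ (xy2 j)).
rewrite (devmx_linear lin xw2) (devmx_linear lin (fun i => aball_le e88 (xy2 i))).
rewrite trmx_mul !mulmxA => /(congr1 (mulmx^~ (invmx (devmx y2)^T))).
rewrite !mulmxK ?unitmx_tr // => /(congr1 (mulmx (invmx (devmx w2)))).
by rewrite -!mulmxA !mulKmx.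
Qed.

Lemma linear_part_unique A B x (e r : R) : 0 < e -> 0 < r ->
  is_linear_part A x e -> is_linear_part B x r -> A = B.
Proof.
move=> e0 r0 hA hB.
have m0 : 0 < Num.min e r by rewrite lt_min e0.
have [w xw uw] := independent_quadruple x m0.
have m1 : Num.min e r <= e by rewrite ge_min lexx.
have m2 : Num.min e r <= r by rewrite ge_min lexx orbT.
have := devmx_linear hA (fun i => aball_le m1 (xw i)).
rewrite (devmx_linear hB (fun i => aball_le m2 (xw i))).
move=> /(congr1 (mulmx (invmx (devmx w)))).
by rewrite !mulKmx.
Qed.

(** The local matrix is unique, hence locally constant; along a path joining two points its entries
    have zero derivative. *)
Lemma linear_part : exists A : 'M[R]_4, A *m jmx *m A^T = jmx /\
  forall y, dev (\val (phi y)) = dev (\val y) *m A.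
Proof.
have [A hA] := choice local_linear.
have stable x y (e : R) : is_linear_part (A x) x e -> aball x e y -> A y = A x.
  move=> he xy; have [_ [r r0 hr]] := hA y.
  have d0 : 0 < e - (adist x y + `|tht y - tht x|) by rewrite subr_gt0.
  by apply: linear_part_unique r0 d0 hr _ => z yz; apply: he; exact: aball_sub yz.
have const a b : A a = A b.
  have [z [z0 z1 [K K0 z_lip] _]] := ads_path a b.
  rewrite -z0 -z1; apply/matrixP => i j.
  apply: (is_derive_0_is_cst (f := fun s => A (z s) i j)) => s.
  apply: near_eq_is_derive (is_derive_cst (A (z s) i j) s 1).
  have [_ [e e0 he]] := hA (z s).
  apply/nbhs_ballP; exists (e / K); first by rewrite /= divr_gt0.
  move=> t; rewrite /ball /= ltr_pdivlMr // => st; rewrite (stable (z s) (z t) e) //.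
  by apply: le_lt_trans st; rewrite mulrC; exact: z_lip.
exists (A (mkads disc_pole 0)); split; first by have [] := hA (mkads disc_pole 0).
move=> y; have [_ [e e0 he]] := hA y.
by rewrite (const _ y) he //; exact: aball_center.
Qed.

End LinearPart.

(** * A pigeonhole principle for bounded families *)

Section Pigeonhole.
Context {R : realType}.

Lemma bounded_infinite_close (T : Type) (I : finType) (S : set T) (F : T -> I -> R) (B d : R) :
  0 < d -> (forall g, S g -> forall i, `|F g i| <= B) ->
  (forall g g', S g -> S g' -> (forall i, `|F g i - F g' i| < d) -> g = g') ->
  finite_set S.
Proof.
move=> d0 hB hS.
(* Each value is shifted by [B] and rounded down to a multiple of [d]; two elements of the same cell
   are [d]-close, hence equal. *)
pose cell (g : T) : {ffun I -> 'I_(Num.truncn (2 * B / d)).+1} :=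
  [ffun i => inord (Num.truncn ((F g i + B) / d))].
have inj : {in S &, injective cell}.
  move=> g g' /set_mem Sg /set_mem Sg' /ffunP e; apply: hS => // i.
  have := e i; rewrite !ffunE => /(congr1 val) /=.
  have nn h : S h -> 0 <= (F h i + B) / d.
    move=> Sh; rewrite divr_ge0 // ?(ltW d0) //.
    by have := hB h Sh i; rewrite ler_norml; lra.
  have le h : S h -> (Num.truncn ((F h i + B) / d) < (Num.truncn (2 * B / d)).+1)%N.
    move=> Sh; rewrite ltnS le_truncn // ler_pM2r ?invr_gt0 //.
    by have := hB h Sh i; rewrite ler_norml; lra.
  rewrite !inordK ?le // => ee.
  have /andP[l1 l2] := truncn_itv (nn _ Sg); have /andP[l3 l4] := truncn_itv (nn _ Sg').
  rewrite -ee in l3 l4; move: (Num.truncn _) l1 l2 l3 l4 {ee} => n.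
  rewrite !ler_pdivlMr // !ltr_pdivrMr // -natr1 mulrDl mul1r => l1 l2 l3 l4.
  by rewrite ltr_norml; apply/andP; split; lra.
apply: (card_le_finite _ (finite_finset (X := cell @` S))).
by have := inj_card_eq inj; rewrite card_eq_sym card_eq_le => /andP[].
Qed.

End Pigeonhole.

(** * Quantitative estimates for matrices and developed points *)

Section Estimates.
Context {R : realType}.
Implicit Types (a b x y z : AdS R).

Lemma sin_lip (s t : R) : `|sin s - sin t| <= `|s - t|.
Proof.
rewrite -!cosBpihalf; have -> : s - t = (s - pi / 2) - (t - pi / 2) by ring.
exact: cos_lip.
Qed.

Definition mxb m n (A : 'M[R]_(m, n)) (e : R) : Prop := forall i j, `|A i j| <= e.

Lemma mxb_mul m n p (A : 'M[R]_(m, n)) (B : 'M[R]_(n, p)) (a b : R) :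
  mxb A a -> mxb B b -> mxb (A *m B) (n%:R * (a * b)).
Proof.
move=> hA hB i j; rewrite mxE; apply: (le_trans (ler_norm_sum _ _ _)).
have -> : n%:R * (a * b) = \sum_(k < n) (a * b) by rewrite sumr_const card_ord mulr_natl.
by apply: ler_sum => k _; rewrite normrM ler_pM.
Qed.

Lemma mxb_le m n (A : 'M[R]_(m, n)) (a b : R) : a <= b -> mxb A a -> mxb A b.
Proof. by move=> ab hA i j; exact: le_trans (hA i j) ab. Qed.

Lemma mxb_tr m n (A : 'M[R]_(m, n)) (a : R) : mxb A a -> mxb A^T a.
Proof. by move=> hA i j; rewrite mxE. Qed.

Lemma mxb_ex m n (A : 'M[R]_(m, n)) : exists2 a : R, 0 < a & mxb A a.
Proof.
exists (1 + \sum_i \sum_j `|A i j|).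
  by rewrite ltr_pwDl // sumr_ge0 // => i _; rewrite sumr_ge0.
move=> i j; rewrite (bigD1 i) //= (bigD1 j) //=.
have h1 : 0 <= \sum_(i0 < n | i0 != j) `|A i i0| by rewrite sumr_ge0.
have h2 : 0 <= \sum_(i0 < m | i0 != i) \sum_j0 `|A i0 j0|.
  by rewrite sumr_ge0 // => k _; rewrite sumr_ge0.
lra.
Qed.

Lemma mxb_jmx : mxb (jmx : 'M[R]_4) 1.
Proof.
move=> i j; rewrite !mxE; case: eqVneq => _; last by rewrite mulr0n normr0.
by case: i => -[|[|[|[|//]]]] ilt /=; rewrite mulr1n ?normrN normr1.
Qed.

Lemma coord_bound x i : `|(\val x).1 0 i| <= 1.
Proof.
rewrite -(expr_le1 (n := 2)) // real_normK ?num_real //.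
have /sphereE := ads_sphere x.
have := sqr_ge0 ((\val x).1 0 0); have := sqr_ge0 ((\val x).1 0 1).
have := sqr_ge0 ((\val x).1 0 2).
case: i => -[|[|[|//]]] ilt.
- rewrite (_ : Ordinal ilt = 0); [lra|exact: val_inj].
- rewrite (_ : Ordinal ilt = 1); [lra|exact: val_inj].
- rewrite (_ : Ordinal ilt = 2); [lra|exact: val_inj].
Qed.

Lemma mxb_dev x (m : R) : 0 < m -> m <= hgt x -> mxb (dev (\val x)) m^-1.
Proof.
move=> m0 mx i j; rewrite (ord1 i).
have hi : (hgt x)^-1 <= m^-1 by rewrite lef_pV2 ?posrE ?hgt_gt0.
have h0 : 0 <= (hgt x)^-1 by rewrite invr_ge0 ltW // hgt_gt0.
have key (t : R) : `|t| <= 1 -> `|(hgt x)^-1 * t| <= m^-1.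
  move=> t1; rewrite normrM (ger0_norm h0); apply: le_trans hi.
  by rewrite ler_piMr.
case: j => -[|[|[|[|//]]]] ilt.
- by rewrite (_ : Ordinal ilt = 0) ?devE; [apply/key/cos_max|exact: val_inj].
- by rewrite (_ : Ordinal ilt = 1) ?devE; [apply/key/sin_max|exact: val_inj].
- by rewrite (_ : Ordinal ilt = 2) ?devE; [apply/key/coord_bound|exact: val_inj].
- by rewrite (_ : Ordinal ilt = 3) ?devE; [apply/key/coord_bound|exact: val_inj].
Qed.

Definition ads_close (d : R) x y : Prop :=
  (forall i, `|(\val x).1 0 i - (\val y).1 0 i| < d) /\ `|tht x - tht y| < d.

Lemma mxb_dev_close x y (m d : R) : 0 < m -> m <= hgt x -> m <= hgt y -> ads_close d x y ->
  mxb (dev (\val x) - dev (\val y)) (d * (m^-1 + m^-1 ^+ 2)).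
Proof.
move=> m0 mx my [hc ht] i j; rewrite (ord1 i).
have d0 : 0 <= d by apply: le_trans (ltW ht).
have x0 := hgt_gt0 x; have y0 := hgt_gt0 y.
have key (s t : R) : `|t| <= 1 -> `|s - t| <= d ->
    `|(hgt x)^-1 * s - (hgt y)^-1 * t| <= d * (m^-1 + m^-1 ^+ 2).
  move=> t1 st.
  have -> : (hgt x)^-1 * s - (hgt y)^-1 * t =
    (hgt x)^-1 * (s - t) + (hgt x)^-1 * (hgt y)^-1 * (hgt y - hgt x) * t.
    by field; rewrite !gt_eqF.
  have hx : `|(hgt x)^-1| <= m^-1.
    by rewrite ger0_norm ?invr_ge0 ?(ltW x0) // lef_pV2 ?posrE.
  have hy : `|(hgt y)^-1| <= m^-1.
    by rewrite ger0_norm ?invr_ge0 ?(ltW y0) // lef_pV2 ?posrE.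
  apply: (le_trans (ler_normD _ _)); rewrite [leRHS]mulrDr lerD //.
    by rewrite normrM mulrC ler_pM.
  rewrite normrM -[leRHS]mulr1 ler_pM // normrM mulrC ler_pM //.
    by have := hc 2; rewrite distrC -/(hgt x) -/(hgt y) => /ltW.
  by rewrite normrM expr2 ler_pM.
rewrite [X in `|X|]mxE [X in _ + X]mxE.
case: j => -[|[|[|[|//]]]] ilt.
- rewrite (_ : Ordinal ilt = 0) ?devE; [apply: key|exact: val_inj].
    exact: cos_max.
  by apply: le_trans (cos_lip _ _) _; exact: ltW.
- rewrite (_ : Ordinal ilt = 1) ?devE; [apply: key|exact: val_inj].
    exact: sin_max.
  by apply: le_trans (sin_lip _ _) _; exact: ltW.
- rewrite (_ : Ordinal ilt = 2) ?devE; [apply: key|exact: val_inj].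
    exact: coord_bound.
  exact: ltW.
- rewrite (_ : Ordinal ilt = 3) ?devE; [apply: key|exact: val_inj].
    exact: coord_bound.
  exact: ltW.
Qed.

(* If [dev x] is close to [dev z] then so are [x] and [z], up to the deck
   transformation [theta |-> theta + 2 pi]. *)
Lemma dev_close_cos z x (e : R) : 0 <= e -> e <= 1 / 4 ->
  mxb (dev (\val x) - dev (\val z)) e ->
  1 - 4 * e <= cos (tht x - tht z) /\ 1 - 8 * e / hgt z <= cos (adist z x).
Proof.
move=> e0 e4 h.
have x0 := hgt_gt0 x; have z0 := hgt_gt0 z.
pose rz := (hgt z)^-1; pose rx := (hgt x)^-1.
have rz1 : 1 <= rz by rewrite /rz invf_ge1 // hgt_le1.
have rx0 : 0 < rx by rewrite invr_gt0.
pose u i := dev (\val x) 0 i - dev (\val z) 0 i.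
have hu i : `|u i| <= e by have := h 0 i; rewrite [X in `|X|]mxE [X in _ + X]mxE.
have hz i : `|dev (\val z) 0 i| <= rz by exact: (mxb_dev z0 (lexx _)).
(* [rx] and [rz] are the norms of the negative parts of the two developed points, which form the
   angle [tht x - tht z]; this is their inner product. *)
have cT : rx * rz * cos (tht x - tht z) =
   rz ^+ 2 + u 0 * dev (\val z) 0 0 + u 1 * dev (\val z) 0 1.
  rewrite /u !devE -/(tht x) -/(tht z) -/(hgt x) -/(hgt z) -/rx -/rz cosB.
  have cs := cos2Dsin2 (tht z).
  transitivity (rz ^+ 2 * (cos (tht z) ^+ 2 + sin (tht z) ^+ 2) +
    (rx * cos (tht x) - rz * cos (tht z)) * (rz * cos (tht z)) +
    (rx * sin (tht x) - rz * sin (tht z)) * (rz * sin (tht z))); first by ring.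
  by rewrite cs mulr1.
have hp i : `|u i * dev (\val z) 0 i| <= e * rz by rewrite normrM ler_pM.
have rxle : rx <= rz + 2 * e.
  have : (rx - rz) ^+ 2 <= 2 * e ^+ 2.
    have h1 : rx ^+ 2 - 2 * (rx * rz * cos (tht x - tht z)) + rz ^+ 2 = u 0 ^+ 2 + u 1 ^+ 2.
      rewrite /u !devE -/(tht x) -/(tht z) -/(hgt x) -/(hgt z) -/rx -/rz cosB.
      have cs := cos2Dsin2 (tht z); have cs' := cos2Dsin2 (tht x).
      transitivity (rx ^+ 2 * (cos (tht x) ^+ 2 + sin (tht x) ^+ 2) -
        2 * (rx * rz * (cos (tht x) * cos (tht z) + sin (tht x) * sin (tht z))) +
        rz ^+ 2 * (cos (tht z) ^+ 2 + sin (tht z) ^+ 2)); last by ring.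
      by rewrite cs cs' !mulr1.
    have h2 : u 0 ^+ 2 <= e ^+ 2 by rewrite -real_normK ?num_real // ler_pXn2r ?nnegrE.
    have h3 : u 1 ^+ 2 <= e ^+ 2 by rewrite -real_normK ?num_real // ler_pXn2r ?nnegrE.
    have h4 : rx * rz * cos (tht x - tht z) <= rx * rz.
      by rewrite ler_piMr ?cos_le1 // mulr_ge0 ?(ltW rx0) //; lra.
    move: h1 h2 h3 h4; clear; move: (rx * rz * _) (u 0 ^+ 2) (u 1 ^+ 2) => c v w.
    rewrite sqrrB; lra.
  move=> h1; rewrite leNgt; apply/negP => h2.
  have h3 : (2 * e) ^+ 2 <= (rx - rz) ^+ 2 by rewrite ler_pXn2r ?nnegrE //; lra.
  have e00 : e = 0.
    apply/eqP; rewrite -sqrf_eq0 eq_le sqr_ge0 andbT.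
    by move: h1 h3; rewrite exprMn; lra.
  by move: h1; rewrite e00 expr0n /= mulr0 => h4; move: h2; rewrite e00 => h5; nra.
have c1 : 1 - 4 * e <= cos (tht x - tht z).
  have := hp 0; have := hp 1; rewrite !ler_norml => /andP[h1 _] /andP[h2 _].
  have h3 : rz * (rz - 2 * e) <= rx * rz * cos (tht x - tht z) by rewrite cT; lra.
  have h4 : rz - 2 * e <= rx * cos (tht x - tht z).
    have rz0 : 0 < rz by lra.
    by rewrite -(ler_pM2l rz0) mulrA (mulrC rz rx).
  have c0 : 0 <= cos (tht x - tht z).
    by rewrite -(pmulr_rge0 _ rx0); lra.
  have h5 : rz - 2 * e <= (rz + 2 * e) * cos (tht x - tht z).
    by apply: (le_trans h4); rewrite ler_wpM2r.
  have c1 := cos_le1 (tht x - tht z).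
  nra.
split => //.
(* As [Q (dev z) = -1], the number [1 - bprod z x] is the product of [dev z] with the difference
   [u]. *)
have h6 : `|1 - bprod z x| <= 4 * (rz * e).
  have -> : 1 - bprod z x = - (dev (\val z) 0 0 * u 0) - dev (\val z) 0 1 * u 1
     + dev (\val z) 0 2 * u 2 + dev (\val z) 0 3 * u 3.
    have := Q_dev z; rewrite /Q /bprod /bform /u => q; rewrite opprK.
    by rewrite -[X in X + _](opprK 1) -q; ring.
  have hp' i : `|dev (\val z) 0 i * u i| <= rz * e by rewrite normrM ler_pM.
  have := hp' 0; have := hp' 1; have := hp' 2; have := hp' 3; clear.
  move: (rz * e) (dev _ 0 0 * _) (dev _ 0 1 * _) (dev _ 0 2 * _) (dev _ 0 3 * _).
  move=> k a0 a1 a2 a3.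
  by rewrite !ler_norml => /andP[? ?] /andP[? ?] /andP[? ?] /andP[? ?]; apply/andP; split; lra.
have := bprodE z x.
have h7 : `|(1 - bprod z x) * (hgt z * hgt x)| <= 4 * (rz * e).
  rewrite normrM -[leRHS]mulr1 ler_pM // ger0_norm ?mulr_ge0 ?(ltW z0) ?(ltW x0) //.
  by rewrite mulr_ile1 ?(ltW z0) ?(ltW x0) ?hgt_le1.
move: h7; rewrite ler_norml => /andP[h7 _] h8.
have h9 : e <= rz * e by rewrite ler_peMl.
have -> : 8 * e / hgt z = 8 * (rz * e) by rewrite /rz; ring.
lra.
Qed.

End Estimates.

(** * Invariance of the domain, and quotients of nearby group elements *)

Section GroupAction.
Context {R : realType}.
Implicit Types (a b k x y z : AdS R).
Variables (f : 'rV[R]_3 -> R) (G : SOhat22_subgroup R).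
Hypothesis f_lip : lipschitz1 f.
Hypothesis G_preserves : forall g, G g -> preserves g (circle_graph f).
Local Notation D := (invisible_domain f).

Lemma G_ale g a b : G g -> ale a b -> ale (g a) (g b).
Proof. by move=> /subgroup_sub; exact: SOhat22_ale. Qed.

Lemma G_alt g a b : G g -> alt a b -> alt (g a) (g b).
Proof. by move=> /subgroup_sub; exact: SOhat22_alt. Qed.

Lemma G_altP g a b : G g -> alt (g a) (g b) <-> alt a b.
Proof.
move=> Gg; split; last exact: G_alt.
by have [h [Gh gK hK]] := subgroup_inv Gg; move=> /(G_alt Gh); rewrite !gK.
Qed.

Lemma G_dom g z : G g -> D z -> D (g z).
Proof.
move=> Gg /(domain_nonrel f_lip)[a [b [na nb az zb]]].
have [h [Gh gK hK]] := subgroup_inv Gg.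
have nr c : nonrel f c -> nonrel f (g c).
  by apply: (@nonrel_image _ f g h) => // [? ?|]; [exact: G_ale|exact: G_preserves].
by apply/(domain_nonrel f_lip); exists (g a), (g b); split; [exact: nr|exact: nr|exact: G_alt|exact: G_alt].
Qed.

Lemma G_image g : G g -> g @` D = D.
Proof.
move=> Gg; apply/seteqP; split => [_ [z Dz <-]|z Dz]; first exact: G_dom.
have [h [Gh gK hK]] := subgroup_inv Gg.
by exists (h z); [exact: G_dom|exact: hK].
Qed.

Lemma G_linear g : G g -> exists A : 'M[R]_4, A *m jmx *m A^T = jmx /\
  forall y, dev (\val (g y)) = dev (\val y) *m A.
Proof.
move=> Gg; have [h [Gh gK hK]] := subgroup_inv Gg.
exact: (linear_part (subgroup_sub Gg) (subgroup_sub Gh) gK hK).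
Qed.

Lemma G_bprod g a b : G g -> bprod (g a) (g b) = bprod a b.
Proof.
move=> /G_linear[A [AJ hA]]; rewrite /bprod; congr (- _).
have := bform_mx (dev (\val (g a))) (dev (\val (g b))).
rewrite !hA trmx_mul !mulmxA -(mulmxA _ A) -(mulmxA _ _ A^T) AJ bform_mx.
by move=> /matrixP /(_ 0 0); rewrite !mxE eqxx !mulr1n.
Qed.

Lemma domain_depth k : D k -> exists2 m : R, 0 < m &
  forall x, D x -> ale k x \/ ale x k -> m <= hgt x.
Proof.
move=> /(invisible_domainP f_lip)[eta eta0 hk].
(* Adding the margin inequalities at [k] and at [x] to the relation and the triangle inequality
   gives [2 d(x, q) > eta] for every [q] on the circle. *)
pose e := Num.min (eta / 2) 1.
have e0 : 0 < e by rewrite lt_min ltr01 andbT divr_gt0.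
have e1 : e <= 1 by rewrite ge_min lexx orbT.
have e2 : e <= eta / 2 by rewrite ge_min lexx.
have p2 := @pi_ge2 R.
have ce : cos e < 1 by rewrite -(@cos0 R) ltr_cos_0pi ?lexx //; lra.
exists (1 - cos e); first by rewrite subr_gt0.
move=> x /(invisible_domainP f_lip)[eta' eta'0 hx] kx.
have deep_dist q : circle q -> e < sdist (\val x).1 q.
  move=> cq; have [h1 h2] := hk q cq; have [h3 h4] := hx q cq.
  have t1 := sdist_triangle (ads_sphere k) (ads_sphere x) (circle_sphere cq).
  rewrite -/(adist k x) in t1.
  case: kx => kx; first by move: kx; rewrite /ale; lra.
  by move: kx; rewrite /ale adistC; lra.
have /sphereE sx := ads_sphere x; rewrite -/(hgt x) in sx.
have x0 := hgt_gt0 x; have x1 := hgt_le1 x.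
have h2 : hgt x ^+ 2 <= hgt x by rewrite expr2 ler_piMl // ltW.
pose r := Num.sqrt ((\val x).1 0 0 ^+ 2 + (\val x).1 0 1 ^+ 2).
have r2 : r ^+ 2 = (\val x).1 0 0 ^+ 2 + (\val x).1 0 1 ^+ 2.
  by rewrite sqr_sqrtr // addr_ge0 ?sqr_ge0.
have [r0|r0] := eqVneq r 0.
  have : 0 <= cos e by apply: cos_ge0_pihalf; lra.
  by move: r2; rewrite r0 expr0n /=; lra.
have {}r0 : 0 < r by rewrite lt_neqAle eq_sym r0 sqrtr_ge0.
(* The boundary point nearest to [x], whose scalar product with [x] is [r]. So [r < cos e], and
   [hgt x >= hgt x ^+ 2 = 1 - r^2 >= 1 - r]. *)
pose q : 'rV[R]_3 := row3 ((\val x).1 0 0 / r) ((\val x).1 0 1 / r) 0.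
have cq : circle q.
  split; last by rewrite row3E.
  apply/sphereE; rewrite !row3E !exprMn -mulrDl -r2 exprVn expr0n /= addr0.
  by rewrite divff // expf_neq0 // gt_eqF.
have dq : dot (\val x).1 q = r.
  rewrite dotE !row3E mulr0 addr0 !mulrA -mulrDl -!expr2 -r2 expr2 mulfK //.
  by rewrite gt_eqF.
have : r < cos e.
  have sq := circle_sphere cq.
  rewrite -dq -cos_sdist // ltr_cos_0pi ?sdist_ge0 ?sdist_lepi //; first exact: deep_dist.
  by lra.
have rr : r ^+ 2 <= r.
  by rewrite expr2 ler_piMl ?(ltW r0) // -(expr_le1 (n := 2)) ?(ltW r0) // r2; have := sqr_ge0 (hgt x); lra.
lra.
Qed.

Lemma domain_bounded : exists B : R, forall x, D x -> `|tht x| <= B.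
Proof.
have [y0 cy0] := @circle_neq0 R.
exists (`|f y0| + pi) => x /(invisible_domainP f_lip)[eta eta0 hx].
have [h1 h2] := hx _ cy0; have := sdist_lepi (ads_sphere x) (circle_sphere cy0).
have := ler_norm (f y0); have := ler_norm (- f y0); rewrite normrN ler_norml.
by move=> h3 h4 h5; apply/andP; split; lra.
Qed.

Lemma ads_close_aball (e : R) : 0 < e -> exists2 d : R, 0 < d &
  forall x y, ads_close d x y -> aball x e y.
Proof.
move=> e0; have e20 : 0 < e / 2 by rewrite divr_gt0.
have [d d0 hd] := sdist_small e20.
exists (Num.min d (e / 2)); first by rewrite lt_min d0.
have m1 : Num.min d (e / 2) <= d by rewrite ge_min lexx.
have m2 : Num.min d (e / 2) <= e / 2 by rewrite ge_min lexx orbT.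
move=> x y [h1 h2]; rewrite /aball distrC.
have : adist x y < e / 2 by apply: hd => // i; exact: lt_le_trans (h1 i) m1.
by have := lt_le_trans h2 m2; lra.
Qed.

Lemma ads_close_le (d e : R) x y : d <= e -> ads_close d x y -> ads_close e x y.
Proof.
by move=> de [h1 h2]; split=> [i|]; [exact: lt_le_trans (h1 i) de|exact: lt_le_trans h2 de].
Qed.

Lemma bprod_margin a b : (1 - bprod a b) * (hgt a * hgt b) <= `|tht b - tht a - adist a b|.
Proof.
rewrite bprodE distrC; apply: le_trans (cos_lip _ _); exact: ler_norm.
Qed.

Section NearIdentity.
Variables (w : 'I_4 -> AdS R) (x0 xm xp : AdS R) (m : R).
Hypothesis uw : devmx w \in unitmx.
Hypotheses (xm0 : alt xm x0) (x0p : alt x0 xp).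
Hypotheses (xm_pi : tht x0 - tht xm < pi / 2) (xp_pi : tht xp - tht x0 < pi / 2).
Hypothesis m0 : 0 < m.

Definition deep_at (g : AdS R -> AdS R) : Prop := (forall i, m <= hgt (g (w i))) /\
  [/\ m <= hgt (g x0), m <= hgt (g xm) & m <= hgt (g xp)].

Definition close_at (d : R) (g g' : AdS R -> AdS R) : Prop :=
  (forall i, ads_close d (g (w i)) (g' (w i))) /\ ads_close d (g x0) (g' x0).

(** With [A] and [A'] the matrices of [g] and [g'], the quotient [k] has matrix [A' J A^T J],
    because [J A^T J] inverts [A]. So [dev (k x) - dev x] is linear in [A' - A], which is read off
    the test points [w]; each factor 4 comes from a product of matrices. *)
Lemma linear_close (r : R) : 0 < r -> exists2 C : R, 0 < C &
  forall (d : R) g g' (k : AdS R -> AdS R), 0 < d -> G g -> G g' -> G k -> (forall x, g (k x) = g' x) ->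
  deep_at g -> deep_at g' -> close_at d g g' ->
  forall x, r <= hgt x -> mxb (dev (\val (k x)) - dev (\val x)) (C * d).
Proof.
move=> r0; have [c c0 hc] := mxb_ex (invmx (devmx w)).
pose e := m^-1 + m^-1 ^+ 2.
have e0 : 0 < e by rewrite addr_gt0 ?exprn_gt0 ?invr_gt0.
exists (4 * (4 * (4 * (4 * (r^-1 * (4 * (c * e))) * 1) * (4 * (c * m^-1))) * 1)).
  by rewrite !(mulr_gt0, invr_gt0).
move=> d g g' k d0 Gg Gg' Gk gk [dg _] [dg' _] [cl _] x rx.
have [A [AJ hA]] := G_linear Gg; have [A' [AJ' hA']] := G_linear Gg'.
have eA (h : AdS R -> AdS R) B : (forall y, dev (\val (h y)) = dev (\val y) *m B) ->
    B = invmx (devmx w) *m devmx (h \o w).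
  move=> hB; rewrite (_ : devmx (h \o w) = devmx w *m B) ?mulKmx //.
  by apply/row_matrixP => i; rewrite row_mul !row_devmx /= hB.
have kx : dev (\val (k x)) = dev (\val x) *m A' *m jmx *m A^T *m jmx.
  rewrite -hA' -gk hA -!mulmxA (mulmxA A) (mulmxA (A *m jmx)) AJ jmxK mulmx1 //.
have xE : dev (\val x) = dev (\val x) *m A *m jmx *m A^T *m jmx.
  by rewrite -!mulmxA (mulmxA A) (mulmxA (A *m jmx)) AJ jmxK mulmx1.
have -> : dev (\val (k x)) - dev (\val x) = dev (\val x) *m
   (invmx (devmx w) *m (devmx (g' \o w) - devmx (g \o w))) *m jmx *m A^T *m jmx.
  by rewrite mulmxBr -(eA _ _ hA') -(eA _ _ hA) mulmxBr !mulmxBl -kx -xE.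
have bA : mxb A (4 * (c * m^-1)).
  rewrite (eA g A hA); apply: mxb_mul => // i j; rewrite devmxE.
  exact: (mxb_dev m0 (dg i)).
have bD : mxb (devmx (g' \o w) - devmx (g \o w)) (d * e).
  move=> i j; rewrite mxE [X in _ + X]mxE !devmxE /= distrC.
  have := mxb_dev_close m0 (dg i) (dg' i) (cl i) 0 j.
  by rewrite mxE [X in _ + X]mxE.
have bx : mxb (dev (\val x)) r^-1 by exact: mxb_dev.
have bJ := @mxb_jmx R.
have := mxb_mul (mxb_mul (mxb_mul (mxb_mul bx (mxb_mul hc bD)) bJ) (mxb_tr bA)) bJ.
by apply: mxb_le; rewrite le_eqVlt; apply/orP; left; apply/eqP; ring.
Qed.

(** Excludes deck transformations at the base point. Since [bprod] is invariant and heights are at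
    least [m], [g x0] lies between [g xm] and [g xp] with a slack independent of [g]; so does the
    nearby point [g' x0 = g (k x0)], and [k x0] lies between [xm] and [xp]. *)
Lemma base_lift : exists2 d : R, 0 < d & forall g g' (k : AdS R -> AdS R), G g -> (forall x, g (k x) = g' x) ->
  deep_at g -> close_at d g g' -> `|tht (k x0) - tht x0| < pi / 2.
Proof.
have p0 := @pi_gt0 R.
pose m1 := (1 - bprod xm x0) * (m * m); pose m2 := (1 - bprod x0 xp) * (m * m).
have m10 : 0 < m1.
  apply: mulr_gt0; last exact: mulr_gt0.
  by rewrite subr_gt0; apply: bprod_lt1 => //; have := xm_pi; have := xp_pi; lra.
have m20 : 0 < m2.
  apply: mulr_gt0; last exact: mulr_gt0.
  by rewrite subr_gt0; apply: bprod_lt1 => //; have := xm_pi; have := xp_pi; lra.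
have mu0 : 0 < Num.min m1 m2 by rewrite lt_min m10.
have mu1 : Num.min m1 m2 <= m1 by rewrite ge_min lexx.
have mu2 : Num.min m1 m2 <= m2 by rewrite ge_min lexx orbT.
have [d d0 hd] := ads_close_aball mu0.
exists d => // g g' k Gg gk [_ [dg1 dg2 dg3]] [_ /hd] cl.
have marg a b : alt a b -> tht b - tht a <= pi -> m <= hgt (g a) -> m <= hgt (g b) ->
    (1 - bprod a b) * (m * m) <= tht (g b) - tht (g a) - adist (g a) (g b).
  move=> ab ba ma mb; have gab := G_alt Gg ab.
  rewrite -[leRHS]ger0_norm; last by rewrite subr_ge0; exact: ltW.
  apply: le_trans (bprod_margin _ _); rewrite G_bprod // ler_wpM2l //.
    by rewrite subr_ge0 ltW // bprod_lt1.
  by rewrite ler_pM // ltW.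
have h1 := marg _ _ xm0 (ltW (lt_trans xm_pi (_ : pi / 2 < pi))) dg2 dg1.
have h2 := marg _ _ x0p (ltW (lt_trans xp_pi (_ : pi / 2 < pi))) dg1 dg3.
have {}h1 : m1 <= tht (g x0) - tht (g xm) - adist (g xm) (g x0) by apply: h1; lra.
have {}h2 : m2 <= tht (g xp) - tht (g x0) - adist (g x0) (g xp) by apply: h2; lra.
move: cl; rewrite /aball => cl.
have n1 := ler_norm (tht (g' x0) - tht (g x0)).
have n2 := ler_norm (- (tht (g' x0) - tht (g x0))); rewrite normrN in n2.
have : alt (g xm) (g (k x0)).
  by rewrite gk /alt; have := adist_triangle (g x0) (g xm) (g' x0); lra.
have : alt (g (k x0)) (g xp).
  by rewrite gk /alt; have := adist_triangle (g x0) (g' x0) (g xp); rewrite (adistC (g' x0) (g x0)); lra.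
move=> /(G_altP _ _ Gg)/alt_tht h3 /(G_altP _ _ Gg)/alt_tht h4.
by have := xm_pi; have := xp_pi; rewrite ltr_norml => h5 h6; apply/andP; split; lra.
Qed.

(** [dev_close_cos] controls [k] only through cosines. The [theta] displacement is followed from
    [x0] to [z]: its cosine stays positive and it starts within [pi / 2], so it never leaves that
    interval. *)
Lemma near_identity z (e : R) : 0 < e -> exists2 d : R, 0 < d &
  forall g g' (k : AdS R -> AdS R), G g -> G g' -> G k -> (forall x, g (k x) = g' x) ->
  deep_at g -> deep_at g' -> close_at d g g' -> aball z e (k z).
Proof.
move=> e0; have p2 := @pi_ge2 R.
have [zp [z0 z1 [K K0 zlip] [r r0 zr]]] := ads_path x0 z.
have [C C0 hC] := linear_close r0; have [d1 d10 hb] := base_lift.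
pose e' := Num.min (e / 2) 1.
have e'0 : 0 < e' by rewrite lt_min ltr01 andbT divr_gt0.
have e'1 : e' <= 1 by rewrite ge_min lexx orbT.
have e'e : e' <= e / 2 by rewrite ge_min lexx.
have ce : cos e' < 1 by rewrite -(@cos0 R) ltr_cos_0pi ?lexx //; lra.
have hz := hgt_gt0 z; have hz1 := hgt_le1 z.
(* An error on developed points for which both bounds of [dev_close_cos] at [z] exceed [cos e']. *)
pose u := Num.min (1 / 8) (hgt z * ((1 - cos e') / 16)).
have u0 : 0 < u by rewrite lt_min divr_gt0 //= mulr_gt0 // divr_gt0 // subr_gt0.
have u8 : u <= 1 / 8 by rewrite ge_min lexx.
have uz : u <= hgt z * ((1 - cos e') / 16) by rewrite ge_min lexx orbT.
exists (Num.min d1 (u / C)); first by rewrite lt_min d10 divr_gt0.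
move=> g g' k Gg Gg' Gk gk dg dg' cl.
have cl1 : close_at d1 g g'.
  have le1 : Num.min d1 (u / C) <= d1 by rewrite ge_min lexx.
  by case: cl => c1 c2; split=> [i|]; exact: ads_close_le le1 _.
have cl2 : close_at (u / C) g g'.
  have le2 : Num.min d1 (u / C) <= u / C by rewrite ge_min lexx orbT.
  by case: cl => c1 c2; split=> [i|]; exact: ads_close_le le2 _.
have dk s : mxb (dev (\val (k (zp s))) - dev (\val (zp s))) u.
  have := hC _ _ _ _ (divr_gt0 u0 C0) Gg Gg' Gk gk dg dg' cl2 (zp s) (zr s).
  by rewrite mulrC divfK // gt_eqF.
have u4 : u <= 1 / 4 by lra.
have cT s : 0 < cos (tht (k (zp s)) - tht (zp s)).
  by have [h1 _] := dev_close_cos (ltW u0) u4 (dk s); lra.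
have c0 : `|tht (k (zp 0)) - tht (zp 0)| < pi / 2 by rewrite z0; exact: hb gk dg cl1.
pose T s := tht (k (zp s)) - tht (zp s).
have T_cont : continuous T.
  have zc : continuous (fun s : R => tht (zp s)).
    move=> s; apply/cvgrPdist_lt => eps eps0.
    apply/nbhs_ballP; exists (eps / K); first by rewrite /= divr_gt0.
    move=> t; rewrite /ball /= ltr_pdivlMr // mulrC => st.
    rewrite distrC; apply: le_lt_trans st; apply: le_trans (zlip s t).
    by rewrite lerDr adist_ge0.
  have kc : continuous (fun s : R => tht (k (zp s))).
    move=> s; apply/cvgrPdist_lt => eps eps0.
    have [k' [Gk' kK k'K]] := subgroup_inv Gk.
    have [q q0 hq] := iso_continuous (subgroup_sub Gk) (subgroup_sub Gk') kK k'K (zp s) eps0.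
    apply/nbhs_ballP; exists (q / K); first by rewrite /= divr_gt0.
    move=> t; rewrite /ball /= ltr_pdivlMr // mulrC => st.
    have : aball (zp s) q (zp t) by apply: le_lt_trans st; exact: zlip.
    move=> /hq; rewrite /aball distrC; apply: le_lt_trans.
    by rewrite lerDr adist_ge0.
  by move=> s; apply: cvgB; [exact: kc|exact: zc].
have Tpi s : `|T s| != pi / 2.
  apply/eqP => h; have := cT s; rewrite -/(T s) -cos_norm h cos_pihalf ltxx //.
have T1 : `|T 1| < pi / 2.
  have nT : {within `[0, 1], continuous (fun s : R => `|T s|)}.
    apply: continuous_subspaceT => s; apply: (@continuous_comp _ _ _ T) => //.
      exact: T_cont.
    exact: norm_continuous.
  rewrite ltNge; apply/negP => h.
  have [|c _ ec] := IVT ler01 nT (v := pi / 2).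
    by rewrite ge_min (ltW c0) le_max h orbT.
  by have := Tpi c; rewrite ec eqxx.
have [h1 h2] := dev_close_cos (ltW u0) u4 (dk 1).
rewrite z1 -/(T 1) in h1 h2.
have h3 : cos e' < cos (T 1).
  have : 4 * u < 1 - cos e'.
    have : hgt z * ((1 - cos e') / 16) <= (1 - cos e') / 16.
      by rewrite ler_piMl // divr_ge0 // subr_ge0 ltW.
    lra.
  by move: h1; rewrite /T z1; lra.
have h4 : cos e' < cos (adist z (k z)).
  apply: lt_le_trans h2; have : 8 * u / hgt z <= (1 - cos e') / 2.
    by rewrite ler_pdivrMr //; lra.
  lra.
rewrite /aball.
have : adist z (k z) < e'.
  by rewrite -ltr_cos_0pi ?adist_ge0 ?(ltW (adist_ltpi _ _)) //; lra.
have : `|tht (k z) - tht z| < e'.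
  rewrite -z1 -/(T 1) -ltr_cos_0pi ?cos_norm //; last by rewrite normr_ge0; lra.
  by lra.
lra.
Qed.

End NearIdentity.

End GroupAction.

(** * Finiteness, freeness and proper discontinuity *)

Section ProperAction.
Context {R : realType}.
Implicit Types (a b k x y z : AdS R).
Variables (f : 'rV[R]_3 -> R) (G : SOhat22_subgroup R).
Hypothesis f_lip : lipschitz1 f.
Hypothesis G_preserves : forall g, G g -> preserves g (circle_graph f).
Hypothesis G_discrete : discrete_subgroup G.
Hypothesis G_torsion_free : torsion_free G.
Local Notation D := (invisible_domain f).

(* A family of elements of [G] converging pointwise to the identity does so in
   the compact-open topology, because its members preserve the order. *)
Lemma pointwise_identity (U : R -> set (AdS R -> AdS R)) :
  (forall d e, d <= e -> U d `<=` U e) -> (forall d, U d `<=` G) ->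
  (forall z (e : R), 0 < e -> exists2 d : R, 0 < d & forall k : AdS R -> AdS R, U d k -> aball z e (k z)) ->
  exists2 d : R, 0 < d & U d `<=` [set id].
Proof.
move=> U_mono UG ptw.
pose F : set_system {compact-open, AdS R -> AdS R} := filter_from [set d : R | 0 < d] U.
have FF : Filter F.
  apply: filter_from_filter; first by exists 1 => /=.
  move=> d e /= d0 e0; exists (Num.min d e); first by rewrite /= lt_min d0.
  move=> k kU; split; apply: U_mono kU; rewrite ge_min lexx ?orbT //.
have Fid : F --> (id : {compact-open, AdS R -> AdS R}).
  apply/compact_open_cvgP => K O cK oO KO.
  have near_x x : K x -> \forall x' \near x & k \near F, O (k x').
    move=> Kx; have Ox : O x by apply: KO; exists x.
    have /nbhs_ads[e e0 he] : nbhs x O by apply: open_nbhs_nbhs.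
    have e40 : 0 < e / 4 by lra.
    have [d1 d10 h1] := ptw (ashift (- (e / 4)) x) _ e40.
    have [d2 d20 h2] := ptw (ashift (e / 4) x) _ e40.
    exists ([set b | aball x (e / 4) b], U (Num.min d1 d2)) => /=.
      split; first by apply/nbhs_ads; exists (e / 4).
      by exists (Num.min d1 d2) => //=; rewrite lt_min d10.
    move=> [x' k] [/= xx' Uk]; have Gk := UG _ _ Uk.
    have {}h1 : aball (ashift (- (e / 4)) x) (e / 4) (k (ashift (- (e / 4)) x)).
      by apply: h1; apply: U_mono Uk; rewrite ge_min lexx.
    have {}h2 : aball (ashift (e / 4) x) (e / 4) (k (ashift (e / 4) x)).
      by apply: h2; apply: U_mono Uk; rewrite ge_min lexx orbT.
    have [l1 l2] := (aball_diamond x (e / 4) x').1 xx'.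
    have s1 : aball x (e / 2) (ashift (- (e / 4)) x).
      by rewrite /aball !ashiftE adistxx add0r addrAC subrr add0r normrN gtr0_norm //; lra.
    have s2 : aball x (e / 2) (ashift (e / 4) x).
      by rewrite /aball !ashiftE adistxx add0r addrAC subrr add0r gtr0_norm //; lra.
    have le : e / 2 + e / 4 <= e by lra.
    apply: he; apply: (aball_convex (aball_le le (aball_tri s1 h1)) (aball_le le (aball_tri s2 h2))).
      exact/altW/(G_alt Gk).
    exact/altW/(G_alt Gk).
  have /compact_near_coveringP ncK := cK.
  have := ncK _ F (fun (h : AdS R -> AdS R) x => O (h x)) FF near_x; apply: filterS => h hk _ [x Kx <-].
  exact: hk.
have [_ [V nV VG]] := G_discrete (subgroup_id G).
have [d d0 UV] := Fid _ nV.
exists d => // k Uk.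
have : (V `&` [set h : {compact-open, AdS R -> AdS R} | G h]) k by split; [exact: UV|exact: UG Uk].
by rewrite VG.
Qed.

Lemma orbit_finite k y : D k -> D y -> finite_set [set g | G g /\ ale k (g y)].
Proof.
move=> Dk Dy; set S := [set g | _].
have [e [e0 _ De]] := domain_open f_lip Dy.
pose d := Num.min (e / 2) (1 / 4).
have d0 : 0 < d by rewrite lt_min !divr_gt0.
have de : d <= e / 2 by rewrite ge_min lexx.
have d4 : d <= 1 / 4 by rewrite ge_min lexx orbT.
(* The test points surround a point slightly above [y]. They lie in the domain and above [y], so
   [k <= g y] places all their images above [k], where [domain_depth] bounds heights independently
   of [g]. *)
pose x0 := ashift d y.
have ball z : aball x0 d z -> ale y z /\ D z.
  rewrite /aball /x0 !ashiftE => h.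
  have n1 := ler_norm (tht z - (tht y + d)); have n2 := ler_norm (- (tht z - (tht y + d))).
  rewrite normrN in n2.
  have yz : ale y z by rewrite /ale; lra.
  split=> //; apply: (domain_convex f_lip Dy De yz).
  by rewrite /ale !ashiftE adistC; lra.
have [w xw uw] := independent_quadruple x0 d0.
pose xm := ashift (- (d / 2)) x0; pose xp := ashift (d / 2) x0.
have bxm : aball x0 d xm.
  by rewrite /aball /xm ashiftE adistxx add0r tht_ashift addrAC subrr add0r normrN gtr0_norm; lra.
have bxp : aball x0 d xp.
  by rewrite /aball /xp ashiftE adistxx add0r tht_ashift addrAC subrr add0r gtr0_norm; lra.
have bx0 : aball x0 d x0 by exact: aball_center.
have [m m0 hm] := domain_depth f_lip Dk.
have [B hB] := domain_bounded f_lip.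
have S_dom g z : S g -> aball x0 d z -> D (g z) /\ m <= hgt (g z).
  move=> [Gg kg] /ball[yz Dz]; have Dgz := G_dom f_lip G_preserves Gg Dz.
  have kgz : ale k (g z) by exact: ale_trans kg (G_ale Gg yz).
  by split=> //; apply: hm => //; left.
have S_deep g : S g -> deep_at w x0 xm xp m g.
  move=> Sg; split=> [i|]; first by have [] := S_dom _ _ Sg (xw i).
  by split; [case: (S_dom _ _ Sg bx0)|case: (S_dom _ _ Sg bxm)|case: (S_dom _ _ Sg bxp)].
(* Quotients of [g'] by [g] for pairs in [S] that are [r]-close at the test points. They converge
   pointwise to the identity as [r] tends to 0, so discreteness makes them trivial for small [r]. *)
pose U (r : R) : set (AdS R -> AdS R) := [set h | G h /\ exists g g',
  [/\ S g, S g', forall x, g (h x) = g' x & close_at w x0 r g g']].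
have [r r0 Ur] : exists2 r : R, 0 < r & U r `<=` [set id].
  apply: pointwise_identity.
  - move=> r s rs h [Gh [g [g' [Sg Sg' gh [c1 c2]]]]]; split=> //; exists g, g'; split=> //.
    by split=> [i|]; exact: ads_close_le rs _.
  - by move=> r h [].
  - move=> z ee ee0; have p2 := @pi_ge2 R.
    have xm0 : alt xm x0 by apply: ashift_alt; lra.
    have x0p : alt x0 xp by apply: alt_ashift; lra.
    have t1 : tht x0 - tht xm < pi / 2 by rewrite /xm tht_ashift; lra.
    have t2 : tht xp - tht x0 < pi / 2 by rewrite /xp tht_ashift; lra.
    have [r r0 hr] := @near_identity _ G _ _ _ _ _ uw xm0 x0p t1 t2 m0 z _ ee0.
    exists r => // h [Gh [g [g' [Sg Sg' gh cl]]]].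
    by apply: (hr g g' h) => //; [case: Sg|case: Sg'|exact: S_deep|exact: S_deep].
(* Five test points with four coordinates each: a bounded family of twenty reals, which determines
   [g] in [S] once known up to [r]. *)
pose P (i : 'I_5) : AdS R := if unlift ord0 i is Some j then w j else x0.
pose co x (j : 'I_4) : R := if unlift ord0 j is Some l then (\val x).1 0 l else tht x.
have bP i : aball x0 d (P i) by rewrite /P; case: unliftP.
apply: (@bounded_infinite_close R _ ('I_5 * 'I_4)%type S
   (fun g ij => co (g (P ij.1)) ij.2) (Num.max 1 B) r) => //.
  move=> g Sg [i j] /=; have [Dg _] := S_dom _ _ Sg (bP i).
  rewrite /co le_max; case: unliftP => [l _|_].
    by rewrite coord_bound.
  by rewrite hB // orbT.
move=> g g' Sg Sg' cl.
have clP i : ads_close r (g (P i)) (g' (P i)).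
  split=> [l|].
    by have := cl (i, lift ord0 l); rewrite /co /= liftK.
  by have := cl (i, ord0); rewrite /co /= unlift_none.
have [Gg _] := Sg; have [Gg' _] := Sg'.
have [h [Gh gK hK]] := subgroup_inv Gg.
have : U r (h \o g').
  split; first exact: subgroup_comp.
  exists g, g'; split=> // [x|]; first by rewrite /= hK.
  split=> [i|].
    by have := clP (lift ord0 i); rewrite /P liftK.
  by have := clP ord0; rewrite /P unlift_none.
move=> /Ur /= hg; apply/funext => x.
by rewrite -(hK (g' x)) -[h (g' x)]/((h \o g') x) hg.
Qed.

Lemma iter_G g n : G g -> G (iter n g).
Proof.
move=> Gg; have -> : (iter n g : AdS R -> AdS R) = iter n (fun h => g \o h) id.
  by apply/funext => x; elim: n => //= n ->.
by elim: n => [|n IH] /=; [exact: subgroup_id|exact: subgroup_comp].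
Qed.

(** All iterates then satisfy [z <= g^n z], so by [orbit_finite] two of them coincide and [g] has
    finite order. *)
Lemma no_return g z : G g -> D z -> ale z (g z) -> g = id.
Proof.
move=> Gg Dz zg.
have zn n : ale z (iter n g z).
  elim: n => [|n IH]; first exact: ale_refl.
  by rewrite iterS; exact: ale_trans zg (G_ale Gg IH).
have [h [Gh gK hK]] := subgroup_inv Gg.
pose it n : AdS R -> AdS R := iter n g.
have [m [n mn e]] : exists m, exists2 n : nat, (m < n)%N & it m = it n.
  apply: contrapT => H.
  have inj : {in [set: nat] &, injective it}.
    move=> m n _ _ e; case: (ltngtP m n) => // mn; exfalso; apply: H.
      by exists m, n.
    by exists n, m.
  apply: infinite_nat.
  have := sub_finite_set (_ : it @` [set: nat] `<=` _) (orbit_finite Dz Dz).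
  rewrite (eq_finite_set (inj_card_eq inj)).
  apply=> _ [i _ <-]; split; [exact: iter_G|exact: zn].
apply: (G_torsion_free Gg (_ : (0 < n - m)%N)); first by rewrite subn_gt0.
apply/funext => x.
have inj : injective (iter m g).
  by elim: m {mn e} => [//|m IH] a b /= /(can_inj gK) /IH.
by apply: inj; rewrite -iterD subnKC ?(ltnW mn) //; exact: (esym (congr1 (@^~ x) e)).
Qed.

Lemma G_free : free_action G D.
Proof. by move=> g z Gg Dz gz; apply: no_return Gg Dz _; rewrite gz; exact: ale_refl. Qed.

Lemma G_properly_discontinuous : properly_discontinuous G D.
Proof.
move=> K cK KD.
pose fam (J : set (AdS R * AdS R)) := finite_set J /\ forall p, J p -> D p.1 /\ D p.2.
have [J [[fJ JD] KJ]] : exists J, fam J /\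
    K `<=` [set x | exists2 p, J p & alt p.1 x /\ alt x p.2].
  (* Finite families of diamonds with tips in the domain, directed by inclusion: the covering form
     of compactness then yields one family that covers [K]. If [g] returns a point of [K] to [K], it
     relates a lower tip to the image of an upper tip. *)
  pose F := filter_from fam (fun J => [set J' | fam J' /\ J `<=` J']).
  have FF : Filter F.
    apply: filter_from_filter; first by exists set0; split.
    move=> J1 J2 [f1 h1] [f2 h2]; exists (J1 `|` J2).
      by split=> [|p [/h1|/h2]] //; rewrite finite_setU.
    move=> J [fJ]; rewrite subUset => -[s1 s2].
    by split.
  have /compact_near_coveringP ncK := cK.
  have [x Kx|J fJ hJ] := ncK _ F (fun J x => exists2 p, J p & alt p.1 x /\ alt x p.2) FF.
    have [e [e0 D1 D2]] := domain_open f_lip (KD _ Kx).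
    pose p := (ashift (- e) x, ashift e x).
    exists ([set x | alt p.1 x /\ alt x p.2], [set J | fam J /\ [set p] `<=` J]) => /=.
      split; first by apply: nbhs_alt; [apply: ashift_alt; lra|apply: alt_ashift; lra].
      by exists [set p] => //; split=> [|_ -> //]; exact: finite_set1.
    by move=> [x' J] [/= xx' [_ pJ]]; exists p => //; exact: pJ.
  by exists J; split=> //; exact: (hJ J (conj fJ (@subset_refl _ J))).
have fin : finite_set (\bigcup_(pq in J `*` J)
    [set g | G g /\ ale pq.1.1 (g pq.2.2)]).
  apply: bigcup_finite; first exact: finite_setX.
  move=> [p q] [/= Jp Jq].
  have [D1 _] := JD _ Jp; have [_ D2] := JD _ Jq.
  exact: orbit_finite.
apply: sub_finite_set fin => g [Gg [_ [[x Kx <-] Kgx]]].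
have [p Jp [p1 _]] := KJ _ Kgx; have [q Jq [_ q2]] := KJ _ Kx.
exists (p, q) => //=; split=> //.
exact: ale_trans (altW p1) (G_ale Gg (altW q2)).
Qed.

End ProperAction.

(** * Velocities of curves and the order of their ends *)

Section CurveVelocity.
Context {R : realType}.
Implicit Types (g : R -> point3 R).

Lemma C1_curve_deriv g (s : R) : C1_curve g ->
  (forall i, is_derive s 1 (fun t => (g t).1 0 i) ((derive1 g s).1 0 i)) /\
  is_derive s 1 (fun t => (g t).2) (derive1 g s).2.
Proof.
move=> [dg _]; have gs := dg s.
have c : h^-1 *: (g (h *: 1 + s) - g s) @[h --> 0^'] --> derive1 g s.
  by rewrite derive1E; exact: gs.
have c1 : h^-1 *: ((g (h *: 1 + s)).1 - (g s).1) @[h --> 0^'] --> (derive1 g s).1.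
  exact: (cvg_comp _ _ c cvg_fst).
have c2 : h^-1 *: ((g (h *: 1 + s)).2 - (g s).2) @[h --> 0^'] --> (derive1 g s).2.
  exact: (cvg_comp _ _ c cvg_snd).
split.
  move=> i; apply: (@is_derive_mxP _ _ _ _ (fun t : R => (g t).1)).
  by split; [apply: cvgP c1|exact: (cvg_lim _ c1)].
by split; [apply: cvgP c2|exact: (cvg_lim _ c2)].
Qed.

(** The curve moves in the ambient product but stays on the hemisphere near [s], so it factors
    through the chart, and its ambient velocity is the [dpos] of its coordinate velocity. *)
Lemma velocity_deriv (g : R -> point3 R) (dp : 'rV[R]_3) (dt s : R) :
  (forall i, is_derive s 1 (fun t => (g t).1 0 i) (dp 0 i)) ->
  is_derive s 1 (fun t => (g t).2) dt ->
  (\forall t \near s, disc (g t).1) ->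
  is_derive s 1 (dev \o g) (dF (coord (g s)) (row3 (dp 0 0) (dp 0 1) dt)) /\
  Q (dF (coord (g s)) (row3 (dp 0 0) (dp 0 1) dt)) =
    (dot dp dp - dt ^+ 2) / (g s).1 0 2 ^+ 2.
Proof.
move=> d1 d2 gD; have gs : disc (g s).1 by exact: nbhs_singleton gD.
set w := row3 _ _ _.
have wE : (w 0 0 = dp 0 0) * (w 0 1 = dp 0 1) * (w 0 2 = dt) by rewrite !row3E.
have dc i : is_derive s 1 (fun t => coord (g t) 0 i) (w 0 i).
  have [->|[->|->]] : i = 0 \/ i = 1 \/ i = 2.
    by case: i => [[|[|[|]]] hi] //; [left|right; left|right; right]; exact: val_inj.
  - by rewrite wE; under eq_fun do rewrite coordE; exact: d1.
  - by rewrite wE; under eq_fun do rewrite coordE; exact: d1.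
  - by rewrite wE; under eq_fun do rewrite coordE.
have cs := coord_in_dom gs.
have near_eq (V : normedModType R) (h : point3 R -> V) :
  \forall t \near s, h (chart (coord (g t))) = h (g t).
  by apply: filterS gD => t gt; rewrite coordK.
split.
  apply: is_derive_mx => i j; rewrite (ord1 i).
  exact: near_eq_is_derive (near_eq _ (fun z => dev z 0 j)) (dev_deriv dc cs j).
have dpE : dpos (coord (g s)) w = dp.
  suff h i : dpos (coord (g s)) w 0 i = dp 0 i by apply: row3P; exact: h.
  apply: deriv1_unique (d1 i).
  exact: near_eq_is_derive (near_eq _ (fun z => z.1 0 i)) (chart_deriv dc cs i).
rewrite Q_dF // dpE wE; congr (_ / _ ^+ 2).
by rewrite -(chartE (coord (g s))).1.2 coordK.
Qed.

Lemma C1_curve_velocity g (s : R) : C1_curve g -> (\forall t \near s, disc (g t).1) ->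
  sqnorm_velocity g s =
  (dot (derive1 g s).1 (derive1 g s).1 - (derive1 g s).2 ^+ 2) / (g s).1 0 2 ^+ 2.
Proof.
move=> gC gD; have [d1 d2] := C1_curve_deriv s gC.
have [[_ dv] <-] := velocity_deriv d1 d2 gD.
by rewrite /sqnorm_velocity derive1E dv.
Qed.

Definition sg (past : bool) : R := (-1) ^+ past.
Definition ple past (a b : AdS R) : Prop := adist a b <= sg past * (tht b - tht a).
Definition plt past (a b : AdS R) : Prop := adist a b < sg past * (tht b - tht a).

Lemma pleE a b : (ple false a b <-> ale a b) * (ple true a b <-> ale b a).
Proof.
rewrite /ple /ale /sg expr0 expr1 mul1r mulN1r opprB adistC.
by split; rewrite // adistC.
Qed.

Lemma pltE a b : (plt false a b <-> alt a b) * (plt true a b <-> alt b a).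
Proof.
rewrite /plt /alt /sg expr0 expr1 mul1r mulN1r opprB adistC.
by split; rewrite // adistC.
Qed.

Lemma sg_sqr past : sg past ^+ 2 = 1.
Proof. by rewrite /sg -exprM mulnC exprM sqrrN !expr1n. Qed.

Lemma arc_rel past g (s s' : R) (y z : AdS R) : C1_curve g -> s < s' ->
  (forall t, s <= t <= s' -> disc (g t).1) -> \val y = g s -> \val z = g s' ->
  ((forall t, s <= t <= s' -> causal_at past g t) -> ple past y z) /\
  ((forall t, s <= t <= s' -> timelike_at past g t) -> plt past y z).
Proof.
move=> gC ss' gD ys zs'.
have d1 t i : s <= t <= s' -> is_derive t 1 (fun t => (g t).1 0 i) ((derive1 g t).1 0 i).
  by move=> _; exact: (C1_curve_deriv t gC).1.
have d2 t : s <= t <= s' ->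
    is_derive t 1 (fun t => sg past * (g t).2) (sg past * (derive1 g t).2).
  by move=> _; apply: deriv1Ml; exact: (C1_curve_deriv t gC).2.
have sD t : s <= t <= s' -> sphere (g t).1 by move=> /gD[].
have gDn t : s < t < s' -> \forall u \near t, disc (g u).1.
  move=> tss; have : t \in `]s, s'[ by rewrite in_itv.
  move=> /near_in_itvoo; apply: filterS => u; rewrite in_itv /= => /andP[su us].
  by apply: gD; rewrite !ltW.
have h2 t : s < t < s' -> 0 < (g t).1 0 2 ^+ 2.
  move=> /andP[st ts]; rewrite exprn_gt0 //.
  by have [] := gD t; rewrite ?ltW.
have [r1 r2] : (ple past y z <-> sdist (g s).1 (g s').1 <= sg past * (g s').2 - sg past * (g s).2) *
   (plt past y z <-> sdist (g s).1 (g s').1 < sg past * (g s').2 - sg past * (g s).2).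
  by rewrite /ple /plt /adist /tht ys zs' mulrBr.
have W t : s < t < s' -> s <= t <= s' by move=> /andP[/ltW -> /ltW ->].
split=> K.
- apply/r1; apply: (curve_le sD d1 d2 _ (ltW ss')) => t tss.
  have [+ k2] := K t (W _ tss); rewrite (C1_curve_velocity gC (gDn _ tss)).
  rewrite ler_pdivrMr ?h2 // mul0r subr_le0 => k1.
  by rewrite exprMn sg_sqr mul1r; split=> //; exact: ltW.
- apply/r2; apply: (curve_lt sD d1 d2 _ ss') => t tss.
  have [+ k2] := K t (W _ tss); rewrite (C1_curve_velocity gC (gDn _ tss)).
  rewrite ltr_pdivrMr ?h2 // mul0r subr_lt0 => k1.
  by rewrite exprMn sg_sqr mul1r.
Qed.

(** The one-sided steps match the definition of [piecewise_arc]: the left one reaches the supremum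
    of the set where [P] holds, the right one passes it. *)
Lemma real_induction (P : R -> Prop) (a b : R) : a <= b -> P a ->
  (forall t, a <= t <= b -> exists2 e : R, 0 < e & forall s s', a <= s -> s < s' -> s' <= b ->
    t - e <= s /\ s' <= t \/ t <= s /\ s' <= t + e -> P s -> P s') -> P b.
Proof.
move=> ab Pa step.
pose S : set R := [set t | a <= t <= b /\ P t].
have Sa : S a by split; rewrite ?lexx.
have ubS : has_ubound S by exists b => t [/andP[]].
have supS : has_sup S by split=> //; exists a.
set u := sup S.
have au : a <= u by exact: ub_le_sup.
have ub : u <= b by apply: sup_le_ub; [exists a|move=> t [/andP[]]].
have [e e0 he] : exists2 e : R, 0 < e & forall s s', a <= s -> s < s' -> s' <= b ->
    u - e <= s /\ s' <= u \/ u <= s /\ s' <= u + e -> P s -> P s'.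
  by apply: step; rewrite au.
have Pu : P u.
  have [s [sab Ps] us] := sup_adherent e0 supS.
  have su : s <= u by apply: ub_le_sup.
  move: su; rewrite le_eqVlt => /predU1P[<- //|su].
  have /andP[sa _] := sab.
  by apply: (he s u) => //; left; split=> //; rewrite ltW.
move: ub; rewrite le_eqVlt => /predU1P[<- //|ub].
have u1 : u < Num.min b (u + e) by rewrite lt_min ub ltrDl.
have Pu1 : P (Num.min b (u + e)).
  by apply: (he u) => //; [rewrite ge_min lexx|right; split=> //; rewrite ge_min lexx orbT].
have : Num.min b (u + e) <= u.
  apply: ub_le_sup => //; split=> //; rewrite ge_min lexx andbT.
  by apply: le_trans au _; exact: ltW.
by rewrite leNgt u1.
Qed.

End CurveVelocity.

(** * The orbit projection and the lifting of relations *)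

Section OrbitProjection.
Context {R : realType}.
Implicit Types (a b k x y z : AdS R).
Variables (f : 'rV[R]_3 -> R) (G : SOhat22_subgroup R).
Hypothesis f_lip : lipschitz1 f.
Hypothesis G_preserves : forall g, G g -> preserves g (circle_graph f).
Hypothesis G_discrete : discrete_subgroup G.
Hypothesis G_torsion_free : torsion_free G.
Local Notation D := (invisible_domain f).
Local Notation T := (set_type D).
Local Notation M := (@orbit_space R G D).
Local Notation pr := (@orbit_proj R G D).

Lemma G_continuous g x (e : R) : G g -> 0 < e ->
  exists2 r : R, 0 < r & forall y, aball x r y -> aball (g x) e (g y).
Proof.
move=> Gg e0; have [h [Gh gK hK]] := subgroup_inv Gg.
exact: (iso_continuous (subgroup_sub Gg) (subgroup_sub Gh) gK hK x e0).
Qed.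

Lemma ale_ashift x (d e : R) : d <= e -> ale (ashift d x) (ashift e x).
Proof. by rewrite /ale !ashiftE adistxx => de; lra. Qed.

Lemma finite_uniform {S : Type} (A : set S) (P : S -> R -> Prop) : finite_set A ->
  (forall s (d e : R), d <= e -> P s e -> P s d) ->
  (forall s, A s -> exists2 e : R, 0 < e & P s e) ->
  exists2 e : R, 0 < e & forall s, A s -> P s e.
Proof.
move=> /finite_setP[n]; elim: n A => [|n IH] A An P_anti PA.
  exists 1 => // x Ax; move: An; rewrite II0 card_eq0 => /eqP A0.
  by move: Ax; rewrite A0.
have /eq_cardSP[x Ax A'n] := An.
have [y A'y|e e0 he] := IH _ A'n P_anti; first by apply: PA; case: A'y.
have [d d0 hd] := PA x Ax.
exists (Num.min d e); first by rewrite lt_min d0.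
move=> y Ay; have [->|yx] := pselect (y = x).
  by apply: P_anti hd; rewrite ge_min lexx.
by apply: (P_anti _ _ e); [rewrite ge_min lexx orbT|exact: he].
Qed.

(** At some scale [orbit_finite] leaves finitely many candidates [g]. For each nontrivial one
    [no_return] denies [z <= g z], and this failure persists when the tips are moved slightly. *)
Lemma wandering z : D z -> exists e : R, [/\ 0 < e, D (ashift (- e) z), D (ashift e z) &
  forall g, G g -> ale (ashift (- e) z) (g (ashift e z)) -> g = id].
Proof.
move=> Dz; have [e1 [e10 D1 D2]] := domain_open f_lip Dz.
have fin := orbit_finite f_lip G_preserves G_discrete D1 D2.
have [||e2 e20 he2] := @finite_uniform _ _
    (fun g e => G g -> ale (ashift (- e) z) (g (ashift e z)) -> g = id) fin.
- move=> g d e de h Gg zg; apply: h => //.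
  apply: ale_trans (ale_ashift z (_ : - e <= - d)) _; first by rewrite lerN2.
  exact: ale_trans zg (G_ale Gg (ale_ashift z de)).
- move=> g [Gg _]; have [->|gid] := pselect (g = id); first by exists 1.
  have zg : ~ ale z (g z).
    by move=> zg; apply: gid; exact: (no_return f_lip G_preserves G_discrete G_torsion_free Gg Dz).
  move/negP : zg; rewrite -ltNge => zg.
  (* The amount by which [z <= g z] fails; moving the lower tip and the image of the upper tip by at
     most [d / 4] each cannot compensate it. *)
  pose d := adist z (g z) - (tht (g z) - tht z).
  have d0 : 0 < d by rewrite subr_gt0.
  have d40 : 0 < d / 4 by lra.
  have [r r0 hr] := G_continuous z Gg d40.
  exists (Num.min (r / 2) (d / 4)); first by rewrite lt_min; lra.
  set e := Num.min _ _ => _ zge; exfalso.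
  have e0 : 0 < e by rewrite lt_min; lra.
  have e1r : e <= r / 2 by rewrite ge_min lexx.
  have e1d : e <= d / 4 by rewrite ge_min lexx orbT.
  have /hr : aball z r (ashift e z).
    by rewrite /aball !ashiftE adistxx add0r addrAC subrr add0r gtr0_norm //; lra.
  rewrite /aball => b; move: zge; rewrite /ale !ashiftE => zge.
  have t1 := adist_triangle (g (ashift e z)) z (g z).
  rewrite (adistC (g (ashift e z))) in t1.
  have n1 := ler_norm (tht (g (ashift e z)) - tht (g z)).
  have dE : d = adist z (g z) - (tht (g z) - tht z) by [].
  have := adist_ge0 (g z) (g (ashift e z)); lra.
pose e := Num.min e1 e2.
have e0 : 0 < e by rewrite lt_min e10.
have ee1 : e <= e1 by rewrite ge_min lexx.
have ee2 : e <= e2 by rewrite ge_min lexx orbT.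
have Ds (s : R) : - e1 <= s <= e1 -> D (ashift s z).
  by move=> /andP[s1 s2]; apply: (domain_convex f_lip D1 D2); exact: ale_ashift.
exists e; split=> //; [by apply: Ds; lra|by apply: Ds; lra|].
move=> g Gg zg.
have N (s : R) : e <= s -> ale (ashift (- s) z) (g (ashift s z)).
  move=> es; apply: ale_trans (ale_ashift z (_ : - s <= - e)) _; first by rewrite lerN2.
  exact: ale_trans zg (G_ale Gg (ale_ashift z es)).
by apply: (he2 g) => //; [split=> //; exact: N|exact: N].
Qed.

Lemma dom_val (x : T) : D (\val x). Proof. exact: set_mem (valP x). Qed.

Definition mkdom z (Dz : D z) : T := exist _ z (mem_set Dz).

Lemma nbhs_dom (x : T) (U : set T) : nbhs x U <->
  exists2 e : R, 0 < e & forall y : T, aball (\val x) e (\val y) -> U y.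
Proof.
split.
  move=> /nbhs_ballP[e /= e0 xU].
  have /nbhs_ads[d d0 hd] : nbhs (\val x) (ball (\val x) e) by exact: nbhsx_ballx.
  by exists d => // y /hd ?; exact: xU.
case=> e e0 xU; apply/nbhs_ballP.
have /nbhs_ballP[d /= d0 hd] : nbhs (\val x) (aball (\val x) e) by apply/nbhs_ads; exists e.
by exists d => // y xy; apply: xU; exact: hd.
Qed.

Lemma prP (x y : T) : pr x = pr y <-> exists2 g, G g & g (\val x) = \val y.
Proof.
rewrite /orbit_proj; split.
  by move=> /eqmodP/asboolP.
by move=> h; apply/eqmodP/asboolP.
Qed.

Lemma pr_surj (m : M) : exists x : T, pr x = m.
Proof. by exists (repr m); exact: reprK. Qed.

Lemma open_orbit (U : set M) : open U <-> open (pr @^-1` U).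
Proof. by []. Qed.

Lemma pr_continuous : continuous pr.
Proof. exact: pi_continuous. Qed.

Lemma pr_G g (x y : T) : G g -> g (\val x) = \val y -> pr x = pr y.
Proof. by move=> Gg gxy; apply/prP; exists g. Qed.

(** Only the end point of a lift is carried along: each local arc is moved by a group element so
    that it starts at the current point [y]. The case [t = a] is kept apart because the
    chronological relation is irreflexive. *)
Lemma lift_along (K : (R -> point3 R) -> R -> Prop) (rel : AdS R -> AdS R -> Prop)
  (c : R -> M) (a b : R) (x : T) :
  (forall y z w, rel y z -> rel z w -> rel y w) ->
  (forall g y z, G g -> rel y z -> rel (g y) (g z)) ->
  (forall g (s s' : R) y z, C1_curve g -> s < s' -> (forall t, s <= t <= s' -> disc (g t).1) ->
    (forall t, s <= t <= s' -> K g t) -> \val y = g s -> \val z = g s' -> rel y z) ->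
  a < b -> piecewise_arc pr K `[a, b] c -> pr x = c a ->
  exists2 y : T, rel (\val x) (\val y) & pr y = c b.
Proof.
move=> rel_tr rel_G K_rel ab cK xa.
pose P t := exists y : T, pr y = c t /\ (t = a /\ y = x \/ rel (\val x) (\val y)).
have [|t tab|y [yb [[ba _]|xy]]] := @real_induction _ P a b (ltW ab).
- by exists x; split=> //; left.
- have [|e e0 [h1 h2]] := cK t; first by rewrite /= in_itv.
  exists e => // s s' as_ ss' s'b h [y [ys xy]].
  have [J [g [gC gl gK]] [Js Js' Jss]] : exists2 J : set R, Defs.arc pr K J c &
      [/\ J s, J s' & forall u, s <= u <= s' -> J u].
    have sub l r : l <= s -> s' <= r -> let J := `[a, b] `&` `[l, r] in
        [/\ J s, J s' & forall u, s <= u <= s' -> J u].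
      move=> ls s'r J; suff Ju u : s <= u <= s' -> J u by split=> //; apply: Ju; rewrite lexx ltW.
      move=> /andP[su us]; split; rewrite /= in_itv /=.
        by rewrite (le_trans as_) ?(le_trans us).
      by rewrite (le_trans ls) ?(le_trans us).
    case: h => -[h3 h4].
      by exists (`[a, b] `&` `[t - e, t]) => //; exact: sub.
    by exists (`[a, b] `&` `[t, t + e]) => //; exact: sub.
  have [z zs prz] := gl _ Js; have [z' zs' prz'] := gl _ Js'.
  have zz' : rel (\val z) (\val z').
    apply: (K_rel g s s') => // u us; last exact/gK/Jss.
    by have [w <- _] := gl _ (Jss _ us).
  have [k Gk kz] : exists2 k, G k & k (\val z) = \val y by apply/prP; rewrite prz ys.
  pose y' := mkdom (G_dom f_lip G_preserves Gk (dom_val z')).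
  have yy' : rel (\val y) (\val y') by rewrite -kz; exact: rel_G.
  exists y'; split; first by rewrite -prz'; apply/esym/(pr_G Gk).
  by right; case: xy => [[_ <-] //|xy]; exact: rel_tr yy'.
- by rewrite ba ltxx in ab.
- by exists y.
Qed.

End OrbitProjection.

(** * Joining causal curves, and compactness of slabs *)

Section JoiningCurves.
Context {R : realType}.
Implicit Types (a b k w x y z : AdS R).

Lemma ple_trans past b a c : ple past a b -> ple past b c -> ple past a c.
Proof.
rewrite /ple => h1 h2; have t := adist_triangle b a c.
by apply: le_trans t (le_trans (lerD h1 h2) _); rewrite -mulrDr addrC subrKA.
Qed.

Lemma plt_trans past b a c : plt past a b -> plt past b c -> plt past a c.
Proof.
rewrite /plt => h1 h2; have t := adist_triangle b a c.
by apply: le_lt_trans t (lt_le_trans (ltrD h1 h2) _); rewrite -mulrDr addrC subrKA.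
Qed.

Lemma pltW past a b : plt past a b -> ple past a b. Proof. exact: ltW. Qed.

Lemma is_derive_pair (V W : normedModType R) (p : R -> V) (t : R -> W) (s : R) dp dt :
  is_derive s 1 p dp -> is_derive s 1 t dt ->
  is_derive s 1 (fun u => (p u, t u)) (dp, dt).
Proof.
move=> [d1 e1] [d2 e2].
have c1 : h^-1 *: (p (h *: 1 + s) - p s) @[h --> 0^'] --> dp by rewrite -e1; exact: d1.
have c2 : h^-1 *: (t (h *: 1 + s) - t s) @[h --> 0^'] --> dt by rewrite -e2; exact: d2.
have c : (h^-1 *: (p (h *: 1 + s) - p s), h^-1 *: (t (h *: 1 + s) - t s)) @[h --> 0^'] --> (dp, dt).
  exact: cvg_pair c1 c2.
have e : (fun h : R => h^-1 *: (((fun u => (p u, t u)) \o shift s) (h *: 1) - (p s, t s))) =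
  (fun h : R => (h^-1 *: (p (h *: 1 + s) - p s), h^-1 *: (t (h *: 1 + s) - t s))) by [].
split; first by apply/cvg_ex; exists (dp, dt); exact: c.
rewrite /derive e.
exact: (norm_cvg_lim c).
Qed.

Lemma joining_curve (p q : 'rV[R]_3) (t0 d : R) : sphere p -> sphere q -> sdist p q < pi ->
  let g := fun s => (garc p q s, t0 + s * d) in
  C1_curve g /\ forall s, derive1 g s = (dgarc p q s, d).
Proof.
move=> sp sq pq g.
have dg (s : R) : is_derive s 1 g (dgarc p q s, d).
  apply: is_derive_pair.
    by apply: is_derive_mx => i j; rewrite (ord1 i); exact: garc_deriv.
  have := deriv1D (deriv1_cst s t0) (deriv1M (deriv1_id s) (deriv1_cst s d)).
  by congr is_derive; ring.
have g' s : derive1 g s = (dgarc p q s, d) by rewrite derive1E; have [_ ->] := dg s.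
split=> //; split=> [s|]; first by have [] := dg s.
have -> : derive1 g = fun s => (dgarc p q s, d) by exact/funext.
move=> s; set e := sdist p q.
have hd := deriv1M (deriv1_id s) (deriv1_cst s e).
have dd : is_derive s 1 (dgarc p q) (\row_j ((e * - (cos (s * e) * (1 * e + s * 0))) * p 0 j
    + (e * (- sin (s * e) * (1 * e + s * 0))) * gperp p q 0 j)).
  apply: is_derive_mx => i j; rewrite (ord1 i) mxE.
  have := deriv1D (deriv1M (deriv1Ml e (deriv1N (deriv1_sin hd))) (deriv1_cst s (p 0 j)))
    (deriv1M (deriv1Ml e (deriv1_cos hd)) (deriv1_cst s (gperp p q 0 j))).
  have -> : (fun t => dgarc p q t 0 j) =
    (fun t => e * - sin (t * e) * p 0 j + e * cos (t * e) * gperp p q 0 j).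
    by apply/funext => t; rewrite !mxE.
  by congr is_derive; ring.
have [/derivable1_diffP/differentiable_continuous //] := is_derive_pair dd (deriv1_cst s d).
Qed.

(** Every point of the arc is between its ends, so causal convexity keeps the arc in the invisible
    domain. *)
Lemma joining_arc past x y : ple past x y -> x <> y ->
  exists g : R -> point3 R, [/\ C1_curve g, g 0 = \val x, g 1 = \val y,
    forall s, 0 <= s <= 1 -> exists w, [/\ \val w = g s, ple past x w & ple past w y] &
    forall s, 0 <= s <= 1 -> causal_at past g s /\ (plt past x y -> timelike_at past g s)].
Proof.
move=> xy nxy; set p := (\val x).1; set q := (\val y).1; pose d := tht y - tht x.
have sp : sphere p by []. have sq : sphere q by [].
have pq : sdist p q < pi := adist_ltpi x y.
have xy' : sdist p q <= sg past * d := xy.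
have d0 : 0 < sg past * d.
  rewrite lt_neqAle (le_trans (sdist_ge0 sp sq) xy') andbT; apply/eqP => e.
  apply: nxy; apply: ads_eq.
    by apply/eqP; rewrite eq_le adist_ge0 andbT; rewrite -e in xy'.
  have : sg past * (sg past * d) = 0 by rewrite -e mulr0.
  by rewrite mulrA -expr2 sg_sqr mul1r /d => h; lra.
have := joining_curve (tht x) d sp sq pq; set g := fun s : R => _ => /= -[gC g'].
have gdisc s : 0 <= s <= 1 -> disc (g s).1.
  move=> s01; apply: (garc_disc sp sq pq) => //; try by have [] := ads_disc x.
    by apply/ltW; have [] := ads_disc y.
  by right; have [] := ads_disc y.
exists g; split => //.
- by rewrite /g garc0 // mul0r addr0; exact: esym (surjective_pairing _).
- by rewrite /g garc1 // mul1r /d addrC subrK; exact: esym (surjective_pairing _).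
- move=> s s01; exists (mkads (gdisc s s01) (tht x + s * d)); split=> //.
    rewrite /ple /adist /tht /=.
    have /andP[s0 s1] := s01.
    have := sdist_garc sp sq pq (lexx 0) s0 s1; rewrite garc0 // subr0.
    move=> h; apply: le_trans h _; rewrite -/(tht x) addrAC subrr add0r mulrCA mulrC.
    exact: ler_wpM2l.
  rewrite /ple /adist /tht /=.
  have /andP[s0 s1] := s01.
  have := sdist_garc sp sq pq s0 s1 (lexx 1); rewrite garc1 //.
  move=> h; apply: le_trans h _; rewrite -/(tht x) -/(tht y).
  have -> : sg past * (tht y - (tht x + s * d)) = (1 - s) * (sg past * d) by rewrite /d; ring.
  by rewrite mulrC; apply: ler_wpM2l; rewrite ?subr_ge0.
- move=> s s01.
  have gn : \forall t \near s, disc (g t).1.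
    have [_ h] := gdisc s s01.
    have pos : \forall t \near s, 0 < garc p q t 0 2.
      exact: cvgr_gt _ (deriv1_continuous (garc_deriv p q s 2)) _ h.
    by apply: filterS pos => t ht; split=> //; exact: garc_sphere.
  have v := C1_curve_velocity gC gn; rewrite g' /= dgarc_norm // in v.
  have h2 : 0 < (g s).1 0 2 ^+ 2 by have [_ h] := gdisc s s01; rewrite exprn_gt0.
  have dd : d ^+ 2 = (sg past * d) ^+ 2 by rewrite exprMn sg_sqr mul1r.
  split=> [|xy2]; (split; last by rewrite g').
    rewrite v ler_pdivrMr // mul0r subr_le0 dd ler_sqr ?nnegrE //.
      exact: sdist_ge0.
    exact: ltW.
  rewrite v ltr_pdivrMr // mul0r subr_lt0 dd ltr_sqr ?nnegrE //.
    exact: sdist_ge0.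
  exact: ltW.
Qed.

(** The lower bound on heights makes the set closed in R^3 x R, away from the boundary. Cluster
    points are found there and brought back to [AdS]. *)
Lemma compact_slab (m B : R) : 0 < m ->
  compact [set z : AdS R | m <= hgt z /\ `|tht z| <= B].
Proof.
move=> m0.
pose S : set 'rV[R]_3 := [set p | sphere p /\ m <= p 0 2].
have cc i : continuous (fun p : 'rV[R]_3 => p 0 i) by move=> p; exact: coord_continuous.
have cS : compact S.
  apply: bounded_closed_compact.
    exists 1; split; first exact: num_real.
    move=> M M1 p [sp mp]; apply/ltW/(le_lt_trans _ M1).
    change (mx_norm p <= 1).
    have [->|/mx_norm_neq0[[i j] ->]] := eqVneq (mx_norm p) 0; first exact: ler01.
    rewrite /= (ord1 i); have dp : disc p by split=> //; exact: lt_le_trans mp.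
    exact: (coord_bound (mkads dp 0)).
  apply: closedI.
    apply: (@closed_comp _ _ (fun p => dot p p) [set 1]); last exact: closed_eq.
    move=> p _.
    rewrite (_ : (fun p => dot p p) = fun p => p 0 0 * p 0 0 + p 0 1 * p 0 1 + p 0 2 * p 0 2).
      have sq i : (q 0 i * q 0 i) @[q --> p] --> p 0 i * p 0 i by apply: cvgM; exact: cc.
      exact: cvgD (cvgD (sq 0) (sq 1)) (sq 2).
    by apply/funext => q; rewrite dotE.
  apply: (@closed_comp _ _ (fun p : 'rV[R]_3 => p 0 2) [set r | m <= r]); last exact: closed_ge.
  by move=> p _; exact: cc.
have cC : compact (S `*` `[- B, B]) by apply: compact_setX => //; exact: segment_compact.
move=> F FF FS.
have [|[p t] [[[sp mp] tB] cl]] := cC ((fun z : AdS R => \val z) @ F) _.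
  change (F ((fun z : AdS R => \val z) @^-1` (S `*` `[- B, B]))).
  apply: filterS FS => z [mz Bz]; split; first by split.
  by rewrite /= in_itv /= -ler_norml.
have dp : disc p by split=> //; exact: lt_le_trans mp.
exists (mkads dp t); split.
  by split=> //; move: tB; rewrite /= in_itv /= -ler_norml.
move=> U V FU /nbhs_ballP[e /= e0 he].
have [|_ [[z Uz <-] bz]] := cl ((fun z : AdS R => \val z) @` U) (ball (p, t) e) _ (nbhsx_ballx _ _ e0).
  change (F ((fun z : AdS R => \val z) @^-1` ((fun z : AdS R => \val z) @` U))).
  by apply: filterS FU => z Uz; exists z.
by exists z; split=> //; exact: he.
Qed.

Lemma ale_closedr k z :
  (forall e : R, 0 < e -> exists2 x, ale k x & aball z e x) -> ale k z.
Proof.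
move=> h; apply/ler_addgt0Pr => e /h[x]; rewrite /ale /aball => kx zx.
have := adist_triangle x k z; rewrite (adistC x).
have := ler_norm (tht x - tht z); lra.
Qed.

Lemma ale_closedl k z :
  (forall e : R, 0 < e -> exists2 x, ale x k & aball z e x) -> ale z k.
Proof.
move=> h; apply/ler_addgt0Pr => e /h[x]; rewrite /ale /aball => kx zx.
have := adist_triangle x z k.
have := ler_norm (- (tht x - tht z)); rewrite normrN; lra.
Qed.

Lemma bigcup_finite_compact {I : Type} {X : topologicalType} (A : set I) (F : I -> set X) :
  finite_set A -> (forall i, A i -> compact (F i)) -> compact (\bigcup_(i in A) F i).
Proof.
elim/Pchoice: I A F => I A F fA cF.
rewrite -bigsetU_fset_set // big_seq; apply: big_ind => //; [exact: compact0|exact: compactU|].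
by move=> i; rewrite in_fset_set // => /set_mem; exact: cF.
Qed.

End JoiningCurves.

(** * Causality of the orbit space *)

Section CausalRelations.
Context {R : realType}.
Implicit Types (a b k w z : AdS R).
Variables (f : 'rV[R]_3 -> R) (G : SOhat22_subgroup R).
Hypothesis f_lip : lipschitz1 f.
Hypothesis G_preserves : forall g, G g -> preserves g (circle_graph f).
Local Notation D := (invisible_domain f).
Local Notation T := (set_type D).
Local Notation M := (@orbit_space R G D).
Local Notation pr := (@orbit_proj R G D).
Implicit Types (x y : T).

Lemma G_ple past g a b : G g -> ple past a b -> ple past (g a) (g b).
Proof.
by case: past => Gg h; [apply/(pleE _ _).2/(G_ale Gg)/(pleE _ _).2|apply/(pleE _ _).1/(G_ale Gg)/(pleE _ _).1].
Qed.

Lemma G_plt past g a b : G g -> plt past a b -> plt past (g a) (g b).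
Proof.
by case: past => Gg h; [apply/(pltE _ _).2/(G_alt Gg)/(pltE _ _).2|apply/(pltE _ _).1/(G_alt Gg)/(pltE _ _).1].
Qed.

Lemma ple_convex past a b z : D a -> D b -> ple past a z -> ple past z b -> D z.
Proof.
case: past => Da Db az zb.
  by apply: (domain_convex f_lip Db Da); apply/(pleE _ _).2.
by apply: (domain_convex f_lip Da Db); apply/(pleE _ _).1.
Qed.

Lemma joining_M past x y : ple past (\val x) (\val y) -> \val x <> \val y ->
  causal pr past (pr x) (pr y) /\
  (plt past (\val x) (\val y) -> chronological pr past (pr x) (pr y)).
Proof.
move=> xy nxy; have [g [gC g0 g1 gD gK]] := joining_arc xy nxy.
have /choice[W hW] (s : R) : exists w : T, 0 <= s <= 1 -> \val (\val w) = g s.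
  have [s01|s01] := boolP (0 <= s <= 1); last by exists x.
  have [w [ws xw wy]] := gD s s01.
  by exists (mkdom (ple_convex (dom_val x) (dom_val y) xw wy)).
have W0 : pr (W 0) = pr x.
  by congr pr; apply/val_inj/val_inj; rewrite hW // lexx ler01.
have W1 : pr (W 1) = pr y.
  by congr pr; apply/val_inj/val_inj; rewrite hW // lexx ler01.
have curve K : (forall s, 0 <= s <= 1 -> K g s) -> piecewise_arc pr K `[0, 1] (pr \o W).
  move=> gK' t _; exists 1 => //.
  suff h J : J `<=` `[0, 1] -> Defs.arc pr K J (pr \o W) by split; apply: h => s [].
  move=> J01; exists g; split=> // s /J01; rewrite /= in_itv /= => s01; last exact: gK'.
  by exists (W s) => //; exact: hW.
split=> [|xy2].
  right; exists 0, 1, (pr \o W); split=> //; apply: curve => s s01.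
  by have [] := gK s s01.
exists 0, 1, (pr \o W); split=> //; apply: curve => s s01.
by have [_] := gK s s01; apply.
Qed.

Lemma causalP past x m : causal pr past (pr x) m <->
  exists2 y, ple past (\val x) (\val y) & pr y = m.
Proof.
split=> [[<-|[a [b [c [ab cC ca cb]]]]]|[y xy <-]].
- by exists x => //; rewrite /ple adistxx subrr mulr0.
- rewrite -cb; apply: (lift_along f_lip G_preserves (K := causal_at past) (a := a)) => //.
  + by move=> y z w; exact: ple_trans.
  + by move=> g y z Gg; exact: (G_ple Gg).
  + by move=> g s s' y z gC ss gD gK ys zs; exact: (arc_rel past gC ss gD ys zs).1.
- have [/val_inj -> |xy'] := pselect (\val x = \val y); first by left.
  exact: (joining_M xy xy').1.
Qed.

Lemma chronologicalP past x m : chronological pr past (pr x) m <->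
  exists2 y, plt past (\val x) (\val y) & pr y = m.
Proof.
split=> [[a [b [c [ab cC ca cb]]]]|[y xy <-]].
  rewrite -cb; apply: (lift_along f_lip G_preserves (K := timelike_at past) (a := a)) => //.
  + by move=> y z w; exact: plt_trans.
  + by move=> g y z Gg; exact: (G_plt Gg).
  + by move=> g s s' y z gC ss gD gK ys zs; exact: (arc_rel past gC ss gD ys zs).2.
apply: (joining_M (pltW xy) _).2 => // e.
by move: xy; rewrite /plt e adistxx subrr mulr0 ltxx.
Qed.

(** The lifts of [m] reached from [x] and from [y] differ by some [g], so a diamond of the quotient
    is the union of the projected diamonds from [x] to the translates of [y]. *)
Lemma causal_diamondP x y m : (causal pr false (pr x) `&` causal pr true (pr y)) m <->
  exists g (z : T), [/\ G g, ale (\val x) (\val z), ale (\val z) (g (\val y)) & pr z = m].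
Proof.
split=> [[/causalP[z xz zm] /causalP[w yw wm]]|[g [z [Gg xz zy zm]]]].
  have [g Gg gwz] : exists2 g, G g & g (\val w) = \val z by apply/prP; rewrite zm.
  exists g, z; split=> //; first exact/(pleE _ _).1.
  by rewrite -gwz; apply: (G_ale Gg); apply/(pleE _ _).2.
have Dgy := G_dom f_lip G_preserves Gg (dom_val y).
split; apply/causalP; first by exists z => //; apply/(pleE _ _).1.
have [h [Gh gK hK]] := subgroup_inv Gg.
exists (mkdom (G_dom f_lip G_preserves Gh (dom_val z))).
  by apply/(pleE _ _).2; rewrite /= -[\val y]gK; exact: (G_ale Gh).
by rewrite -zm; apply/esym/(pr_G Gh).
Qed.

Lemma timelike_diamondP x y m :
  (chronological pr false (pr x) `&` chronological pr true (pr y)) m <->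
  exists g (z : T), [/\ G g, alt (\val x) (\val z), alt (\val z) (g (\val y)) & pr z = m].
Proof.
split=> [[/chronologicalP[z xz zm] /chronologicalP[w yw wm]]|[g [z [Gg xz zy zm]]]].
  have [g Gg gwz] : exists2 g, G g & g (\val w) = \val z by apply/prP; rewrite zm.
  exists g, z; split=> //; first exact/(pltE _ _).1.
  by rewrite -gwz; apply: (G_alt Gg); apply/(pltE _ _).2.
split; apply/chronologicalP; first by exists z => //; apply/(pltE _ _).1.
have [h [Gh gK hK]] := subgroup_inv Gg.
exists (mkdom (G_dom f_lip G_preserves Gh (dom_val z))).
  by apply/(pltE _ _).2; rewrite /= -[\val y]gK; exact: (G_alt Gh).
by rewrite -zm; apply/esym/(pr_G Gh).
Qed.

Hypothesis G_discrete : discrete_subgroup G.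
Hypothesis G_torsion_free : torsion_free G.

(** A diamond with tips within the radius of [wandering] admits only [g = id] in
    [timelike_diamondP], so it is the projection of a single small diamond. *)
Lemma orbit_strongly_causal : strongly_causal pr.
Proof.
split=> [_ [m [n ->]]|m U].
  have [[x <-] [y <-]] := (pr_surj m, pr_surj n).
  apply/open_orbit; rewrite openE => w /timelike_diamondP[g [z [Gg xz zy /prP[h Gh hzw]]]].
  apply/nbhs_dom.
  have xw : alt (h (\val x)) (\val w) by rewrite -hzw; exact: (G_alt Gh).
  have wy : alt (\val w) (h (g (\val y))) by rewrite -hzw; exact: (G_alt Gh).
  have /nbhs_ads[e e0 he] := nbhs_alt xw wy.
  exists e => // w' /he[xw' wy'].
  have [h' [Gh' hK h'K]] := subgroup_inv Gh.
  apply/timelike_diamondP; exists g, (mkdom (G_dom f_lip G_preserves Gh' (dom_val w'))).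
  split=> //=.
  - by rewrite -[\val x]hK; exact: (G_alt Gh').
  - by rewrite -[g _]hK; exact: (G_alt Gh').
  - by apply/esym/(pr_G Gh').
have [x <-] := pr_surj m => mU.
have /nbhs_dom[e e0 he] : nbhs x (pr @^-1` U) by exact: pr_continuous.
have [r [r0 D1 D2 hr]] := wandering f_lip G_preserves G_discrete G_torsion_free (dom_val x).
pose d := Num.min e r.
have d0 : 0 < d by rewrite lt_min e0.
have dr : d <= r by rewrite ge_min lexx orbT.
have Ds (s : R) : - r <= s <= r -> D (ashift s (\val x)).
  by move=> /andP[s1 s2]; apply: (domain_convex f_lip D1 D2); exact: ale_ashift.
have [N P] : D (ashift (- d) (\val x)) /\ D (ashift d (\val x)).
  by split; apply: Ds; clear -d0 dr r0; lra.
exists (chronological pr false (pr (mkdom N)) `&` chronological pr true (pr (mkdom P))).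
  split; first by exists (pr (mkdom N)), (pr (mkdom P)).
  apply/timelike_diamondP; exists id, x; split=> //; first exact: subgroup_id.
    by apply: ashift_alt; rewrite oppr_lt0.
  exact: alt_ashift.
move=> _ /timelike_diamondP[g [z [Gg /= xz zx <-]]].
have gid : g = id.
  apply: hr => //; apply: ale_trans (ale_ashift _ (_ : - r <= - d)) _; first by rewrite lerN2.
  apply: ale_trans (altW (alt_le_trans xz (altW zx))) _.
  exact/(G_ale Gg)/ale_ashift.
apply: he; apply: (aball_le (_ : d <= e)); first by rewrite ge_min lexx.
by apply/aball_diamond; rewrite gid in zx.
Qed.

(** Points of the diamond lie in a compact slab by [domain_depth]; a cluster point there satisfies
    the closed order relations and returns to the domain by convexity. *)
Lemma compact_diamond k b : D k -> D b ->
  compact [set x : T | ale k (\val x) /\ ale (\val x) b].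
Proof.
move=> Dk Db F FF FJ.
have [m m0 hm] := domain_depth f_lip Dk; have [B hB] := domain_bounded f_lip.
have [|z [_ cl]] := compact_slab (B := B) m0 (F := (fun x : T => \val x) @ F) _.
  change (F ((fun x : T => \val x) @^-1` [set z : AdS R | m <= hgt z /\ `|tht z| <= B])).
  apply: filterS FJ => x [kx xb]; have Dx := dom_val x.
  by split; [apply: hm => //; left|exact: hB].
have near_z (e : R) (U : set T) : 0 < e -> F U -> exists x : T,
    [/\ U x, ale k (\val x), ale (\val x) b & aball z e (\val x)].
  move=> e0 FU.
  have nz : nbhs z (aball z e) by apply/nbhs_ads; exists e.
  have FU' : F ((fun x : T => \val x) @^-1` ((fun x : T => \val x) @`
      (U `&` [set x : T | ale k (\val x) /\ ale (\val x) b]))).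
    by apply: filterS (filterI FU FJ) => x Ux; exists x.
  by have [_ [[x [Ux [kx xb]] <-] zx]] := cl _ _ FU' nz; exists x.
have kz : ale k z.
  by apply: ale_closedr => e e0; have [x [_ kx _ zx]] := near_z e setT e0 filterT; exists (\val x).
have zb : ale z b.
  by apply: ale_closedl => e e0; have [x [_ _ xb zx]] := near_z e setT e0 filterT; exists (\val x).
exists (mkdom (domain_convex f_lip Dk Db kz zb)); split=> // U V FU /nbhs_dom[e e0 he].
have [x [Ux _ _ zx]] := near_z e U e0 FU.
by exists x; split=> //; exact: he.
Qed.

Lemma orbit_globally_hyperbolic : globally_hyperbolic pr.
Proof.
split=> [|m n]; first exact: orbit_strongly_causal.
have [[x <-] [y <-]] := (pr_surj m, pr_surj n).
set S := [set g | G g /\ ale (\val x) (g (\val y))].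
have fS : finite_set S by exact: (orbit_finite f_lip G_preserves G_discrete (dom_val x) (dom_val y)).
rewrite (_ : _ `&` _ = \bigcup_(g in S)
  (pr @` [set z : T | ale (\val x) (\val z) /\ ale (\val z) (g (\val y))])).
  apply: bigcup_finite_compact => // g [Gg _]; apply: continuous_compact.
    by apply: continuous_subspaceT; exact: pr_continuous.
  by apply: compact_diamond; [exact: dom_val|exact: (G_dom f_lip G_preserves Gg (dom_val y))].
apply/seteqP; split=> u.
  move=> /causal_diamondP[g [z [Gg xz zy <-]]].
  by exists g; [split=> //; exact: ale_trans xz zy|exists z].
by move=> [g [Gg _] [z [xz zy] <-]]; apply/causal_diamondP; exists g, z.
Qed.

End CausalRelations.

(** * Integrating the speed over one more arc *)

Section IntegralStep.
Context {R : realType}.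
Implicit Types (F V W dW : R -> R) (a s t u : R).
Local Notation mu := (@lebesgue_measure R).

(** [F] is controlled in the open interval only, its values at the breakpoints being null for the
    integral. Measurability is carried along for the next step of the induction. *)
Lemma integral_step F V W dW a s t : a <= s -> s < t -> (forall u, 0 <= F u) ->
  (forall u, s < u < t -> F u = V u) ->
  (forall u, s < u < t -> {for u, continuous V}) ->
  (forall u, s < u < t -> V u <= dW u) ->
  (forall u, s <= u <= t -> is_derive u 1 W (dW u)) ->
  (forall u, s <= u <= t -> {for u, continuous dW}) ->
  measurable_fun `[a, s] F ->
  measurable_fun `[a, t] F /\
  (\int[mu]_(u in `[a, t]) (F u)%:E <=
    \int[mu]_(u in `[a, s]) (F u)%:E + (W t - W s)%:E)%E.
Proof.
move=> as_ st F0 FV cV VW dW_ cW mF.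
have mFo : measurable_fun `]s, t[ F.
  apply: (@eq_measurable_fun _ _ _ _ _ V).
    by move=> u; rewrite inE /= in_itv /= => /FV.
  apply: open_continuous_measurable_fun => //.
  by move=> u; rewrite inE /= in_itv /=; exact: cV.
have mFoc : measurable_fun `]s, t] F by apply/measurable_fun_itv_bndo_bndcP.
have U : `[a, t]%classic = `[a, s] `|` `]s, t].
  by rewrite -itv_bndbnd_setU //= bnd_simp // ltW.
have mF' : measurable_fun `[a, t] F by rewrite U; apply/measurable_funU.
split=> //.
rewrite U ge0_integral_setU //=; last 3 first.
- by apply/measurable_EFinP; rewrite -U.
- by move=> u _; rewrite lee_fin.
- apply/disj_set2P; rewrite -subset0 => u [] /=; rewrite !in_itv /= => /andP[_ us] /andP[su _].
  by rewrite ltNge us in su.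
apply: leeD => //.
rewrite -integral_itv_bndo_bndc; last exact/measurable_EFinP.
have cWi : {within `[s, t], continuous dW}.
  by apply: continuous_in_subspaceT => u; rewrite inE /= in_itv /=; exact: cW.
have cd u : s <= u <= t -> {for u, continuous W}.
  by move=> su; exact: deriv1_continuous (dW_ _ su).
have mdW : measurable_fun `]s, t[ dW.
  apply: open_continuous_measurable_fun => // u.
  by rewrite inE /= in_itv /= => /andP[/ltW su /ltW ut]; apply: cW; rewrite su.
apply: (@le_trans _ _ (\int[mu]_(u in `]s, t[) (dW u)%:E)%E).
  apply: ge0_le_integral => //=.
  - by move=> u _; rewrite lee_fin.
  - exact/measurable_EFinP.
  - exact/measurable_EFinP.
  - by move=> u; rewrite in_itv /= lee_fin => sut; rewrite FV //; exact: VW.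
rewrite integral_itv_bndo_bndc; last exact/measurable_EFinP.
rewrite integral_itv_obnd_cbnd; last first.
  by apply/measurable_EFinP/measurable_fun_itv_bndo_bndcP.
rewrite (@continuous_FTC2 _ dW W) ?EFinB //.
- split.
  + by move=> u; rewrite in_itv /= => /andP[/ltW su /ltW ut]; have [] := dW_ u; rewrite ?su.
  + by apply: cvg_at_right_filter; apply: cd; rewrite lexx ltW.
  + by apply: cvg_at_left_filter; apply: cd; rewrite lexx ltW.
- move=> u; rewrite in_itv /= => /andP[/ltW su /ltW ut].
  by rewrite derive1E; have [] := dW_ u; rewrite ?su.
Qed.

End IntegralStep.

(** * The speed does not depend on the lift *)

Section SpeedOfLifts.
Context {R : realType}.
Implicit Types (a b k w z : AdS R).
Variables (f : 'rV[R]_3 -> R) (G : SOhat22_subgroup R).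
Hypothesis f_lip : lipschitz1 f.
Hypothesis G_preserves : forall g, G g -> preserves g (circle_graph f).
Hypothesis G_discrete : discrete_subgroup G.
Hypothesis G_torsion_free : torsion_free G.
Local Notation D := (invisible_domain f).
Local Notation T := (set_type D).
Local Notation M := (@orbit_space R G D).
Local Notation pr := (@orbit_proj R G D).

Lemma Q_mulmx (A : 'M[R]_4) X : A *m jmx *m A^T = jmx -> Q (X *m A) = Q X.
Proof.
move=> hA; have : (Q (X *m A))%:M = (Q X)%:M :> 'M[R]_1.
  rewrite /Q -!bform_mx trmx_mul -!mulmxA (mulmxA A jmx) (mulmxA _ A^T) hA.
  by rewrite mulmxA.
by move=> /matrixP/(_ 0 0); rewrite !mxE eqxx !mulr1n.
Qed.

Lemma C1_curve_near (g : R -> point3 R) (u e : R) (x : AdS R) : C1_curve g -> \val x = g u -> 0 < e ->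
  \forall t \near u, forall y : AdS R, \val y = g t -> aball x e y.
Proof.
move=> [dg _] xu e0.
have /nbhs_ballP[d /= d0 hd] : nbhs x (aball x e) by apply/nbhs_ads; exists e.
have /derivable1_diffP/differentiable_continuous cg := dg u.
have : \forall t \near u, ball (g u) d (g t) by apply: cg; exact: nbhsx_ballx.
by apply: filterS => t; rewrite -xu => ut y yt; apply: hd; rewrite -yt in ut.
Qed.

(** Near [u] the two lifts differ by one fixed element [k]: the element relating them at a nearby
    time, composed with the inverse of [k], is trivial by [wandering]. The linear part of [k]
    preserves [Q]. *)
Lemma lifts_sqnorm (g1 g2 : R -> point3 R) (c : R -> M) (u e : R) : 0 < e ->
  C1_curve g1 -> C1_curve g2 -> lifts pr g1 `]u - e, u + e[ c ->
  lifts pr g2 `]u - e, u + e[ c -> sqnorm_velocity g1 u = sqnorm_velocity g2 u.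
Proof.
move=> e0 C1 C2 l1 l2.
have inu t : `|t - u| < e -> `]u - e, u + e[%classic t.
  by rewrite ltr_distl /= in_itv /=.
have uu : `]u - e, u + e[%classic u by apply: inu; rewrite subrr normr0.
have [x xu px] := l1 u uu; have [y yu py] := l2 u uu.
have [k Gk kx] : exists2 k, G k & k (\val x) = \val y by apply/prP; rewrite px py.
have [r [r0 _ _ hr]] := wandering f_lip G_preserves G_discrete G_torsion_free (dom_val y).
have [r' r'0 hr'] := G_continuous (\val x) Gk r0.
have [A [hA kA]] := G_linear Gk.
have near_e : \forall t \near u, `|t - u| < e.
  by apply: filterS (nbhsx_ballx u _ e0) => t; rewrite distrC.
have gD1 : \forall t \near u, disc (g1 t).1.
  by apply: filterS near_e => t /inu/l1[z <- _].
have devE : \forall t \near u, (dev (g1 t)) *m A = (dev \o g2) t.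
  have n1 := C1_curve_near C1 xu r'0; have n2 := C1_curve_near C2 yu r0.
  apply: filterS3 near_e n1 n2 => t te xt_ yt_.
  have [x' xt px'] := l1 t (inu _ te); have [y' yt py'] := l2 t (inu _ te).
  have xx' : aball (\val x) r' (\val x') by exact: xt_.
  have yy' : aball (\val y) r (\val y') by exact: yt_.
  have [h Gh hx'] : exists2 h, G h & h (k (\val x')) = \val y'.
    have [h Gh hxy] : exists2 h, G h & h (\val x') = \val y' by apply/prP; rewrite px' py'.
    have [k' [Gk' kK k'K]] := subgroup_inv Gk.
    by exists (h \o k'); [exact: subgroup_comp|rewrite /= kK].
  have hid : h = id.
    apply: hr => //.
    have /aball_diamond[_ b1] : aball (\val y) r (k (\val x')) by rewrite -kx; exact: hr'.
    have /aball_diamond[b2 _] := yy'.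
    apply: ale_trans (altW b2) _; rewrite -hx'; exact/(G_ale Gh)/altW.
  by rewrite /= -yt -hx' hid /= kA -xt.
have [d1 d2] := C1_curve_deriv u C1.
have [dv _] := velocity_deriv d1 d2 gD1.
set V := dF _ _ in dv.
have dvA : is_derive u 1 (fun t => dev (g1 t) *m A) (V *m A).
  apply: is_derive_mx => i j.
  rewrite mxE; rewrite (_ : (fun _ => _) = \sum_l (fun t => dev (g1 t) 0 l * A l j)).
  apply: is_derive_sum => l.
  have := deriv1M (is_derive_mxP dv 0 l) (deriv1_cst u (A l j)).
  by congr is_derive; rewrite mulr0 addr0 ?(ord1 i).
  by apply/funext => t; rewrite fct_sumE mxE (ord1 i).
have e1 : derive1 (dev \o g1) u = V by rewrite derive1E; have [_ ->] := dv.
have e2 : derive1 (dev \o g2) u = V *m A.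
  by rewrite derive1E; have [_ ->] := near_eq_is_derive devE dvA.
by rewrite /sqnorm_velocity e1 e2 Q_mulmx.
Qed.

Lemma speed_spec (I : set R) (c : R -> M) (u q : R) :
  has_speed pr I c u q -> has_speed pr I c u (speed pr I c u).
Proof. by move=> h; rewrite /speed; apply: getPex; exists q. Qed.

Lemma speed_lift (g : R -> point3 R) (c : R -> M) (I : set R) (s t u : R) :
  C1_curve g -> `]s, t[ `<=` I -> lifts pr g `]s, t[ c -> s < u < t ->
  speed pr I c u = Num.sqrt (- sqnorm_velocity g u).
Proof.
move=> gC stI lg /andP[su ut].
pose e := Num.min (u - s) (t - u).
have e0 : 0 < e by rewrite lt_min !subr_gt0 su.
have sub (d : R) : d <= e -> `]u - d, u + d[ `<=` `]s, t[.
  move=> de v; rewrite /= !in_itv /=; have : e <= u - s by rewrite ge_min lexx.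
  have : e <= t - u by rewrite ge_min lexx orbT.
  by move=> h1 h2 /andP[v1 v2]; apply/andP; split; lra.
have : has_speed pr I c u (Num.sqrt (- sqnorm_velocity g u)).
  by exists g; split=> //; exists e => // v [_ /(sub e (lexx e))]; exact: lg.
move=> /speed_spec[g2 [g2C [e2 e20 lg2] ->]].
suff -> : sqnorm_velocity g2 u = sqnorm_velocity g u by [].
have d0 : 0 < Num.min e e2 by rewrite lt_min e0.
apply: (lifts_sqnorm d0 g2C gC) => v vd.
  apply: lg2; split; first by apply/stI/(sub (Num.min e e2)) => //; rewrite ge_min lexx.
  have : Num.min e e2 <= e2 by rewrite ge_min lexx orbT.
  by move: vd; rewrite /= !in_itv /= => /andP[v1 v2] h; apply/andP; split; lra.
by apply/lg/(sub (Num.min e e2)) => //; rewrite ge_min lexx.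
Qed.

(** Where no speed exists, [get] returns the default point, which is 0. *)
Lemma speed_ge0 (I : set R) (c : R -> M) u : 0 <= speed pr I c u.
Proof.
have [[q /speed_spec[g [_ _ ->]] //]|n] := pselect (exists q, has_speed pr I c u q).
by rewrite /speed getPN // => q hq; apply: n; exists q.
Qed.

End SpeedOfLifts.

(** * A potential that bounds the length of past curves *)

Section PotentialGrowth.
Context {R : realType}.
Implicit Types (a b z : AdS R).

(* AM-GM: [(w - n) / e] and [e (w + n)] have product [w ^+ 2 - n ^+ 2]. *)
Lemma speed_bound (w n d e m r : R) : 0 <= n <= w -> `|d| <= n -> 0 < e -> 0 < m <= r ->
  (w ^+ 2 - n ^+ 2) / r ^+ 2 <= (((w - d) / e + 2 * e * w) / (2 * m)) ^+ 2 /\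
  0 <= ((w - d) / e + 2 * e * w) / (2 * m).
Proof.
move=> /andP[n0 nw] dn e0 /andP[m0 mr].
have r0 : 0 < r := lt_le_trans m0 mr.
have dn' : d <= n by apply: le_trans dn; exact: ler_norm.
pose a := (w - n) / e; pose b := e * (w + n).
have a0 : 0 <= a by rewrite divr_ge0 ?subr_ge0 // ltW.
have b0 : 0 <= b by rewrite mulr_ge0 ?addr_ge0 ?(ltW e0) // (le_trans n0).
have ab : a * b = w ^+ 2 - n ^+ 2 by rewrite /a /b; field; rewrite gt_eqF.
have aw : a <= (w - d) / e by rewrite /a ler_pM2r ?invr_gt0 // lerB.
have bw : b <= 2 * e * w.
  by rewrite /b [2 * e]mulrC -mulrA ler_pM2l //; clear -nw; lra.
have m20 : 0 < 2 * m by rewrite mulr_gt0.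
have Y0 : 0 <= (a + b) / (2 * m) by rewrite divr_ge0 ?addr_ge0 // ltW.
have Y1 : (a + b) / (2 * m) <= ((w - d) / e + 2 * e * w) / (2 * m).
  by rewrite ler_pM2r ?invr_gt0 // lerD.
split; last exact: le_trans Y1.
apply: (@le_trans _ _ (((a + b) / (2 * m)) ^+ 2)); last first.
  by rewrite ler_sqr ?nnegrE // (le_trans Y0).
rewrite -ab expr_div_n; apply: (@le_trans _ _ (a * b / m ^+ 2)).
  apply: ler_wpM2l; first exact: mulr_ge0.
  rewrite lef_pV2 ?posrE ?exprn_gt0 //.
  by rewrite ler_sqr ?nnegrE // ltW.
rewrite ler_pdivrMr ?exprn_gt0 //.
have -> : (a + b) ^+ 2 / (2 * m) ^+ 2 * m ^+ 2 = (a + b) ^+ 2 / 4.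
  by clearbody a b; field; rewrite gt_eqF.
have := sqr_ge0 (a - b); rewrite sqrrB sqrrD; clearbody a b; lra.
Qed.

Lemma sqrt_le (x y : R) : 0 <= y -> x <= y ^+ 2 -> Num.sqrt x <= y.
Proof. by move=> y0 xy; rewrite -[leRHS]ger0_norm // -sqrtr_sqr ler_wsqrtr. Qed.

Lemma dot_disc_circle (p q : 'rV[R]_3) : disc p -> circle q -> -1 < dot q p < 1.
Proof.
move=> dp cq; have sp := disc_sphere dp; have sq := circle_sphere cq.
have s0 := sdist_disc_circle dp cq; have [_ q0] := cq.
have s1 : sdist p q < pi by apply: sdist_ltpi => //; rewrite q0.
rewrite dotC -cos_sdist // -cospi -cos0 !ltr_cos_0pi ?s0 ?s1 ?lexx ?pi_ge0 ?(ltW s0) ?(ltW s1) //.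
Qed.

Lemma continuous_sqrt (h : R -> R) (u : R) : {for u, continuous h} ->
  {for u, continuous (fun v => Num.sqrt (h v))}.
Proof. by move=> ch; apply: (continuous_comp ch); exact: sqrt_continuous. Qed.

Section CoordinateCurve.
Variables (c w : R -> 'rV[R]_3) (s t : R).
Hypothesis c_dom : forall u, s <= u <= t -> coord_dom (c u).
Hypothesis c_der : forall u i, s <= u <= t -> is_derive u 1 (fun v => c v 0 i) (w u 0 i).
Hypothesis w_cont : forall u i, s <= u <= t -> {for u, continuous (fun v => w v 0 i)}.
Variables (q : 'rV[R]_3) (k e m : R).
Hypotheses (cq : circle q) (e0 : 0 < e) (m0 : 0 < m).
Hypothesis w_past : forall u, s < u < t -> metric (c u) (w u) (w u) <= 0 /\ w u 0 2 < 0.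
Hypothesis c_deep : forall u, s < u < t -> m <= height (c u).

(** Designed so that its derivative along a past curve is the right side of [speed_bound]; its
    increase therefore dominates the length. The constant [k] will be [f q]. *)
Definition potential (z : point3 R) : R :=
  - ((z.2 + sdist q z.1 - k) / e + 2 * e * z.2) / (2 * m).

Let dd u : R := - (Num.sqrt (1 - dot q (chart (c u)).1 ^+ 2))^-1 * dot q (dpos (c u) (w u)).
Let dW u : R := - ((w u 0 2 + dd u) / e + 2 * e * w u 0 2) / (2 * m).

Lemma potential_deriv u : s <= u <= t ->
  is_derive u 1 (fun v => potential (chart (c v))) (dW u).
Proof.
move=> su; have cu := c_dom su; have dc i := c_der i su.
have d1 : is_derive u 1 (fun v => sdist q (chart (c v)).1) (dd u).
  apply: deriv1_acos; first exact: dot_disc_circle (chart_disc cu) cq.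
  rewrite (_ : (fun v => dot q (chart (c v)).1) = fun v =>
    q 0 0 * (chart (c v)).1 0 0 + q 0 1 * (chart (c v)).1 0 1 + q 0 2 * (chart (c v)).1 0 2).
    by rewrite dotE; do !apply: deriv1D; apply: deriv1Ml; exact: chart_deriv.
  by apply/funext => v; rewrite dotE.
have ie : (2 * m)^-1 != 0 by rewrite invr_eq0 mulf_neq0 ?gt_eqF.
have := deriv1M (deriv1N (deriv1D (deriv1M (deriv1B (deriv1D (dc 2) d1) (deriv1_cst u k))
  (deriv1_cst u e^-1)) (deriv1Ml (2 * e) (dc 2)))) (deriv1_cst u (2 * m)^-1).
congr is_derive; rewrite /dW !mulr0 !addr0 subr0 //.
Qed.

Let c_cont u i : s <= u <= t -> {for u, continuous (fun v => c v 0 i)}.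
Proof. by move=> su; exact: deriv1_continuous (c_der i su). Qed.

Let height_cont u : s <= u <= t -> {for u, continuous (fun v => height (c v))}.
Proof.
move=> su; apply: (@deriv1_continuous _ _ _ (dheight (c u) (w u))).
by apply: height_deriv; [move=> i; exact: c_der|exact: c_dom].
Qed.

Let dheight_cont u : s <= u <= t -> {for u, continuous (fun v => dheight (c v) (w v))}.
Proof.
move=> su; apply: cvgM.
  apply: cvgN; apply: cvgD; apply: cvgM; solve [exact: c_cont|exact: w_cont].
by apply: cvgV; [rewrite gt_eqF // height_gt0 //; exact: c_dom|exact: height_cont].
Qed.

Lemma potential_deriv_cont u : s <= u <= t -> {for u, continuous dW}.
Proof.
move=> su; have dch := dot_disc_circle (chart_disc (c_dom su)) cq.
have dotq v : dot q (chart (c v)).1 = q 0 0 * c v 0 0 + q 0 1 * c v 0 1.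
  by have [_ q2] := cq; rewrite dotE q2 mul0r addr0 !chartE.
have dotdq v : dot q (dpos (c v) (w v)) = q 0 0 * w v 0 0 + q 0 1 * w v 0 1.
  by have [_ q2] := cq; rewrite dotE q2 mul0r addr0 !row3E.
have pos : 0 < 1 - dot q (chart (c u)).1 ^+ 2.
  by rewrite subr_gt0 -real_normK ?num_real // expr_lt1 // ltr_norml.
have cq' (x : R -> 'rV[R]_3) : (forall i, {for u, continuous (fun v => x v 0 i)}) ->
    {for u, continuous (fun v => q 0 0 * x v 0 0 + q 0 1 * x v 0 1)}.
  by move=> h; apply: cvgD; apply: cvgMr; exact: h.
have dd_cont : {for u, continuous dd}.
  rewrite /dd; apply: cvgM; last first.
    have h : {for u, continuous (fun v => dot q (dpos (c v) (w v)))}.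
      have -> : (fun v => dot q (dpos (c v) (w v))) = fun v => q 0 0 * w v 0 0 + q 0 1 * w v 0 1.
        exact/funext.
      by apply: cq' => i; exact: w_cont.
    exact: h.
  have h : {for u, continuous (fun v => dot q (chart (c v)).1)}.
    have -> : (fun v => dot q (chart (c v)).1) = fun v => q 0 0 * c v 0 0 + q 0 1 * c v 0 1.
      exact/funext.
    by apply: cq' => i; exact: c_cont.
  have h2 : {for u, continuous (fun v => 1 - dot q (chart (c v)).1 ^+ 2)}.
    by apply: cvgB; [exact: cvg_cst|exact: (cvgM h h)].
  apply: cvgN; apply: cvgV; first by rewrite gt_eqF // sqrtr_gt0.
  exact: continuous_sqrt h2.
rewrite /dW; apply: cvgM; last exact: cvg_cst.
apply: cvgN; apply: cvgD.
  by apply: cvgM; [apply: cvgD => //; exact: w_cont|exact: cvg_cst].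
by apply: cvgMr; exact: w_cont.
Qed.

Let V u : R := Num.sqrt (- ((dot (dpos (c u) (w u)) (dpos (c u) (w u)) - w u 0 2 ^+ 2)
  / height (c u) ^+ 2)).

Lemma metric_cont u : s < u < t -> {for u, continuous V}.
Proof.
move=> /andP[su ut]; have sut : s <= u <= t by rewrite !ltW.
have hc := height_cont sut; have wc i := @w_cont u i sut; have dc := dheight_cont sut.
have E v : dot (dpos (c v) (w v)) (dpos (c v) (w v)) =
    w v 0 0 * w v 0 0 + w v 0 1 * w v 0 1 + dheight (c v) (w v) * dheight (c v) (w v).
  by rewrite dotE !row3E.
have dotc : {for u, continuous (fun v => dot (dpos (c v) (w v)) (dpos (c v) (w v)))}.
  rewrite (_ : (fun v => _) = fun v => w v 0 0 * w v 0 0 + w v 0 1 * w v 0 1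
      + dheight (c v) (w v) * dheight (c v) (w v)); last exact/funext.
  by apply: cvgD; [apply: cvgD|]; apply: cvgM; solve [exact: wc|exact: dc].
apply: continuous_sqrt; apply: cvgN; apply: cvgM.
  by apply: cvgB => //; exact: (cvgM (wc 2) (wc 2)).
apply: cvgV; last exact: (cvgM hc hc).
by rewrite gt_eqF // exprn_gt0 // height_gt0 //; exact: c_dom.
Qed.

(** [speed_bound] with [w] the rate of decrease of [theta] and [n] the spherical speed;
    [radial_speed] bounds the derivative [dd] of the distance to [q] by [n]. *)
Lemma metric_potential u : s < u < t -> V u <= dW u.
Proof.
move=> sut; have su : s <= u <= t by case/andP: sut => /ltW -> /ltW ->.
have [k1 k2] := w_past sut; have cu := c_dom su.
have h0 := height_gt0 cu.
rewrite metricE // in k1.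
rewrite /V; set N := dot (dpos (c u) (w u)) _ in k1 *.
have N0 : 0 <= N by rewrite /N dotE !addr_ge0 ?sqr_ge0 // -expr2 sqr_ge0.
have Nw : N <= (- w u 0 2) ^+ 2.
  by move: k1; rewrite ler_pdivrMr ?exprn_gt0 // mul0r subr_le0 sqrrN.
have nw : Num.sqrt N <= - w u 0 2 by apply: sqrt_le => //; rewrite oppr_ge0 ltW.
have ddN : `|dd u| <= Num.sqrt N.
  have sph v : s <= v <= t -> sphere (chart (c v)).1 by move=> /c_dom/chart_disc[].
  have pder v i : s <= v <= t ->
      is_derive v 1 (fun x => (chart (c x)).1 0 i) (dpos (c v) (w v) 0 i).
    by move=> sv; apply: chart_deriv; [move=> j; exact: c_der|exact: c_dom].
  have := radial_speed sph pder (circle_sphere cq) sut; rewrite -/N.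
  have := dot_disc_circle (chart_disc cu) cq.
  rewrite /dd; set x := dot q (chart (c u)).1; set y := dot q (dpos _ _) => dch rs.
  have pos : 0 < 1 - x ^+ 2.
    by rewrite subr_gt0 -real_normK ?num_real // expr_lt1 // ltr_norml.
  rewrite normrM normrN normfV (ger0_norm (sqrtr_ge0 _)) mulrC ler_pdivrMr ?sqrtr_gt0 //.
  by rewrite -sqrtrM // -sqrtr_sqr ler_wsqrtr.
have [||b1 b2] := @speed_bound (- w u 0 2) (Num.sqrt N) (dd u) e m (height (c u)) _ ddN e0.
- by rewrite sqrtr_ge0.
- by rewrite m0 c_deep.
have E : ((- w u 0 2 - dd u) / e + 2 * e * - w u 0 2) / (2 * m) = dW u.
  by rewrite /dW; congr (_ / _); rewrite mulrN -opprD mulNr -opprD.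
rewrite E in b1 b2; apply: sqrt_le => //.
by move: b1; rewrite sqr_sqrtr // sqrrN -mulNr opprB.
Qed.

Lemma coordinate_length F (a : R) : a <= s -> s < t -> (forall u, 0 <= F u) ->
  (forall u, s < u < t -> F u = Num.sqrt (- metric (c u) (w u) (w u))) ->
  measurable_fun `[a, s] F ->
  measurable_fun `[a, t] F /\
  (\int[lebesgue_measure]_(u in `[a, t]) (F u)%:E <=
    \int[lebesgue_measure]_(u in `[a, s]) (F u)%:E +
      (potential (chart (c t)) - potential (chart (c s)))%:E)%E.
Proof.
move=> as_ st F0 FV mF; apply: (@integral_step _ F V (fun v => potential (chart (c v))) dW) => //.
- move=> u sut; rewrite FV // metricE //.
  by apply: c_dom; case/andP: sut => /ltW -> /ltW ->.
- exact: metric_cont.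
- exact: metric_potential.
- exact: potential_deriv.
- exact: potential_deriv_cont.
Qed.

End CoordinateCurve.

(** [smooth] gives continuity of derivatives in fixed directions; this expansion extends it to a
    direction that moves with the point. *)
Lemma derive_coordinates (h : 'rV[R]_3 -> 'rV[R]_3) x v i : differentiable h x ->
  'D_v h x 0 i = \sum_j v 0 j * 'D_(delta_mx 0 j) h x 0 i.
Proof.
move=> dh; rewrite deriveE // {1}(row_sum_delta v) linear_sum summxE.
by apply: eq_bigr => j _; rewrite linearZ mxE deriveE.
Qed.

Lemma near_eq_continuous (f g : R -> R) (u : R) : (\forall v \near u, f v = g v) ->
  {for u, continuous f} -> {for u, continuous g}.
Proof.
move=> fg cf; have fgu := nbhs_singleton fg.
have : f v @[v --> u] --> g u by rewrite -fgu; exact: cf.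
by apply: cvg_trans; exact: near_eq_cvg fg.
Qed.

Lemma continuous_coord (M : R -> 'rV[R]_3) (u : R) i : {for u, continuous M} ->
  {for u, continuous (fun v => M v 0 i)}.
Proof.
move=> cM; have := @continuous_comp _ _ _ M (fun A : 'rV[R]_3 => A 0 i) u cM.
by apply; exact: coord_continuous.
Qed.

Lemma metricN (x v : 'rV[R]_3) : coord_dom x -> metric x (- v) (- v) = metric x v v.
Proof.
move=> cx; rewrite !metricE //; congr (_ / _).
by rewrite !dotE !row3E /dheight !mxE; ring.
Qed.

(** Coordinates of the image curve, for moving a local lift by a group element while keeping its
    speed and time direction. *)
Lemma image_curve (phi : AdS R -> AdS R) (g : R -> point3 R) (s t : R) : SOhat22 phi -> C1_curve g ->
  (forall u, s <= u <= t -> disc (g u).1) ->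
  exists c w : R -> 'rV[R]_3, [/\ forall u, s <= u <= t -> coord_dom (c u),
    forall u i, s <= u <= t -> is_derive u 1 (fun v => c v 0 i) (w u 0 i),
    forall u i, s <= u <= t -> {for u, continuous (fun v => w v 0 i)},
    forall u, s < u < t -> metric (c u) (w u) (w u) = sqnorm_velocity g u /\
      (causal_at true g u -> w u 0 2 < 0) &
    forall u (x : AdS R), s <= u <= t -> \val x = g u -> \val (phi x) = chart (c u)].
Proof.
move=> [_ [h [phi_h h_sm h_met _ h_fut]]] gC gD.
pose c0 u := coord (g u).
pose w0 u := row3 ((derive1 g u).1 0 0) ((derive1 g u).1 0 1) (derive1 g u).2.
have c0D u : s <= u <= t -> coord_dom (c0 u) by move=> /gD/coord_in_dom.
have i3 (i : 'I_3) : [\/ i = 0, i = 1 | i = 2].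
  case: i => -[|[|[|//]]] hi; [constructor 1|constructor 2|constructor 3]; exact: val_inj.
have c0d (u : R) i : is_derive u 1 (fun v => c0 v 0 i) (w0 u 0 i).
  have [d1 d2] := C1_curve_deriv u gC; rewrite /w0 /c0.
  case: (i3 i) => ->; rewrite row3E; under eq_fun do rewrite coordE; [exact: d1|exact: d1|exact: d2].
have c0c (u : R) : {for u, continuous c0}.
  have [] : is_derive u 1 c0 (w0 u) by apply: is_derive_mx => i j; rewrite (ord1 i).
  by move=> /derivable1_diffP/differentiable_continuous.
have w0c (u : R) i : {for u, continuous (fun v => w0 v 0 i)}.
  have [_ /(_ u) dc] := gC.
  have dc1 : {for u, continuous (fun v => (derive1 g v).1)}.
    by apply: (continuous_comp dc); exact: cvg_fst.
  have dc2 : {for u, continuous (fun v => (derive1 g v).2)}.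
    by apply: (continuous_comp dc); exact: cvg_snd.
  have dc1i j : {for u, continuous (fun v => (derive1 g v).1 0 j)}.
    exact: continuous_coord dc1.
  rewrite /w0; case: (i3 i) => ->.
  - by rewrite (_ : (fun v => _) = (fun v => (derive1 g v).1 0 0)) //; apply/funext => v; rewrite row3E.
  - by rewrite (_ : (fun v => _) = (fun v => (derive1 g v).1 0 1)) //; apply/funext => v; rewrite row3E.
  - by rewrite (_ : (fun v => _) = (fun v => (derive1 g v).2)) //; apply/funext => v; rewrite row3E.
have [hd hdc] := h_sm 1.
exists (fun u => h (c0 u)), (fun u => 'D_(w0 u) h (c0 u)); split.
- by move=> u su; apply: (h_dom phi_h); exact: c0D.
- by move=> u i su; apply: (h_deriv h_sm) => //; exact: c0D.
- move=> u i su.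
  have near_dom : \forall v \near u, coord_dom (c0 v).
    by apply: c0c; apply: open_nbhs_nbhs; split; [exact: open_coord_dom|exact: c0D].
  pose S v := \sum_j w0 v 0 j * 'D_(delta_mx 0 j) h (c0 v) 0 i.
  have E v : coord_dom (c0 v) -> 'D_(w0 v) h (c0 v) 0 i = S v.
    by move=> cv; apply: derive_coordinates; exact: hd.
  have term j : {for u, continuous (fun v => w0 v 0 j * 'D_(delta_mx 0 j) h (c0 v) 0 i)}.
    have hj : {for c0 u, continuous (fun x => 'D_(delta_mx 0 j) h x)} by apply: hdc; exact: c0D.
    have hju : {for u, continuous (fun v => 'D_(delta_mx 0 j) h (c0 v))}.
      exact: (continuous_comp (c0c u) hj).
    have hji : {for u, continuous (fun v => 'D_(delta_mx 0 j) h (c0 v) 0 i)}.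
      exact: continuous_coord hju.
    exact: (cvgM (w0c u j) hji).
  have Sc : {for u, continuous S}.
    pose F j v := w0 v 0 j * 'D_(delta_mx 0 j) h (c0 v) 0 i.
    have -> : S = fun v => F ord0 v + (F (lift ord0 ord0) v + (F (lift ord0 (lift ord0 ord0)) v + 0)).
      by apply/funext => v; rewrite /S !big_ord_recl big_ord0.
    apply: cvgD; first exact: term.
    apply: cvgD; first exact: term.
    by apply: cvgD; [exact: term|exact: cvg_cst].
  by apply: near_eq_continuous Sc; apply: filterS near_dom => v /E.
- move=> u sut; have su : s <= u <= t by case/andP: sut => /ltW -> /ltW ->.
  rewrite h_met; last exact: c0D.
  have gn : \forall v \near u, disc (g v).1.
    have : u \in `]s, t[ by rewrite in_itv.
    move=> /near_in_itvoo; apply: filterS => v; rewrite in_itv /= => /andP[sv vt].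
    by apply: gD; rewrite !ltW.
  have [d1 d2] := C1_curve_deriv u gC.
  have [[_ dv] _] := velocity_deriv d1 d2 gn.
  split.
    rewrite /metric derive_dev; last exact: c0D.
    by rewrite /sqnorm_velocity derive1E dv.
  move=> [k1 k2].
  (* The hypothesis on [h] concerns future vectors, so the past velocity is negated first. *)
  have fut : future_causal (c0 u) (- w0 u).
    split; last by rewrite mxE /w0 row3E; move: k2; rewrite expr1 mulN1r.
    rewrite metricN; last exact: c0D.
    by rewrite /metric derive_dev; [move: k1; rewrite /sqnorm_velocity derive1E dv|exact: c0D].
  have [_] := h_fut _ _ (c0D u su) fut.
  by rewrite deriveE ?linearN ?mxE ?oppr_gt0 -?deriveE //; exact/hd/c0D.
- move=> u x su xu; rewrite -[LHS]coordK ?phi_h /c0 ?xu //.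
Qed.

End PotentialGrowth.

(** * The cosmological time *)

Section CosmologicalTime.
Context {R : realType}.
Implicit Types (a b k w z : AdS R).
Variables (f : 'rV[R]_3 -> R) (G : SOhat22_subgroup R).
Hypothesis f_lip : lipschitz1 f.
Hypothesis G_preserves : forall g, G g -> preserves g (circle_graph f).
Hypothesis G_discrete : discrete_subgroup G.
Hypothesis G_torsion_free : torsion_free G.
Local Notation D := (invisible_domain f).
Local Notation T := (set_type D).
Local Notation M := (@orbit_space R G D).
Local Notation pr := (@orbit_proj R G D).
Implicit Types (x y : T) (q : 'rV[R]_3).

(** Real induction carries the end of the lift together with the length so far. The potential is not
    invariant under the group, so each arc must be moved to start exactly at the current point for
    the increments to telescope. *)
Lemma past_curve_length (c : R -> M) (a b e m k : R) x q : a <= b ->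
  causal_curve pr true `[a, b] c -> pr x = c a -> circle q -> 0 < e -> 0 < m ->
  (forall z, D z -> ale z (\val x) -> m <= hgt z) ->
  exists y, [/\ ale (\val y) (\val x), pr y = c b &
    (curve_length pr a b c <=
      (potential q k e m (\val (\val y)) - potential q k e m (\val (\val x)))%:E)%E].
Proof.
move=> ab cK xa cq e0 m0 x_deep.
set F := speed pr `[a, b] c.
have F0 u : 0 <= F u by exact: speed_ge0.
pose pot y := potential q k e m (\val (\val y)).
pose P t := exists y, [/\ pr y = c t, ale (\val y) (\val x), measurable_fun `[a, t] F &
  (\int[lebesgue_measure]_(u in `[a, t]) (F u)%:E <= (pot y - pot x)%:E)%E].
have [|t tab|y [yb yx _ I]] := @real_induction _ P a b ab; last by exists y.
  exists x; split=> //; first exact: ale_refl.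
    by rewrite set_itv1; exact: measurable_fun_set1.
  by rewrite set_itv1 integral_set1 subrr.
have [|d d0 [h1 h2]] := cK t; first by rewrite /= in_itv.
exists d => // s s' as_ ss' s'b h [y [ys yx mF IF]].
have [J [g [gC gl gK]] Jss] : exists2 J : set R, Defs.arc pr (causal_at true) J c &
    forall u, s <= u <= s' -> J u.
  have sub l r : l <= s -> s' <= r -> forall u, s <= u <= s' -> (`[a, b] `&` `[l, r]) u.
    move=> ls s'r u /andP[su us]; split; rewrite /= in_itv /=.
      by rewrite (le_trans as_) ?(le_trans us).
    by rewrite (le_trans ls) ?(le_trans us).
  case: h => -[h3 h4].
    by exists (`[a, b] `&` `[t - d, t]) => //; exact: sub.
  by exists (`[a, b] `&` `[t, t + d]) => //; exact: sub.
have ss : s <= s <= s' by rewrite lexx ltW.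
have ss'' : s <= s' <= s' by rewrite lexx ltW.
have W u : s < u < s' -> s <= u <= s' by move=> /andP[/ltW -> /ltW ->].
have [z zs prz] := gl _ (Jss _ ss); have [z' zs' prz'] := gl _ (Jss _ ss'').
have [h' Gh hz] : exists2 h, G h & h (\val z) = \val y by apply/prP; rewrite prz ys.
have gD u : s <= u <= s' -> disc (g u).1 by move=> /Jss/gl[v <- _].
have below u (v : T) : s <= u <= s' -> \val (\val v) = g u -> ale (\val v) (\val z).
  move=> /andP[su us] vu; move: su; rewrite le_eqVlt => /predU1P[su|su].
    suff -> : \val v = \val z by exact: ale_refl.
    by apply: val_inj; rewrite vu zs su.
  have su' r : s <= r <= u -> s <= r <= s'.
    by move=> /andP[-> ru]; exact: le_trans us.
  apply/(pleE _ _).2; apply: (arc_rel true gC su _ zs vu).1 => r /su'; [exact: gD|].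
  by move=> /Jss/gK.
have [c' [w [c'D c'd wc c'm c'v]]] := image_curve (subgroup_sub Gh) gC gD.
have sub : `]s, s'[ `<=` `[a, b].
  move=> u; rewrite /= !in_itv /= => /andP[su us].
  by rewrite (le_trans as_ (ltW su)) (le_trans (ltW us)).
have lo : lifts pr g `]s, s'[ c.
  by move=> u; rewrite /= in_itv /= => /W/Jss/gl.
have [|||mF' IF'] := @coordinate_length _ c' w s s' c'D c'd wc q k e m cq e0 m0 _ _ F a as_ ss' F0 _ mF.
- move=> u su; have [-> wn] := c'm u su.
  have ku := gK _ (Jss _ (W _ su)).
  by split; [have [] := ku|exact: wn].
- move=> u su; have [v vu _] := gl _ (Jss _ (W _ su)).
  have Dhv := G_dom f_lip G_preserves Gh (dom_val v).
  have := x_deep (h' (\val v)) Dhv; rewrite /hgt (c'v u _ (W _ su) vu) chartE; apply.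
  apply: ale_trans yx; rewrite -hz; apply: (G_ale Gh); exact: below (W _ su) vu.
- move=> u su; have [-> _] := c'm u su.
  exact: (speed_lift f_lip G_preserves G_discrete G_torsion_free gC sub lo su).
exists (mkdom (G_dom f_lip G_preserves Gh (dom_val z'))); split=> //.
- by rewrite -prz'; apply/esym/(pr_G Gh).
- by apply: ale_trans yx; rewrite -hz; apply: (G_ale Gh); exact: below ss'' zs'.
- apply: le_trans IF' _.
  have -> : chart (c' s') = \val (h' (\val z')) by rewrite (c'v s' _ ss'' zs').
  have -> : chart (c' s) = \val (\val y) by rewrite -hz (c'v s _ ss zs).
  apply: le_trans (leeD IF (lexx _)) _.
  by rewrite -EFinD lee_fin /pot addrC subrKA.
Qed.

(** The function [v_q]: positive on the domain, and the quantity whose smallness marks the past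
    boundary. *)
Definition horizon q z : R := tht z + sdist q (\val z).1 - f q.

Lemma horizon_gt0 q z : circle q -> D z -> 0 < horizon q z.
Proof.
move=> cq /(invisible_domainP f_lip)[eta eta0 h]; have [h1 _] := h q cq.
by rewrite /horizon sdistC; lra.
Qed.

Lemma cosmological_time_le (e m B : R) x q : circle q -> 0 < e -> 0 < m ->
  (forall z, D z -> ale z (\val x) -> m <= hgt z) ->
  (forall z, D z -> `|tht z| <= B) ->
  (cosmological_time pr (pr x) <= ((horizon q (\val x) / e + 4 * e * B) / (2 * m))%:E)%E.
Proof.
move=> cq e0 m0 x_deep hB; apply: ge_ereal_sup => _ [a [b [c [ab cK ca ->]]]].
have [y [yx _ I]] := past_curve_length (f q) ab cK (esym ca) cq e0 m0 x_deep.
apply: le_trans I _; rewrite lee_fin /potential -mulrBl.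
rewrite ler_pM2r ?invr_gt0 ?mulr_gt0 //.
have hy := horizon_gt0 cq (dom_val y).
have tx := hB _ (dom_val x); have ty := hB _ (dom_val y).
have tx' := ler_norm (tht (\val x)); have ty' := ler_norm (- tht (\val y)).
rewrite normrN in ty'.
have E z : (\val z).2 + sdist q (\val z).1 - f q = horizon q z by [].
rewrite !E -/(tht (\val x)) -/(tht (\val y)).
have hye : 0 < horizon q (\val y) / e by rewrite divr_gt0.
have d4 : e * (tht (\val x) - tht (\val y)) <= e * (2 * B).
  rewrite ler_pM2l //; move: tx ty tx' ty'; clear.
  by move: (tht _) (tht _) (`|_|) (`|_|) => s t u v; lra.
move: d4 hye; rewrite mulrBr; clear.
move: (horizon _ _ / e) (horizon _ _ / e) (tht _) (tht _) => u v s t; lra.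
Qed.

(** The curve over a single instant has length 0, but its arcs must still have a causal velocity
    there; a joining arc to a point below provides one. *)
Lemma cosmological_time_ge0 (m : M) : (0 <= cosmological_time pr m)%E.
Proof.
have [x <-] := pr_surj m.
apply: ereal_sup_ge; exists 0%E => //.
exists 0, 0, (fun=> pr x); split=> //; last first.
  by rewrite /curve_length set_itv1 integral_set1.
have xx : ple true (\val x) (ashift (-1) (\val x)).
  by apply/(pleE _ _).2; apply/altW/ashift_alt; rewrite oppr_lt0.
have [|g [gC g0 _ _ gK]] := joining_arc xx.
  by move=> /(congr1 tht); rewrite tht_ashift; move: (tht _) => s h; lra.
move=> t _; exists 1 => //.
suff h J : J `<=` `[0, 0] -> Defs.arc pr (causal_at true) J (fun=> pr x) by split; apply: h => s [].
move=> J0; exists g; split=> // s /J0; rewrite set_itv1 => ->; first by exists x.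
by apply: (gK 0 _).1; rewrite lexx ler01.
Qed.

Lemma past_lift (c : R -> M) (a b : R) x : 0 <= a -> a <= b ->
  causal_curve pr true `[0, +oo[ c -> pr x = c a ->
  exists2 y, ale (\val y) (\val x) & pr y = c b.
Proof.
move=> a0; rewrite le_eqVlt => /predU1P[<- _ xa|ab cK xa]; first by exists x => //; exact: ale_refl.
have cK' : piecewise_arc pr (causal_at true) `[a, b] c.
  have sub (A : set R) : `[a, b] `&` A `<=` `[0, +oo[ `&` A.
    move=> s [+ As]; rewrite /= !in_itv /= => /andP[sa _].
    by rewrite (le_trans a0 sa).
  have arc_sub (A B : set R) : A `<=` B -> Defs.arc pr (causal_at true) B c ->
      Defs.arc pr (causal_at true) A c.
    by move=> AB [g [gC gl gK]]; exists g; split=> // s /AB; [exact: gl|exact: gK].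
  move=> t; rewrite /= in_itv /= => /andP[ta _].
  have [|e e0 [h1 h2]] := cK t; first by rewrite /= in_itv /= (le_trans a0 ta).
  by exists e => //; split; apply: arc_sub (sub _) _.
have /(causalP f_lip G_preserves)[y xy yb] : causal pr true (pr x) (c b).
  by right; exists a, b, c; split.
by exists y => //; apply/(pleE _ _).2.
Qed.

Lemma horizon_mono q a b : circle q -> ale a b -> horizon q a <= horizon q b.
Proof.
rewrite /horizon /ale => /circle_sphere cq ab.
have := @sdist_triangle R (\val b).1 q (\val a).1 cq (ads_sphere b) (ads_sphere a).
rewrite -/(adist b a) adistC; move: ab; clear.
by move: (adist _ _) (sdist _ _) (sdist _ _) (tht _) (tht _) => *; lra.
Qed.

Lemma horizon_near q a b (e : R) : circle q -> aball a e b -> horizon q b <= horizon q a + e.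
Proof.
rewrite /horizon /aball => /circle_sphere cq ab.
have := @sdist_triangle R (\val a).1 q (\val b).1 cq (ads_sphere a) (ads_sphere b).
have := ler_norm (tht b - tht a).
rewrite -/(adist a b); move: ab; clear.
by lra.
Qed.

(** The upper inequalities at [z] follow from those at [a]. Only the lower ones, a uniform positive
    bound on [horizon], can fail. *)
Lemma past_horizon a z : D a -> ale z a ->
  D z \/ forall eta : R, 0 < eta -> exists2 q, circle q & horizon q z < eta.
Proof.
move=> /(invisible_domainP f_lip)[d d0 hd] za.
have [h|h] := pselect (exists2 eta : R, 0 < eta & forall q, circle q -> eta <= horizon q z); [left|right].
  have [eta eta0 he] := h; apply/(invisible_domainP f_lip); exists (Num.min eta d).
    by rewrite lt_min eta0.
  move=> q cq; have := he q cq; have [_] := hd q cq; rewrite /horizon.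
  have sq := circle_sphere cq.
  have := @sdist_triangle R (\val z).1 (\val a).1 q (ads_sphere a) (ads_sphere z) sq.
  rewrite -/(adist a z) !(sdistC _ q) adistC; move: za; rewrite /ale.
  have m1 : Num.min eta d <= eta by rewrite ge_min lexx.
  have m2 : Num.min eta d <= d by rewrite ge_min lexx orbT.
  move: m1 m2; clear; move: (Num.min _ _) (adist _ _) (sdist _ _) (sdist _ _) (tht _) (tht _) => *.
  by split; lra.
move=> eta eta0; apply: contrapT => n; apply: h; exists eta => // q cq.
by rewrite leNgt; apply/negP => hq; apply: n; exists q.
Qed.

Section InextendibleCurve.
Variable c : R -> M.
Hypothesis c_past : causal_curve pr true `[0, +oo[ c.
Hypothesis c_inext : inextendible c.

(** Lifting at integer times is enough: the order controls the curve in between. *)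
Lemma lift_sequence : exists Z : nat -> T, (forall n, pr (Z n) = c n%:R) /\
  forall m n, (m <= n)%N -> ale (\val (Z n)) (\val (Z m)).
Proof.
have /choice[g hg] (nx : nat * T) : exists y, pr nx.2 = c nx.1%:R ->
    ale (\val y) (\val nx.2) /\ pr y = c nx.1.+1%:R.
  have [h|h] := pselect (pr nx.2 = c nx.1%:R); last by exists nx.2.
  have [||y yx yc] := past_lift _ _ c_past h (b := nx.1.+1%:R); rewrite ?ler_nat //.
  by exists y.
have [x0 x0c] := pr_surj (c 0).
pose Z := fix Z n := if n is n'.+1 then g (n', Z n') else x0.
have Zc n : pr (Z n) = c n%:R by elim: n => [//|n IH]; exact: (hg (n, Z n) IH).2.
exists Z; split=> // m n /subnK <-; elim: (n - m)%N => [|k IH]; first exact: ale_refl.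
exact: ale_trans (hg (_, Z (k + m)%N) (Zc _)).1 IH.
Qed.

(** A decreasing sequence in a compact slab has a cluster point [z] below all its terms; once a term
    enters a ball around [z], causal convexity of the ball keeps all later ones in it. *)
Lemma limit_point (Z : nat -> T) : (forall m n, (m <= n)%N -> ale (\val (Z n)) (\val (Z m))) ->
  exists z : AdS R, (forall n, ale z (\val (Z n))) /\
    forall e : R, 0 < e -> exists N, forall n, (N <= n)%N -> aball z e (\val (Z n)).
Proof.
move=> Zm.
have [m m0 hm] := domain_depth f_lip (dom_val (Z 0%N)); have [B hB] := domain_bounded f_lip.
have [|z [_ cl]] := compact_slab (B := B) m0 (F := (fun n => \val (Z n)) @ \oo) _.
  exists 0%N => // n _; have Dn := dom_val (Z n).
  by split; [apply: hm => //; right; exact: Zm|exact: hB].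
have near_z (e : R) N : 0 < e -> exists2 n, (N <= n)%N & aball z e (\val (Z n)).
  move=> e0; have nz : nbhs z (aball z e) by apply/nbhs_ads; exists e.
  have FN : ((fun n => \val (Z n)) @ \oo) [set x | exists2 n, (N <= n)%N & x = \val (Z n)].
    by exists N => // n Nn; exists n.
  by have [_ [[n Nn ->] zn]] := cl _ _ FN nz; exists n.
have zZ n : ale z (\val (Z n)).
  apply: ale_closedl => e e0; have [n' nn' zn'] := near_z e n e0.
  by exists (\val (Z n')) => //; exact: Zm.
exists z; split=> // e e0; have [N _ zN] := near_z e 0%N e0.
exists N => n Nn; apply: aball_convex (aball_center z e0) zN (zZ n) _.
exact: Zm.
Qed.

Lemma limit_outside (Z : nat -> T) z : (forall n, pr (Z n) = c n%:R) ->
  (forall n, ale z (\val (Z n))) ->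
  (forall e : R, 0 < e -> exists N, forall n, (N <= n)%N -> aball z e (\val (Z n))) -> ~ D z.
Proof.
move=> Zc zZ Zz Dz; apply: c_inext; exists (pr (mkdom Dz)) => U /= nU.
have /nbhs_dom[e e0 he] : nbhs (mkdom Dz) (pr @^-1` U) by exact: pr_continuous.
have [r [r0 _ _ hr]] := wandering f_lip G_preserves G_discrete G_torsion_free Dz.
have d0 : 0 < Num.min e r by rewrite lt_min e0.
have [N hN] := Zz _ d0.
exists N%:R; split; first exact: num_real.
move=> t Nt /=.
have t0 : 0 <= t by apply: le_trans (ltW Nt).
have /andP[nt tn] := truncn_itv t0; set n := Num.truncn t in nt tn.
have Nn : (N <= n)%N.
  by rewrite -ltnS -(ltr_nat R); exact: lt_trans Nt tn.
have [y yn yt] := past_lift (ler0n _ n) nt c_past (Zc n).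
have [y' y'y y'n] := past_lift t0 (ltW tn) c_past yt.
(* Continuing from the lift [y] of [c t] to time [n + 1] may end at another lift than [Z n.+1]. The
   [wandering] diamond forces [h] to be trivial, so [y] lies between [z] and [Z n]. *)
have [h Gh hZ] : exists2 h, G h & h (\val (Z n.+1)) = \val y' by apply/prP; rewrite Zc.
have Zn : aball z e (\val (Z n)) by apply: aball_le (hN n Nn); rewrite ge_min lexx.
have /aball_diamond[_ Znr] : aball z r (\val (Z n)).
  by apply: aball_le (hN n Nn); rewrite ge_min lexx orbT.
have hz : ale (h z) (\val y) by apply: ale_trans y'y; rewrite -hZ; exact: (G_ale Gh).
have [h' [Gh' hK h'K]] := subgroup_inv Gh.
have h'id : h' = id.
  apply: hr => //; apply: ale_trans (altW (ashift_alt _ (_ : - r < 0))) _.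
    by rewrite oppr_lt0.
  by rewrite -[X in ale X _]hK; apply: (G_ale Gh'); exact: ale_trans hz (ale_trans yn (altW Znr)).
have zy : ale z (\val y) by rewrite -[z]h'K h'id.
rewrite -yt; apply: he => /=.
exact: aball_convex (aball_center z e0) Zn zy yn.
Qed.

Lemma cosmological_time_vanishes : cosmological_time pr (c t) @[t --> +oo] --> 0%E.
Proof.
have [Z [Zc Zm]] := lift_sequence.
have [z [zZ Zz]] := limit_point Zm.
have [m m0 hm] := domain_depth f_lip (dom_val (Z 0%N)); have [B hB] := domain_bounded f_lip.
have B0 : 0 <= B := le_trans (normr_ge0 _) (hB _ (dom_val (Z 0%N))).
have [/(limit_outside Zc zZ Zz) //|thin] := past_horizon (dom_val (Z 0%N)) (zZ 0%N).
have small (d : R) : 0 < d -> exists N : nat, forall t, N%:R <= t ->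
    (cosmological_time pr (c t) <= d%:E)%E.
  (* [e] makes the term [4 e B] at most [d m]; then [eta] makes [horizon / e] at most [m d] when
     [horizon] is at most [2 eta]. Using [B + 1] keeps the denominator positive. *)
  move=> d0; pose e := d * m / (4 * (B + 1)).
  have B1 : 0 < 4 * (B + 1) by rewrite mulr_gt0 // ltr_wpDl.
  have e0 : 0 < e by rewrite divr_gt0 // mulr_gt0.
  pose eta := e * m * d / 2.
  have eta0 : 0 < eta by rewrite divr_gt0 // mulr_gt0 // mulr_gt0.
  have [q cq qz] := thin eta eta0.
  have [N hN] := Zz eta eta0; exists N => t Nt.
  have [y yN <-] := past_lift (ler0n _ N) Nt c_past (Zc N).
  have y_deep a : D a -> ale a (\val y) -> m <= hgt a.
    by move=> Da ay; apply: hm => //; right; exact: ale_trans ay (ale_trans yN (Zm 0%N N (leq0n _))).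
  apply: le_trans (cosmological_time_le cq e0 m0 y_deep hB) _.
  rewrite lee_fin.
  have hy : horizon q (\val y) <= 2 * eta.
    have := horizon_mono cq yN; have := horizon_near cq (hN N (leqnn _)).
    by move: qz; clear; move: (horizon _ _) (horizon _ _) (horizon _ _) => *; lra.
  rewrite ler_pdivrMr ?mulr_gt0 //.
  have h1 : horizon q (\val y) / e <= m * d.
    rewrite ler_pdivrMr //; apply: le_trans hy _.
    by rewrite (_ : 2 * eta = m * d * e) // /eta; field.
  have h2 : 4 * e * B <= d * m.
    have -> : 4 * e * B = d * m * (B / (B + 1)).
      by rewrite /e; field; rewrite !gt_eqF // ltr_wpDl.
    rewrite ler_piMr ?mulr_ge0 ?(ltW d0) ?(ltW m0) // ler_pdivrMr ?mul1r ?lerDl //.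
    by rewrite ltr_wpDl.
  rewrite (_ : d * (2 * m) = m * d + d * m); last by ring.
  exact: lerD.
apply/fine_cvgP; split.
  have [N hN] := small 1 ltr01; exists N%:R; split; first exact: num_real.
  move=> t /ltW/hN h1 /=; rewrite ge0_fin_numE; last exact: cosmological_time_ge0.
  by apply: le_lt_trans h1 _; rewrite ltry.
apply/cvgrPdist_le => d d0; have [N hN] := small d d0.
exists N%:R; split; first exact: num_real.
move=> t /ltW/hN h1 /=; rewrite sub0r normrN.
have h0 := cosmological_time_ge0 (c t).
rewrite ger0_norm ?fine_ge0 // -lee_fin fineK // ge0_fin_numE //.
by apply: le_lt_trans h1 _; rewrite ltry.
Qed.

End InextendibleCurve.

Lemma orbit_regular_cosmological_time : regular_cosmological_time pr.
Proof.
split=> [m|c]; last exact: cosmological_time_vanishes.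
have [x <-] := pr_surj m.
have [d d0 hd] := domain_depth f_lip (dom_val x); have [B hB] := domain_bounded f_lip.
have [q cq] := @circle_neq0 R.
have x_deep z : D z -> ale z (\val x) -> d <= hgt z by move=> Dz zx; apply: hd => //; right.
exact: le_lt_trans (cosmological_time_le cq ltr01 d0 x_deep hB) (ltry _).
Qed.

End CosmologicalTime.

Theorem proposition10p3 (R : realType) (f : 'rV[R]_3 -> R)
    (L : set (point3 R)) (G : SOhat22_subgroup R)
    (L_achronal : achronal_circle f L)
    (L_generic : ~ pure_lightlike L)
    (G_torsion_free : torsion_free G)
    (G_discrete : discrete_subgroup G)
    (G_preserves : forall g, G g -> preserves g L) :
  let D := invisible_domain f in
  [/\ forall g, G g -> g @` D = D,
      free_action G D,
      properly_discontinuous G D,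
      globally_hyperbolic (@orbit_proj R G D) &
      regular_cosmological_time (@orbit_proj R G D)].
Proof.
move=> D; have [f_lip Lf] := L_achronal; rewrite Lf in G_preserves.
split.
- by move=> g; exact: G_image.
- exact: G_free.
- exact: G_properly_discontinuous.
- exact: orbit_globally_hyperbolic.
- exact: orbit_regular_cosmological_time.
Qed.
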